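(* Let $m,n,r$ be positive integers. Let $\beta\vdash b\le r$ and suppose that $n\ge r+\beta_1$ and $m\ge r-b+[b\neq0]$. Then, as a $(\mathbb C\mathfrak S_m\wr\mathfrak S_n,R_r(m,n))$-bimodule, the tensor space $(\mathbb C^{mn})^{\otimes r}$ has a direct summand isomorphic to $$(\mathbf S_{(m)}\oslash\mathbf S_{\beta[n]})\otimes\Delta_r(\varnothing^\beta).$$ In particular, under these assumptions, $\Delta_r(\varnothing^\beta)=L_r(\varnothing^\beta)$.
   Context: $\beta[n]$ denotes $(n-|\beta|,\beta_1,\beta_2,\dots)$. $[b\ne0]$ is $1$ if $b\ne0$ and $0$ otherwise. $\mathbf S_\lambda$ and $\mathbf S^\lambda$ are the irreducible left and right $\mathbb C\mathfrak S_n$-modules (Specht modules) labelled by $\lambda\vdash n$; $\mathbf S_{(m)}\oslash\mathbf S_{\nu}$ (for $\nu\vdash n$) is the inflation of $\mathbf S_\nu$ along $\mathfrak S_m\wr\mathfrak S_n\to\mathfrak S_n$. Ramified partition algebra. An $(r,s)$-set-partition is a set-partition of the set of northern vertices $1,\dots,r$ and southern vertices $\bar1,\dots,\bar s$; its parts are blocks. An $(r,s)$-set-partition is stacked above an $(s,t)$-set-partition by identifying the southern vertices of the first with the northern vertices of the second, taking connected components, and deleting those components consisting only of middle vertices. A ramified $(r,s)$-set-partition is a pair $(\Lambda,\Lambda')$ of $(r,s)$-set-partitions such that every block of $\Lambda$ (inner block) is contained in a block of $\Lambda'$ (outer block). $R_r(m,n)$ is the $\mathbb C$-algebra with basis the ramified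 $(r,r)$-set-partitions and product given by stacking inner and outer set-partitions separately, multiplied by $m$ for each deleted inner component and $n$ for each deleted outer component. For $0\le b\le r$, $V_r(0^b)$ has basis the ramified $(b,r)$-set-partitions in which each northern vertex is a singleton inner block and lies in an outer block containing at least one southern vertex and no other northern vertex. $\mathfrak S_b$ acts on the left by permuting northern vertices (stacking permutation diagrams above), and $R_r(m,n)$ acts on the right by stacking below with the scalar factors just described, results not in this basis being set to $0$. For $\beta\vdash b$, the standard module is $\Delta_r(\varnothing^\beta)=\mathbf S^\beta\otimes_{\mathbb C\mathfrak S_b}V_r(0^b)$; it has a simple head $L_r(\varnothing^\beta)$. Tensor space. $\mathbb C^{mn}$ has basis $v^j_i$ ($1\le i\le m$, $1\le j\le n$). $\mathfrak S_m\wr\mathfrak S_n$ acts diagonally on the left of $(\mathbb C^{mn})^{\otimes r}$ via $(\sigma_1,\dots,\sigma_n;\pi)v^j_i=v^{\pi(j)}_{\sigma_{\pi(j)}(i)}$. $R_r(m,n)$ acts on the right: $(v^{j_1}_{i_1}\otimes\cdots\otimes v^{j_r}_{i_r})(\Lambda,\Lambda')=\sum v^{j_{\bar1}}_{i_{\bar1}}\otimes\cdots\otimes v^{j_{\bar r}}_{i_{\bar r}}$, the sum over all $i_{\bar1},\dots,i_{\bar r}\in\{1,\dots,m\}$ and $j_{\bar1},\dots,j_{\bar r}\in\{1,\dots,n\}$ such that $i_x=i_y$ whenever $x,y$ are in the same block of $\Lambda$ and $j_x=j_y$ whenever $x,y$ are in the same block of $\Lambda'$ ($x,y\in\{1,\dots,r,\bar1,\dots,\bar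 r\}$). The two actions commute. *)

(* Defs.v *)
From HB Require Import structures.
From mathcomp Require Import all_boot all_order all_algebra all_fingroup.
From mathcomp Require Import boolp reals.
From mathcomp Require classical_sets.
From mathcomp.real_closed Require Import complex.
Set Implicit Arguments.
Unset Strict Implicit.
Unset Printing Implicit Defensive.
Import GRing.Theory VectorInternalTheory.
Local Open Scope ring_scope.

(* A finite-dimensional module over an algebra with a distinguished basis W
   (a group, for a group algebra; the diagrams, for R_r(m, n)) is recorded as
   the family of operators by which the elements of W act.  Submodules,
   homomorphisms, simplicity and radicals only depend on that family.  A bimodule
   with bases G (left) and D (right) is a module on W := G + D. *)

Record module (F : fieldType) (W : Type) := Module {
  module_space :> vectType F;
  operator : W -> 'End(module_space)
}.
Arguments operator {F W} m _.

Section ModuleTheory.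
Variables (F : fieldType) (W : Type).
Implicit Types M N : module F W.

Definition submodule M (U : {vspace M}) : Prop :=
  forall w, (operator M w @: U <= U)%VS.

Definition sub_module M (U : {vspace M}) : module F W :=
  @Module F W (subvs_of U)
    (fun w => linfun (@vsproj _ _ U) \o operator M w \o linfun (@vsval _ _ U))%VF.

(* M / K for a submodule K.  The underlying space is the chosen complement K^C,
   identified with M / K through the projection onto K^C with kernel K. *)
Definition quot_module M (K : {vspace M}) : module F W :=
  @Module F W (subvs_of K^C)
    (fun w => linfun (@vsproj _ _ K^C) \o daddv_pi K^C K \o operator M w
                \o linfun (@vsval _ _ K^C))%VF.

Definition module_hom M N (f : 'Hom(M, N)) : Prop :=
  forall w, (f \o operator M w = operator N w \o f)%VF.

Definition module_iso M N : Prop :=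
  exists f : 'Hom(M, N), module_hom f /\ bijective f.

Definition direct_summand M N : Prop :=
  exists U V : {vspace M},
    [/\ submodule U, submodule V, (U + V)%VS = fullv, (U :&: V)%VS = 0%VS
      & module_iso (sub_module U) N].

Definition simple_module M : Prop :=
  (fullv : {vspace M}) <> 0%VS /\
  forall U : {vspace M}, submodule U -> U = 0%VS \/ U = fullv.

Definition maximal_submodule M (U : {vspace M}) : Prop :=
  [/\ submodule U, U <> fullv
    & forall V : {vspace M}, submodule V -> (U <= V)%VS -> V = U \/ V = fullv].

Definition in_radical M (v : M) : Prop :=
  forall U : {vspace M}, maximal_submodule U -> v \in U.

(* The subspace whose elements are the v with in_radical v; see radicalP. *)
Definition radical M : {vspace M} :=
  classical_sets.xget 0%VS
    (fun K : {vspace M} => forall v : M, v \in K <-> in_radical v).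

Lemma radicalP M (v : M) : v \in radical M <-> in_radical v.
Proof.
suff: exists K : {vspace M}, forall v : M, v \in K <-> in_radical v.
  by move/(classical_sets.xgetPex 0%VS); apply.
pose P d := `[< exists K : {vspace M},
  (forall v, v \in K -> in_radical v) /\ \dim K = d >].
have exP : exists d, P d.
  exists 0%N; apply/asboolP; exists 0%VS; rewrite dimv0; split=> // u.
  by rewrite memv0 => /eqP-> U _; apply: mem0v.
have leP d : P d -> (d <= \dim (fullv : {vspace M}))%N.
  by case/asboolP=> K [_ <-]; apply: dimvS; apply: subvf.
case: (ex_maxnP exP leP) => d /asboolP[K [Krad dK]] maxd; exists K => u.
split=> [/Krad // | radu].
have: P (\dim (K + <[u]>)%VS).
  apply/asboolP; exists (K + <[u]>)%VS; split=> // w.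
  case/memv_addP=> k Kk [_ /vlineP[a ->] ->] U maxU.
  by rewrite rpredD ?rpredZ ?(Krad _ Kk) ?radu.
move/maxd; rewrite -dK => leK.
have /eqP -> : K == (K + <[u]>)%VS by rewrite eqEdim addvSl leK.
by rewrite (subvP (addvSr K <[u]>)) ?memv_line.
Qed.

Definition head_module M : module F W := quot_module (radical M).

End ModuleTheory.

Section LinearAlgebra.
Variable F : fieldType.

Definition free_space (B : finType) : vectType F := {ffun B -> F^o}.

Definition basis_vec (B : finType) (x : B) : free_space B :=
  [ffun y => (y == x)%:R].

(* The linear map sending the basis vector x to \sum_z c x z * z. *)
Definition matrix_map (B B' : finType) (c : B -> B' -> F) :
    'Hom(free_space B, free_space B') :=
  linfun (fun f : free_space B =>
            [ffun z => \sum_x f x * c x z] : free_space B').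

Lemma matrix_mapE (B B' : finType) (c : B -> B' -> F) (f : free_space B) z :
  matrix_map c f z = \sum_x f x * c x z.
Proof.
rewrite /matrix_map; set g := (X in linfun X).
have lin_g : linear g.
  move=> a u v; apply/ffunP=> y; rewrite !ffunE scaler_sumr -big_split /=.
  by apply: eq_bigr => x _; rewrite !ffunE mulrDl scalerAl.
pose G := HB.pack_for {linear free_space B -> free_space B'} g
  (GRing.isLinear.Build _ _ _ _ g lin_g).
by rewrite -[g]/(G : _ -> _) lfunE /= ffunE.
Qed.

(* The tensor product of U and V over F; coordinates are taken in the
   canonical bases of U and V. *)
Definition tensor (U V : vectType F) : vectType F :=
  'M[F]_(dim U, dim V).

Definition pure_tensor (U V : vectType F) (u : U) (v : V) : tensor U V :=
  (v2r u)^T *m v2r v.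

Definition tensor_map (U V : vectType F) (f : 'End(U)) (g : 'End(V)) :
    'End(tensor U V) :=
  linfun (fun A : tensor U V => ((f2mx f)^T *m A *m f2mx g) : tensor U V).

Lemma tensor_mapE (U V : vectType F) (f : 'End(U)) (g : 'End(V)) u v :
  tensor_map f g (pure_tensor u v) = pure_tensor (f u) (g v).
Proof.
rewrite /tensor_map; set h := (X in linfun X).
have lin_h : linear h.
  by move=> a A B; rewrite /h mulmxDr mulmxDl -scalemxAr -scalemxAl.
pose H := HB.pack_for {linear tensor U V -> tensor U V} h
  (GRing.isLinear.Build _ _ _ _ h lin_h).
rewrite -[h]/(H : _ -> _) lfunE /= /h /pure_tensor.
by rewrite unlock /fun_of_lfun_def /= !r2vK trmx_mul !mulmxA.
Qed.

End LinearAlgebra.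

Definition intpart (n : nat) (la : seq nat) : bool :=
  [&& sorted geq la, 0%N \notin la & sumn la == n].

(* beta[n] *)
Definition padded (be : seq nat) (n : nat) : seq nat := (n - sumn be)%N :: be.

(* Permutations are composed as functions, right to left; the product of the
   library is the opposite one. *)
Definition pcomp (T : finType) (s t : {perm T}) : {perm T} := (t * s)%g.

Section Specht.
Variables (F : fieldType) (n : nat) (la : seq nat).

Definition group_alg : vectType F := free_space F 'S_n.

Definition left_regular : module F 'S_n :=
  @Module F 'S_n group_alg
    (fun g => matrix_map (fun h k => (k == pcomp g h)%:R)).

Definition right_regular : module F 'S_n :=
  @Module F 'S_n group_alg
    (fun g => matrix_map (fun h k => (k == pcomp h g)%:R)).

(* Row and column stabilizers of the tableau of shape la that is filled
   with 0, 1, ... along successive rows. *)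
Definition row_perm (s : 'S_n) : bool :=
  [forall i, reshape_index la (s i) == reshape_index la i].

Definition col_perm (s : 'S_n) : bool :=
  [forall i, reshape_offset la (s i) == reshape_offset la i].

Definition young_symmetrizer : group_alg :=
  \sum_(p | row_perm p) \sum_(q | col_perm q)
     (-1) ^+ (odd_perm q) *: basis_vec F (pcomp p q).

Definition specht_left : module F 'S_n :=
  @sub_module F 'S_n left_regular
    <<[seq operator left_regular g young_symmetrizer | g : 'S_n]>>%VS.

Definition specht_right : module F 'S_n :=
  @sub_module F 'S_n right_regular
    <<[seq operator right_regular g young_symmetrizer | g : 'S_n]>>%VS.

End Specht.

(* ((sigma_j)_j; pi) in the wreath product of S_m by S_n. *)
Definition wreath (m n : nat) : Type := ({ffun 'I_n -> 'S_m} * 'S_n)%type.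

Definition inflation (F : fieldType) (m n : nat) (M : module F 'S_n) :
    module F (wreath m n) :=
  @Module F (wreath m n) M (fun g => operator M g.2).

(* inl i is the northern vertex i, inr k the southern vertex k. *)
Definition vertex (r s : nat) : finType := ('I_r + 'I_s)%type.

Section Stacking.
Variables (r s t : nat).
Implicit Types (P : {set {set vertex r s}}) (Q : {set {set vertex s t}}).

(* Northern, middle and southern vertices of two stacked diagrams. *)
Definition vertex3 : finType := ('I_r + 'I_s + 'I_t)%type.

Definition upper (x : vertex r s) : vertex3 := inl x.

Definition lower (x : vertex s t) : vertex3 :=
  match x with inl j => inl (inr j) | inr k => inr k end.

Definition outside (x : vertex r t) : vertex3 :=
  match x with inl i => inl (inl i) | inr k => inr k end.

Definition glue P Q : rel vertex3 := fun x y =>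
  [exists B in P, (x \in upper @: B) && (y \in upper @: B)] ||
  [exists B in Q, (x \in lower @: B) && (y \in lower @: B)].

Definition components P Q : {set {set vertex3}} :=
  equivalence_partition (connect (glue P Q)) [set: vertex3].

Definition stack_part P Q : {set {set vertex r t}} :=
  [set outside @^-1: (C : {set vertex3}) | C in components P Q] :\ set0.

Definition deleted P Q : nat :=
  #|[set C in components P Q | outside @^-1: (C : {set vertex3}) == set0]|.

End Stacking.

Section Ramified.
Variables (r s : nat).

Definition ramified (p : {set {set vertex r s}} * {set {set vertex r s}}) :=
  [&& partition p.1 [set: vertex r s], partition p.2 [set: vertex r s]
    & [forall B in p.1, exists C in p.2, B \subset C]].

Record ram := Ram { ram_val :> {set {set vertex r s}} * {set {set vertex r s}};
                    ram_valP : ramified ram_val }.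
HB.instance Definition _ := [isSub for ram_val].
HB.instance Definition _ := [Finite of ram by <:].

End Ramified.

Section StackRamified.
Variables (r s t : nat).
Implicit Types (P : {set {set vertex r s}}) (Q : {set {set vertex s t}}).

Lemma connect_glue_equiv P Q :
  {in [set: vertex3 r s t] & &, equivalence_rel (connect (glue P Q))}.
Proof.
have sym : connect_sym (glue P Q).
  by apply: sym_connect_sym => x y; rewrite /glue; congr (_ || _);
     apply: eq_existsb => B; rewrite [(x \in _) && _]andbC.
move=> x y z _ _ _; split=> [|xy]; first exact: connect0.
exact: (same_connect sym xy).
Qed.

Lemma stack_part_partition P Q :
  partition (stack_part P Q) [set: vertex r t].
Proof.
have pC := equivalence_partitionP (connect_glue_equiv P Q).
case/and3P: (pC) => /eqP covC tC _; apply/and3P; split.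
- rewrite eqEsubset subsetT; apply/subsetP=> x _.
  have : outside s x \in cover (components P Q) by rewrite covC inE.
  case/bigcupP=> C inC xC; apply/bigcupP; exists (@outside r s t @^-1: C);
    last by rewrite inE.
  rewrite !inE imset_f // andbT; apply/set0Pn; exists x; by rewrite inE.
- apply/trivIsetP=> _ _ /setD1P[_ /imsetP[C inC ->]] /setD1P[_ /imsetP[D inD ->]].
  move=> neq; have CD : C != D by apply: contraNneq neq => ->.
  have := trivIsetP tC _ _ inC inD CD; rewrite -!setI_eq0 => /eqP CD0.
  by rewrite -preimsetI CD0 preimset0.
- by rewrite !inE eqxx.
Qed.

Lemma stack_ramified (x : ram r s) (y : ram s t) :
  ramified (stack_part (ram_val x).1 (ram_val y).1,
            stack_part (ram_val x).2 (ram_val y).2).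
Proof.
have /and3P[_ _ /forall_inP refP] := ram_valP x.
have /and3P[_ _ /forall_inP refQ] := ram_valP y.
case: (ram_val x) (ram_val y) refP refQ => [P P'] [Q Q'] /= refP refQ.
apply/and3P; split; rewrite /= ?stack_part_partition //.
have sub : subrel (connect (glue P Q)) (connect (glue P' Q')).
  apply: connect_sub => u v H; apply: connect1; case/orP: H => /exists_inP[B inB].
    case/andP=> /imsetP[a aB ->] /imsetP[c cB ->]; apply/orP; left.
    have /exists_inP[C inC /subsetP BC] := refP _ inB.
    by apply/exists_inP; exists C; rewrite // !imset_f ?BC.
  case/andP=> /imsetP[a aB ->] /imsetP[c cB ->]; apply/orP; right.
  have /exists_inP[C inC /subsetP BC] := refQ _ inB.
  by apply/exists_inP; exists C; rewrite // !imset_f ?BC.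
apply/forall_inP=> B /setD1P[ne0 /imsetP[_ /imsetP[u _ ->] eqB]].
pose C := @outside r s t @^-1: [set v in [set: vertex3 r s t] | connect (glue P' Q') u v].
have BC : B \subset C.
  by rewrite eqB; apply/subsetP=> v; rewrite !inE => /sub.
apply/exists_inP; exists C => //; rewrite !inE; apply/andP; split.
  by apply: contraNneq ne0 => C0; rewrite -subset0 -C0.
by apply: imset_f; apply: imset_f.
Qed.

Definition stack (x : ram r s) (y : ram s t) : ram r t := Ram (stack_ramified x y).

(* The product x y = m^p n^q (stack x y) of diagrams, where p and q are the
   numbers of deleted inner and outer components, as an element of the space
   with basis ram r t.  For r = s = t this is the product of R_r(m, n). *)
Definition ram_mul (F : fieldType) (m n : nat) (x : ram r s) (y : ram s t) :
    free_space F (ram r t) :=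
  (m%:R ^+ deleted (ram_val x).1 (ram_val y).1 *
   n%:R ^+ deleted (ram_val x).2 (ram_val y).2) *: basis_vec F (stack x y).

End StackRamified.

Section Standard.
Variables (F : fieldType) (m n r b : nat).

Definition standard_diagram (x : ram b r) : bool :=
  [forall i : 'I_b, ([set inl i] \in (ram_val x).1) &&
    [exists C in (ram_val x).2,
      [&& inl i \in C, [exists k : 'I_r, inr k \in C]
        & [forall j : 'I_b, (inl j \in C) ==> (j == i)]]]].

Definition standard_basis : finType := {x : ram b r | standard_diagram x}.

Definition relabel (s : 'S_b) (x : vertex b r) : vertex b r :=
  match x with inl i => inl (s i) | inr k => inr k end.

Definition relabel_part (s : 'S_b) (P : {set {set vertex b r}}) :=
  [set relabel s @: (B : {set vertex b r}) | B in P].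

Definition V_left (s : 'S_b) : 'End(free_space F standard_basis) :=
  matrix_map (fun x z : standard_basis =>
    ((val z : ram b r) ==
      (relabel_part s (ram_val (val x)).1,
       relabel_part s (ram_val (val x)).2) :> _ * _)%:R).

Definition V_right (d : ram r r) : 'End(free_space F standard_basis) :=
  matrix_map (fun x z : standard_basis => ram_mul F m n (val x) d (val z)).

Variable be : seq nat.

Definition Delta_tensor : module F (ram r r) :=
  @Module F (ram r r) (tensor (specht_right F b be) (free_space F standard_basis))
    (fun d => tensor_map \1%VF (V_right d)).

(* Spanned by the (x s) (x) v - x (x) (s v), with s in S_b. *)
Definition Delta_relations : {vspace Delta_tensor} :=
  (\sum_(s : 'S_b)
     limg (tensor_map (operator (specht_right F b be) s) \1%VF
           - tensor_map \1%VF (V_left s)))%VS.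

Definition Delta : module F (ram r r) := quot_module Delta_relations.

Definition L : module F (ram r r) := head_module Delta.

End Standard.

Section Bimodules.
Variables (F : fieldType) (m n r : nat).

Definition outer_tensor (G D : Type) (M : module F G) (N : module F D) :
    module F (G + D) :=
  @Module F (G + D) (tensor M N)
    (fun w => match w with
              | inl g => tensor_map (operator M g) \1%VF
              | inr d => tensor_map \1%VF (operator N d)
              end).

(* The basis vector v^{j_1}_{i_1} (x) ... (x) v^{j_r}_{i_r} is indexed by
   k |-> (i_k, j_k). *)
Definition tindex : finType := {ffun 'I_r -> 'I_m * 'I_n}.

Definition wreath_index (g : wreath m n) (x : tindex) : tindex :=
  [ffun k => (g.1 (g.2 (x k).2) (x k).1, g.2 (x k).2)].

Definition index_at (x z : tindex) (v : vertex r r) : 'I_m * 'I_n :=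
  match v with inl k => x k | inr k => z k end.

Definition compatible (d : ram r r) (x z : tindex) : bool :=
  [forall B in (ram_val d).1, forall u in B, forall v in B,
     (index_at x z u).1 == (index_at x z v).1] &&
  [forall B in (ram_val d).2, forall u in B, forall v in B,
     (index_at x z u).2 == (index_at x z v).2].

Definition tensor_space : module F (wreath m n + ram r r) :=
  @Module F (wreath m n + ram r r) (free_space F tindex)
    (fun w => match w with
              | inl g => matrix_map (fun x z => (z == wreath_index g x)%:R)
              | inr d => matrix_map (fun x z => (compatible d x z)%:R)
              end).

End Bimodules.

(* Main.v *)
From HB Require Import structures.
From mathcomp Require Import all_boot all_order all_algebra all_fingroup zify.
From mathcomp Require boolp.
From mathcomp Require Import reals.
From mathcomp.real_closed Require Import complex.
Require Import Defs.
Set Implicit Arguments.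
Unset Strict Implicit.
Unset Printing Implicit Defensive.
Import Order.TTheory GRing.Theory Num.Theory VectorInternalTheory.
Local Open Scope ring_scope.

(** A half diagram [x] of [V_r(0^b)] acts as an operator [A_x] from the [b]-th to
the [r]-th tensor power, and for elements [s], [t] of the two Specht modules the
vector [psi s t = s . v . t], with [v] the pure tensor whose entries are the
boxes of [be[n]] below the first row, is killed by every non-standard diagram:
its entries are distinct, and it is alternating under exchanging one of them with
the top box of its column.  Hence [s (x) t (x) x |-> A_x (psi s t)] is a bimodule
map from the outer tensor product to tensor space.

It is injective.  If [\sum_x A_x u_x = 0] for a family [u] of such vectors,
equivariant for [S_b], let [u_x0 <> 0] with the southern set-partitions of [x0]
as fine as possible.  Evaluate at a tensor whose coincidences are exactly those
of [x0] and whose entries on the blocks without northern vertex avoid the boxes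
of [be] and the tops of the columns of [be]; the hypotheses on [m] and [n] provide
enough entries.  Antisymmetrizing over the column group kills all terms but
those of the orbit of [x0], so [u_x0] is orthogonal to the very column vectors
that span the space in which it lies.  That [psi] itself is injective follows from
[e g e \in F e] and [e ^+ 2 != 0] for Young symmetrizers [e].

The operators of both algebras on tensor space are closed under conjugate
transposition, so orthogonal complements of submodules are submodules.  Finally a
nonzero submodule of the standard module contains some [A_x (psi e t)] with
[t != 0], because [A_y^* A_x] is a scalar multiple of a diagram on [b] points, which
acts on the vectors [psi e t] by [0] or through [S_b]; this forces the submodule
to be everything. *)

(** * The group algebra *)

Section GroupAlgebra.
Variables (F : numClosedFieldType) (G : finGroupType).
(** A name of its own carries the convolution ring structure; it stays convertible to [group_alg],
    so elements of Specht modules can be multiplied here. *)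
Definition galg := {ffun G -> F^o}.
HB.instance Definition _ := GRing.Lmodule.on galg.
Implicit Types a b c : galg.
Definition gbasis (g : G) : galg := [ffun h => (h == g)%:R].
(** Convolution for the library product of [G]. On ['S_n] this is opposite to [pcomp], so the left
    regular module acts by right multiplication and conversely. *)
Definition gmul a b : galg := [ffun k => \sum_g a g * b (g^-1 * k)%g].

Lemma gmulA : associative gmul.
Proof.
move=> a b c; apply/ffunP=> k; rewrite !ffunE.
under eq_bigr do rewrite ffunE big_distrr /=.
under [RHS]eq_bigr do rewrite ffunE big_distrl /=.
rewrite [RHS]exchange_big /=; apply: eq_bigr => g _.
rewrite [RHS](reindex_inj (mulgI g)) /=; apply: eq_bigr => h _.
by rewrite mulrA mulKg invMg -mulgA.
Qed.

Lemma gmul1l : left_id (gbasis 1%g) gmul.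
Proof.
move=> a; apply/ffunP=> k; rewrite !ffunE (bigD1 1%g) //= big1 => [|g ng].
  by rewrite ffunE eqxx invg1 mul1g mul1r addr0.
by rewrite ffunE (negPf ng) mul0r.
Qed.

Lemma gmul1r : right_id (gbasis 1%g) gmul.
Proof.
move=> a; apply/ffunP=> k; rewrite !ffunE (bigD1 k) //= big1 => [|g ng].
  by rewrite ffunE mulVg eqxx mulr1 addr0.
by rewrite ffunE -eq_mulVg1 (negPf ng) mulr0.
Qed.

Lemma gmulDl : left_distributive gmul +%R.
Proof.
move=> a b c; apply/ffunP=> k; rewrite !ffunE -big_split; apply: eq_bigr => g _.
by rewrite ffunE mulrDl.
Qed.

Lemma gmulDr : right_distributive gmul +%R.
Proof.
move=> a b c; apply/ffunP=> k; rewrite !ffunE -big_split; apply: eq_bigr => g _.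
by rewrite ffunE mulrDr.
Qed.

Lemma gbasis1_neq0 : gbasis 1%g != 0.
Proof. by apply/eqP=> /ffunP/(_ 1%g); rewrite !ffunE eqxx => /eqP; rewrite oner_eq0. Qed.

HB.instance Definition _ :=
  GRing.Zmodule_isNzRing.Build galg gmulA gmul1l gmul1r gmulDl gmulDr gbasis1_neq0.

Lemma gscaleAl (x : F) a b : x *: (a * b) = x *: a * b.
Proof.
apply/ffunP=> k; rewrite !ffunE scaler_sumr; apply: eq_bigr => g _.
by rewrite ffunE scalerAl.
Qed.
HB.instance Definition _ := GRing.Lmodule_isLalgebra.Build F galg gscaleAl.

Lemma gscaleAr (x : F) a b : x *: (a * b) = a * (x *: b).
Proof.
apply/ffunP=> k; rewrite !ffunE scaler_sumr; apply: eq_bigr => g _.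
by rewrite ffunE scalerAr.
Qed.
HB.instance Definition _ := GRing.Lalgebra_isAlgebra.Build F galg gscaleAr.

Lemma galgE a : a = \sum_g a g *: gbasis g.
Proof.
apply/ffunP=> k; rewrite sum_ffunE (bigD1 k) //= big1 => [|g ng].
  by rewrite !ffunE eqxx addr0 /GRing.scale /= mulr1.
by rewrite !ffunE eq_sym (negPf ng) scaler0.
Qed.

Lemma gmulbl g a k : (gbasis g * a) k = a (g^-1 * k)%g.
Proof.
rewrite ffunE (bigD1 g) //= big1 => [|h nh].
  by rewrite ffunE eqxx mul1r addr0.
by rewrite ffunE (negPf nh) mul0r.
Qed.

Lemma gmulbr g a k : (a * gbasis g) k = a (k * g^-1)%g.
Proof.
rewrite ffunE (bigD1 (k * g^-1)%g) //= big1 => [|h nh].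
  by rewrite ffunE invMg invgK mulgKV eqxx mulr1 addr0.
rewrite ffunE; case: eqP => [eg|]; last by rewrite mulr0.
by rewrite -eg invMg invgK mulKVg eqxx in nh.
Qed.

Lemma gbasisM g h : gbasis g * gbasis h = gbasis (g * h)%g.
Proof.
by apply/ffunP=> k; rewrite gmulbl !ffunE -(inj_eq (mulgI g)) mulKVg.
Qed.

(** The conjugate-linear anti-involution inverting group elements. It supplies the positivity that
    replaces semisimplicity arguments below. *)
Definition star a : galg := [ffun g => (a g^-1%g)^*].

Lemma starM a b : star (a * b) = star b * star a.
Proof.
apply/ffunP=> k; rewrite !ffunE rmorph_sum /=.
rewrite (reindex_inj (mulgI k^-1%g)) /=; apply: eq_bigr => g _.
by rewrite rmorphM /= !ffunE mulrC !invMg !invgK mulgK.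
Qed.

(** The coefficient of [star a * a] at the identity is the sum of the squared norms of the
    coefficients of [a]. *)
Lemma star_mul_eq0 a : star a * a = 0 -> a = 0.
Proof.
move=> /ffunP/(_ 1%g); rewrite !ffunE (reindex_inj invg_inj) /= => s0.
have: \sum_g `|a g| ^+ 2 = 0.
  by rewrite -[RHS]s0; apply: eq_bigr => g _; rewrite ffunE !invgK mulg1 normCKC.
move/psumr_eq0P => H; apply/ffunP=> g; rewrite ffunE; apply/eqP.
by rewrite -normr_eq0 -sqrf_eq0 H // => h _; rewrite exprn_ge0.
Qed.

Lemma starK a : star (star a) = a.
Proof. by apply/ffunP=> g; rewrite !ffunE invgK conjCK. Qed.

(* [star a * a] is self-adjoint with square [star a * (a * star a * a) = 0]. *)
Lemma sandwich_eq0 a : (forall x, a * x * a = 0) -> a = 0.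
Proof.
move=> H; apply: star_mul_eq0; apply: star_mul_eq0.
by rewrite starM starK -mulrA [a * _]mulrA H mulr0.
Qed.

End GroupAlgebra.

(** * Young symmetrizers *)

Section Young.
Variables (F : numClosedFieldType) (n : nat) (la : seq nat).
Hypothesis la_n : sumn la = n.
Local Notation ri := (reshape_index la).
Local Notation ci := (reshape_offset la).

Lemma box_lt (i : 'I_n) : (i < sumn la)%N. Proof. by rewrite la_n. Qed.

Lemma box_inj (i j : 'I_n) : ri i = ri j -> ci i = ci j -> i = j.
Proof.
by move=> er ec; apply: val_inj; rewrite /= -(reshape_indexK la i) er ec reshape_indexK.
Qed.

Lemma row_permM (p q : 'S_n) : row_perm la p -> row_perm la q -> row_perm la (p * q)%g.
Proof.
by move=> /forallP hp /forallP hq; apply/forallP=> i; rewrite permM (eqP (hq _)).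
Qed.
Lemma row_permV (p : 'S_n) : row_perm la p -> row_perm la p^-1%g.
Proof.
by move=> /forallP hp; apply/forallP=> i; rewrite -(eqP (hp _)) permKV.
Qed.
Lemma col_permM (p q : 'S_n) : col_perm la p -> col_perm la q -> col_perm la (p * q)%g.
Proof.
by move=> /forallP hp /forallP hq; apply/forallP=> i; rewrite permM (eqP (hq _)).
Qed.
Lemma col_permV (p : 'S_n) : col_perm la p -> col_perm la p^-1%g.
Proof.
by move=> /forallP hp; apply/forallP=> i; rewrite -(eqP (hp _)) permKV.
Qed.
Lemma row_perm1 : row_perm la (1%g : 'S_n).
Proof. by apply/forallP=> i; rewrite perm1. Qed.
Lemma col_perm1 : col_perm la (1%g : 'S_n).
Proof. by apply/forallP=> i; rewrite perm1. Qed.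

(* If no two entries of a column of one tableau share a row of the other, then,
   counting row by row the entries of the first [k] columns, no entry can leave
   the diagram. *)
Lemma column_fits (c : 'I_n -> nat) (g : 'S_n) :
  (forall i, c (g i) = ci i) ->
  (forall i j : 'I_n, ri i = ri j -> c i = c j -> i = j) ->
  forall i : 'I_n, (c i < nth 0%N la (ri i))%N.
Proof.
move=> cg inj i0; set k := nth _ _ _.
pose D (r : nat) := [set i : 'I_n | (ri i == r) && (ci i < k)%N].
pose C (r : nat) := [set i : 'I_n | (ri i == r) && (c i < k)%N].
(* A row of length at most [k] lies in [D r] entirely. In a longer row each entry of [C r] is sent
   to the box of that row in column [c i], injectively by [inj]. *)
have leCD r : (#|C r| <= #|D r|)%N.
  case: (leqP (nth 0%N la r) k) => [le_k|lt_k].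
    apply/subset_leq_card/subsetP=> i; rewrite !inE => /andP[/eqP ir _].
    rewrite ir eqxx (leq_trans _ le_k) // -ir.
    exact: reshape_offsetP (box_lt i).
  pose f (i : 'I_n) : 'I_n := insubd i (flatten_index la r (c i)).
  have fE i : i \in C r -> val (f i) = flatten_index la r (c i).
    rewrite inE => /andP[_ ck]; rewrite val_insubd.
    by have -> : (flatten_index la r (c i) < n)%N
         by rewrite -[X in (_ < X)%N]la_n flatten_indexP ?(ltn_trans ck lt_k).
  rewrite -(@card_in_imset _ _ f (C r)) => [|i j iC jC eqf]; last first.
    have lti : (c i < nth 0 la r)%N
      by move: iC; rewrite inE => /andP[_ ck]; apply: ltn_trans lt_k.
    have ltj : (c j < nth 0 la r)%N
      by move: jC; rewrite inE => /andP[_ ck]; apply: ltn_trans lt_k.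
    apply: inj.
      by move: iC jC; rewrite !inE => /andP[/eqP-> _] /andP[/eqP-> _].
    by rewrite -(flatten_indexKr lti) -(fE _ iC) eqf (fE _ jC) flatten_indexKr.
  apply/subset_leq_card/subsetP=> _ /imsetP[i iC ->]; rewrite inE (fE _ iC).
  have ck : (c i < k)%N by move: iC; rewrite inE => /andP[].
  by rewrite flatten_indexKl ?flatten_indexKr ?eqxx ?(ltn_trans ck lt_k).
have sumC (E : 'I_n -> nat) :
  (\sum_(r < size la) #|[set i : 'I_n | (ri i == r) && (E i < k)]| =
   #|[set i : 'I_n | E i < k]|)%N.
  rewrite -sum1_card (partition_big (fun i : 'I_n => Ordinal (reshape_indexP (box_lt i))) predT) //=.
  apply: eq_bigr => r _; rewrite -sum1_card; apply: eq_bigl => i.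
  by rewrite !inE andbC.
have eqCD : (\sum_(r < size la) #|C r| == \sum_(r < size la) #|D r|)%N.
  rewrite !sumC -[X in _ == X](card_imset _ (@perm_inj _ g)); apply/eqP/eq_card => i.
  apply/idP/imsetP => [|[j + ->]]; rewrite !inE ?cg //.
  by move=> ck; exists (g^-1%g i); rewrite ?inE -?cg permKV.
(* Equal totals force equality in every row. The row of [i0] has length [k], so there [D r] is the
   whole row, and hence so is [C r]. *)
have := leqif_sum (fun (r : 'I_(size la)) (_ : true) => leqif_geq (leCD r)).
case=> _; rewrite eqCD => /esym/forall_inP/(_ (Ordinal (reshape_indexP (box_lt i0))) isT) /=.
set r := ri i0 => leDC.
have sub : C r \subset D r.
  apply/subsetP=> i; rewrite !inE => /andP[/eqP ir _].
  by rewrite ir eqxx /k -/r -ir reshape_offsetP ?box_lt.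
have : i0 \in D r by rewrite inE eqxx reshape_offsetP ?box_lt.
have /eqP <- : C r == D r by rewrite eqEcard sub.
by rewrite inE => /andP[].
Qed.

(** Von Neumann's combinatorial lemma. In the second case every entry is moved within its row to the
    column it had before [g]; [column_fits] says that this box exists. *)
Lemma young_factorization (g : 'S_n) :
  (exists x y : 'I_n, [/\ x != y, ci x = ci y & ri (g x) = ri (g y)]) \/
  (exists q p : 'S_n, [/\ col_perm la q, row_perm la p & g = (q * p)%g]).
Proof.
case: (boolP [exists x : 'I_n, exists y : 'I_n,
   [&& x != y, ci x == ci y & ri (g x) == ri (g y)]]) => [|none].
  by case/existsP=> x /existsP[y /and3P[? /eqP? /eqP?]]; left; exists x, y.
right; pose c (i : 'I_n) := ci (g^-1%g i).
have inj (i j : 'I_n) : ri i = ri j -> c i = c j -> i = j.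
  move=> er ec; apply: contraNeq none => ij.
  apply/existsP; exists (g^-1%g i); apply/existsP; exists (g^-1%g j).
  by rewrite !permKV er -[ci _]/(c i) ec !eqxx (inj_eq perm_inj) ij.
have fit := @column_fits c g (fun i => congr1 (fun z : 'I_n => ci z) (permK g i)) inj.
have lt (i : 'I_n) : (flatten_index la (ri i) (c i) < n)%N.
  by rewrite -[X in (_ < X)%N]la_n flatten_indexP.
pose P0 i := Ordinal (lt i).
have P0inj : injective P0.
  move=> i j /(congr1 val) /= e; apply: inj.
    by rewrite -(flatten_indexKl (fit i)) e flatten_indexKl.
  by rewrite -(flatten_indexKr (fit i)) e flatten_indexKr.
pose P := perm P0inj; exists (g * P)%g, P^-1%g; split; last by rewrite mulgK.
  by apply/forallP=> i; rewrite permM permE /= flatten_indexKr // /c permK.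
apply: row_permV; apply/forallP=> i.
by rewrite permE /= flatten_indexKl.
Qed.

Definition row_sum : galg F 'S_n := \sum_(p | row_perm la p) gbasis F p.
Definition col_sum : galg F 'S_n :=
  \sum_(q | col_perm la q) (-1) ^+ (odd_perm q) *: gbasis F q.

Lemma row_permMl (p q : 'S_n) : row_perm la p -> row_perm la (p * q)%g = row_perm la q.
Proof.
move=> hp; apply/idP/idP => [h|]; last exact: row_permM.
by rewrite -[q](mulKg p) row_permM ?row_permV.
Qed.
Lemma col_permMl (p q : 'S_n) : col_perm la p -> col_perm la (p * q)%g = col_perm la q.
Proof.
move=> hp; apply/idP/idP => [h|]; last exact: col_permM.
by rewrite -[q](mulKg p) col_permM ?col_permV.
Qed.
Lemma col_permMr (p q : 'S_n) : col_perm la p -> col_perm la (q * p)%g = col_perm la q.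
Proof.
move=> hp; apply/idP/idP => [h|]; last by move=> h; apply: col_permM.
by rewrite -[q](mulgK p) col_permM ?col_permV.
Qed.

Lemma row_sumM p : row_perm la p -> gbasis F p * row_sum = row_sum.
Proof.
move=> hp; rewrite /row_sum mulr_sumr [RHS](reindex_inj (mulgI p)) /=.
by apply: eq_big => q; rewrite ?row_permMl // gbasisM.
Qed.

Lemma signM2 (s t : 'S_n) : (-1) ^+ odd_perm (s * t) = (-1) ^+ odd_perm s * (-1) ^+ odd_perm t :> F.
Proof. by rewrite odd_permM signr_addb. Qed.

Lemma col_sumM q : col_perm la q -> col_sum * gbasis F q = (-1) ^+ odd_perm q *: col_sum.
Proof.
move=> hq; rewrite /col_sum mulr_suml [X in _ *: X](reindex_inj (mulIg q)) scaler_sumr /=.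
apply: eq_big => p; rewrite ?col_permMr // => _.
by rewrite -scalerAl gbasisM scalerA signM2 mulrCA -expr2 sqrr_sign mulr1.
Qed.

Lemma col_sum_idem : exists2 c : F, c != 0 & col_sum * col_sum = c *: col_sum.
Proof.
exists (#|[set q : 'S_n | col_perm la q]|)%:R.
  by rewrite pnatr_eq0 -lt0n; apply/card_gt0P; exists 1%g; rewrite inE col_perm1.
rewrite {2}/col_sum mulr_sumr (eq_bigr (fun=> col_sum)) => [|q hq]; last first.
  by rewrite -scalerAr col_sumM // scalerA -expr2 sqrr_sign scale1r.
by rewrite sumr_const cardsE scaler_nat.
Qed.

Lemma row_sum_idem : exists2 c : F, c != 0 & row_sum * row_sum = c *: row_sum.
Proof.
exists (#|[set q : 'S_n | row_perm la q]|)%:R.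
  by rewrite pnatr_eq0 -lt0n; apply/card_gt0P; exists 1%g; rewrite inE row_perm1.
rewrite {1}/row_sum mulr_suml (eq_bigr (fun=> row_sum)) => [|q hq]; last exact: row_sumM.
by rewrite sumr_const cardsE scaler_nat.
Qed.

Lemma star_row_sum : star row_sum = row_sum.
Proof.
apply/ffunP=> g; rewrite !ffunE !sum_ffunE rmorph_sum (reindex_inj invg_inj) /=.
apply: eq_big => p.
  by apply/idP/idP => /row_permV; rewrite ?invgK.
by move=> _; rewrite !ffunE (inj_eq invg_inj) conjC_nat.
Qed.

Lemma star_col_sum : star col_sum = col_sum.
Proof.
apply/ffunP=> g; rewrite !ffunE !sum_ffunE rmorph_sum (reindex_inj invg_inj) /=.
apply: eq_big => p.
  by apply/idP/idP => /col_permV; rewrite ?invgK.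
by move=> _; rewrite !ffunE (inj_eq invg_inj) odd_permV rmorphM /= rmorph_sign conjC_nat.
Qed.

(* The product of ['S_n] is the opposite of [pcomp], whence the order of the factors. *)
Definition symmetrizer : galg F 'S_n := col_sum * row_sum.

Lemma symmetrizerE : symmetrizer = young_symmetrizer F n la.
Proof.
rewrite /symmetrizer /young_symmetrizer /col_sum /row_sum mulr_suml exchange_big /=.
apply: eq_bigr => q _; rewrite mulr_sumr; apply: eq_bigr => p _.
by rewrite -scalerAl gbasisM.
Qed.

(** The coefficient at the identity is 1: a permutation preserving both rows and columns fixes every
    box. *)
Lemma symmetrizer_neq0 : symmetrizer != 0.
Proof.
apply/eqP=> /ffunP/(_ 1%g); rewrite /symmetrizer /col_sum mulr_suml sum_ffunE.
rewrite (bigD1 1%g) ?col_perm1 //= big1 => [|q /andP[hq nq]].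
  rewrite odd_perm1 expr0 scale1r addr0 mul1r /row_sum sum_ffunE (bigD1 1%g) ?row_perm1 //= big1.
    by rewrite !ffunE eqxx addr0 => /eqP; rewrite oner_eq0.
  by move=> p /andP[_ np]; rewrite ffunE eq_sym (negPf np).
rewrite -scalerAl mulr_sumr ffunE sum_ffunE big1 ?scaler0 // => p hp.
rewrite gbasisM ffunE; case: eqP => // /esym/eqP; rewrite mulg_eq1 => /eqP qp.
case/eqP: nq; apply/permP=> i; rewrite perm1; apply: box_inj; last exact/eqP/(forallP hq).
by rewrite qp; apply/eqP/(forallP (row_permV hp)).
Qed.

(** For a group element, [young_factorization] either lets both factors be absorbed up to sign, or
    gives a row transposition that becomes a column transposition on the other side of [g], so that
    the product equals its own negative. *)
Lemma col_row_sandwich (x : galg F 'S_n) :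
  exists c : F, col_sum * x * row_sum = c *: symmetrizer.
Proof.
have step g : exists c : F, col_sum * gbasis F g * row_sum = c *: symmetrizer.
  case: (young_factorization g) => [[x1 [y [nxy exy gxy]]]|[q [p [hq hp ->]]]]; last first.
    exists ((-1) ^+ odd_perm q).
    by rewrite -gbasisM mulrA col_sumM // -!scalerAl -mulrA row_sumM.
  exists 0; rewrite scale0r; set z := _ * _.
  have tc : col_perm la (tperm x1 y).
    by apply/forallP=> i; case: tpermP => // ->; rewrite exy.
  have tr : row_perm la (tperm (g x1) (g y)).
    by apply/forallP=> i; case: tpermP => // ->; rewrite gxy.
  have : z = - z.
    rewrite {1}/z -(row_sumM tr) mulrA -[_ * gbasis _ g * _]mulrA gbasisM.
    have -> : (g * tperm (g x1) (g y) = tperm x1 y * g)%g.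
      by rewrite -tpermJ /conjg mulgA mulgA mulgV mul1g.
    by rewrite -gbasisM mulrA col_sumM // odd_tperm nxy scaleN1r !mulNr.
  move/eqP; rewrite -addr_eq0 -mulr2n -scaler_nat scaler_eq0 pnatr_eq0 /=.
  by move/eqP.
have [c cP] := boolp.choice step.
exists (\sum_g x g * c g); rewrite {1}(galgE x) scaler_suml.
rewrite (big_distrr col_sum) (big_distrl row_sum) /=.
by apply: eq_bigr => g _; rewrite -scalerAr -scalerAl cP scalerA.
Qed.

Lemma symmetrizer_sandwich (x : galg F 'S_n) :
  exists c : F, symmetrizer * x * symmetrizer = c *: symmetrizer.
Proof.
have [c cP] := col_row_sandwich (row_sum * x * col_sum).
by exists c; rewrite -cP /symmetrizer !mulrA.
Qed.

(** If the square vanished, the self-adjoint element [z] would have square 0 and vanish. But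
    [star symmetrizer * symmetrizer] is a multiple of [z], so the symmetrizer would vanish too. *)
Lemma symmetrizer_sqr_neq0 : symmetrizer * symmetrizer != 0.
Proof.
have [c c0 cP] := col_sum_idem; have [d d0 dP] := row_sum_idem.
apply/negP=> /eqP H; case/eqP: symmetrizer_neq0.
pose z := row_sum * col_sum * row_sum.
have zz : z * z = 0.
  have -> : z * z = d *: (row_sum * (symmetrizer * symmetrizer)).
    have -> : z * z = row_sum * col_sum * (row_sum * row_sum) * col_sum * row_sum.
      by rewrite /z !mulrA.
    by rewrite dP -!scalerAr -!scalerAl /symmetrizer !mulrA.
  by rewrite H mulr0 scaler0.
have z0 : z = 0.
  have sz : star z = z by rewrite /z !starM star_row_sum star_col_sum mulrA.
  by apply: star_mul_eq0; rewrite sz zz.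
apply: star_mul_eq0; rewrite /symmetrizer starM star_row_sum star_col_sum.
by rewrite mulrA -[row_sum * _ * _]mulrA cP -scalerAr -scalerAl -/z z0 scaler0.
Qed.

(** With the next lemma: the pairing of the right and the left ideal of the symmetrizer, whose
    values are scalar multiples of it, is nondegenerate on either side. *)
Lemma right_ideal_faithful (y : galg F 'S_n) :
  (forall x, symmetrizer * y * x * symmetrizer = 0) -> symmetrizer * y = 0.
Proof.
by move=> H; apply: sandwich_eq0 => x; rewrite mulrA H mul0r.
Qed.

Lemma left_ideal_faithful (y : galg F 'S_n) :
  (forall x, symmetrizer * x * (y * symmetrizer) = 0) -> y * symmetrizer = 0.
Proof.
by move=> H; apply: sandwich_eq0 => x; rewrite -[y * _ * x]mulrA -mulrA H mulr0.
Qed.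

End Young.

(** * Stacking diagrams and counting labellings *)

Local Open Scope nat_scope.

(** * Set-partitions as equivalence relations *)

Section SameBlock.
Variable T : finType.
Implicit Types (P : {set {set T}}) (u v w : T).

(** Diagrams are compared through this relation, which determines a partition by [partition_eq]. *)
Definition same P u v := [exists B in P, (u \in B) && (v \in B)].

Definition constant_on P (A : eqType) (f : T -> A) :=
  [forall B in P, forall u in B, forall v in B, f u == f v].

Lemma constant_onP P (A : eqType) (f : T -> A) :
  reflect (forall u v, same P u v -> f u = f v) (constant_on P f).
Proof.
apply: (iffP forall_inP) => [H u v /exists_inP[B inB /andP[uB vB]]|H B inB].
  by have /forall_inP/(_ u uB)/forall_inP/(_ v vB)/eqP := H B inB.
apply/forall_inP=> u uB; apply/forall_inP=> v vB; apply/eqP/H.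
by apply/exists_inP; exists B => //; rewrite uB.
Qed.

Section Partition.
Variable P : {set {set T}}.
Hypothesis partP : partition P [set: T].

Lemma same_pblock u v : same P u v = (v \in pblock P u).
Proof.
have inP : u \in cover P by rewrite (cover_partition partP) inE.
apply/exists_inP/idP => [[B inB /andP[uB vB]]|vu].
  by rewrite (def_pblock (partition_trivIset partP) inB uB).
by exists (pblock P u); rewrite ?pblock_mem // mem_pblock inP.
Qed.

Lemma same_refl u : same P u u.
Proof. by rewrite same_pblock mem_pblock (cover_partition partP) inE. Qed.

Lemma same_sym u v : same P u v = same P v u.
Proof. by apply: eq_existsb => B; rewrite [(u \in B) && _]andbC. Qed.

Lemma same_trans u v w : same P u v -> same P v w -> same P u w.
Proof.
rewrite !same_pblock => uv; suff /eqP-> : pblock P u == pblock P v by [].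
by rewrite eq_pblock ?(cover_partition partP) ?inE ?(partition_trivIset partP).
Qed.

End Partition.

Lemma partition_eq P Q : partition P [set: T] -> partition Q [set: T] ->
  (forall u v, same P u v = same Q u v) -> P = Q.
Proof.
have sub P' Q' : partition P' [set: T] -> partition Q' [set: T] ->
    (forall u v, same P' u v = same Q' u v) -> P' \subset Q'.
  move=> pP pQ eqs; apply/subsetP=> B inB.
  have /set0Pn[u uB] := partition_neq0 pP inB.
  rewrite -(def_pblock (partition_trivIset pP) inB uB).
  have -> : pblock P' u = pblock Q' u.
    by apply/setP=> v; rewrite -!same_pblock.
  by rewrite pblock_mem ?(cover_partition pQ) ?inE.
by move=> pP pQ eqs; apply/eqP; rewrite eqEsubset !sub // => u v; rewrite eqs.
Qed.

End SameBlock.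

Lemma same_imset (T T' : finType) (f : T -> T') (P : {set {set T}}) u v :
  injective f ->
  same [set f @: (B : {set T}) | B in P] (f u) (f v) = same P u v.
Proof.
move=> inj; apply/exists_inP/exists_inP => [[_ /imsetP[B inB ->]]|[B inB]].
  by rewrite !(mem_imset _ _ inj) => H; exists B.
by move=> uv; exists (f @: B); [exact: imset_f | rewrite !(mem_imset _ _ inj)].
Qed.

(** * Labellings of two stacked set-partitions *)

Section Stack.
Variables (r s t : nat) (P : {set {set vertex r s}}) (Q : {set {set vertex s t}}).
Local Notation con := (connect (glue P Q)).
Local Notation V := (vertex3 r s t).

Definition label (A : Type) k l (a : 'I_k -> A) (z : 'I_l -> A) (v : vertex k l) : A :=
  match v with inl i => a i | inr j => z j end.

Definition label3 (A : Type) (a : 'I_r -> A) (y : 'I_s -> A) (z : 'I_t -> A) (v : V) : A :=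
  match v with inl (inl i) => a i | inl (inr j) => y j | inr k => z k end.

Lemma glue_con_sym : connect_sym (glue P Q).
Proof.
apply: sym_connect_sym => x y; rewrite /glue; congr (_ || _);
  by apply: eq_existsb => B; rewrite [(x \in _) && _]andbC.
Qed.

Lemma same_stack u v :
  same (stack_part P Q) u v = con (outside s u) (outside s v).
Proof.
apply/exists_inP/idP => [[B /setD1P[_ /imsetP[C /imsetP[w _ ->] ->]]]|uv].
  rewrite !inE /= => /andP[wu wv]; apply: connect_trans wv.
  by rewrite glue_con_sym.
pose C := [set x in [set: V] | con (outside s u) x].
exists (@outside r s t @^-1: C); last by rewrite !inE connect0.
rewrite !inE imset_f ?imset_f // andbT; apply/set0Pn; exists u.
by rewrite !inE connect0.
Qed.

Lemma label3P (A : eqType) (a : 'I_r -> A) (y : 'I_s -> A) (z : 'I_t -> A) :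
  reflect (forall u v, con u v -> label3 a y z u = label3 a y z v)
          (constant_on P (label a y) && constant_on Q (label y z)).
Proof.
have upE u : label3 a y z (upper t u) = label a y u by case: u.
have loE u : label3 a y z (@lower r s t u) = label y z u by case: u.
apply: (iffP andP) => [[/constant_onP hP /constant_onP hQ] u v|H].
  case/connectP=> p + ->; elim: p u => //= w p IHp u /andP[uw /IHp <-].
  case/orP: uw => /exists_inP[B inB /andP[/imsetP[u' uB ->] /imsetP[w' wB ->]]].
    by rewrite !upE; apply: hP; apply/exists_inP; exists B => //; rewrite uB.
  by rewrite !loE; apply: hQ; apply/exists_inP; exists B => //; rewrite uB.
split; apply/constant_onP=> u v /exists_inP[B inB /andP[uB vB]].
  rewrite -!upE; apply: H; apply: connect1; apply/orP; left.
  by apply/exists_inP; exists B; rewrite ?imset_f.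
rewrite -!loE; apply: H; apply: connect1; apply/orP; right.
by apply/exists_inP; exists B; rewrite ?imset_f.
Qed.

(* A labelling of the middle vertices compatible with both diagrams is forced on
   the components that reach an outside vertex and free on the deleted ones. *)
Lemma card_stack (A : finType) (a0 : A) (a : 'I_r -> A) (z : 'I_t -> A) :
  #|[set y : {ffun 'I_s -> A} | constant_on P (label a y) && constant_on Q (label y z)]|
  = #|A| ^ deleted P Q * constant_on (stack_part P Q) (label a z).
Proof.
have outE y u : label3 a y z (outside s u) = label a z u by case: u.
case: (boolP (constant_on _ _)) => [/constant_onP cst|ncst]; last first.
  rewrite muln0; apply: eq_card0 => y; rewrite inE; apply: contraNF ncst.
  move=> /label3P H; apply/constant_onP=> u v; rewrite same_stack => /H.
  by rewrite !outE.
pose cl u := [set v in [set: V] | con u v].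
have clE u v : (v \in cl u) = con u v by rewrite !inE.
have cl_eq u v : con u v -> cl u = cl v.
  by move=> uv; apply/setP=> w; rewrite !clE (same_connect glue_con_sym uv).
pose D := [set C in components P Q | @outside r s t @^-1: (C : {set V}) == set0].
pose T := {C : {set V} | C \in D}.
(* The default [a0] only occurs on deleted components, where [ext] uses the free value [phi]
   instead. *)
pose out u := odflt a0 (omap (label a z) [pick p | outside s p \in cl u]).
have outP u p : outside s p \in cl u -> out u = label a z p.
  rewrite /out => pu; case: pickP => [q qu|/(_ p)]; last by rewrite pu.
  apply: cst; rewrite same_stack; apply: connect_trans (_ : con u _).
    by rewrite glue_con_sym -clE.
  by rewrite -clE.
pose ext (phi : {ffun T -> A}) : {ffun 'I_s -> A} :=
  [ffun j => if insub (cl (inl (inr j))) is Some c then phi c else out (inl (inr j))].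
have mid C : C \in D -> exists j, C = cl (inl (inr j)).
  rewrite inE => /andP[/imsetP[u _ ->] /eqP C0]; move: C0.
  case: u => [[i|j]|k] C0; last 2 [by exists j].
    have : (inl i : vertex r t) \in (set0 : {set vertex r t}) by rewrite -C0 !inE connect0.
    by rewrite inE.
  have : (inr k : vertex r t) \in (set0 : {set vertex r t}) by rewrite -C0 !inE connect0.
  by rewrite inE.
have extinj : injective ext.
  move=> p q /ffunP epq; apply/ffunP=> [[C CD]]; have [j Cj] := mid C CD.
  have := epq j; rewrite !ffunE -Cj; case: insubP => [c _ cC|]; last by rewrite CD.
  by have -> : c = exist _ C CD by apply: val_inj.
have -> : [set y : {ffun 'I_s -> A} | constant_on P (label a y) && constant_on Q (label y z)]
        = ext @: [set: {ffun T -> A}].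
  apply/setP=> y; rewrite inE; apply/label3P/imsetP => [H|[phi _ ->] u v uv].
    pose phi : {ffun T -> A} := [ffun c : T =>
      odflt a0 (omap y [pick j | val c == cl (inl (inr j))])].
    exists phi => //; apply/ffunP=> j; rewrite ffunE; case: insubP => [c _ cE|nD].
      rewrite ffunE; case: pickP => [j' /eqP cE'|/(_ j)]; last by rewrite cE eqxx.
      apply: (H (inl (inr j)) (inl (inr j'))); rewrite -clE -cE cE' clE; exact: connect0.
    have : @outside r s t @^-1: cl (inl (inr j)) != set0.
      apply: contraNneq nD => C0; rewrite inE C0 eqxx andbT; exact: imset_f.
    case/set0Pn=> p; rewrite inE => pj; rewrite (outP _ _ pj) -(outE y).
    by apply: (H (inl (inr j))); rewrite -clE.
  (* [val3] depends on the component of [u] only, so it suffices to identify the labelling with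
     it. *)
  pose val3 u := if insub (cl u) is Some c then phi c else out u.
  suff val3E w : label3 a (ext phi) z w = val3 w.
    by rewrite !val3E /val3 (cl_eq _ _ uv); case: insub => // ; rewrite /out (cl_eq _ _ uv).
  have outw p : val3 (outside s p) = label a z p.
    rewrite /val3; case: insubP => [c + cE|_]; last by apply: outP; rewrite clE connect0.
    rewrite inE => /andP[_ /eqP C0].
    have : p \in (set0 : {set vertex r t}) by rewrite -C0 inE clE connect0.
    by rewrite inE.
  case: w => [[i|j]|k]; last by rewrite (outw (inr k)).
    by rewrite (outw (inl i)).
  by rewrite /val3 /= ffunE.
by rewrite card_imset // cardsT card_ffun card_sig muln1; congr (_ ^ _); apply: eq_card.
Qed.

End Stack.

(** * Ramified diagrams as pairs of nested relations *)

Section RamSame.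
Variables k l : nat.
Implicit Types d : ram k l.

Definition inner d := same (ram_val d).1.
Definition outer d := same (ram_val d).2.

Lemma inner_part d : partition (ram_val d).1 [set: vertex k l].
Proof. by have /and3P[] := ram_valP d. Qed.
Lemma outer_part d : partition (ram_val d).2 [set: vertex k l].
Proof. by have /and3P[] := ram_valP d. Qed.

Lemma inner_outer d u v : inner d u v -> outer d u v.
Proof.
case/exists_inP=> B inB /andP[uB vB].
have /and3P[_ _ /forall_inP/(_ B inB)/exists_inP[C inC /subsetP sBC]] := ram_valP d.
by apply/exists_inP; exists C; rewrite ?sBC.
Qed.

Lemma inner_sym d u v : inner d u v = inner d v u. Proof. exact: same_sym. Qed.
Lemma outer_sym d u v : outer d u v = outer d v u. Proof. exact: same_sym. Qed.
Lemma inner_refl d u : inner d u u. Proof. exact: same_refl (inner_part d) u. Qed.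
Lemma outer_refl d u : outer d u u. Proof. exact: same_refl (outer_part d) u. Qed.
Lemma inner_trans d u v w : inner d u v -> inner d v w -> inner d u w.
Proof. exact: same_trans (inner_part d) u v w. Qed.
Lemma outer_trans d u v w : outer d u v -> outer d v w -> outer d u w.
Proof. exact: same_trans (outer_part d) u v w. Qed.

Lemma ram_eq d d' : inner d =2 inner d' -> outer d =2 outer d' -> d = d'.
Proof.
move=> ei eo; apply: val_inj; rewrite /= [ram_val d]surjective_pairing [RHS]surjective_pairing.
congr pair; apply: partition_eq => //; by [exact: inner_part | exact: outer_part].
Qed.

End RamSame.

Section Image.
Variables (k l k' l' : nat) (f : vertex k l -> vertex k' l').
Hypothesis bij_f : bijective f.
Variable d : ram k l.

Let inj_f : injective f := bij_inj bij_f.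

Lemma ramified_image :
  ramified ([set f @: (B : {set vertex k l}) | B in (ram_val d).1],
            [set f @: (B : {set vertex k l}) | B in (ram_val d).2]).
Proof.
have fT : [set: vertex k' l'] = f @: [set: vertex k l].
  case: bij_f => g _ gK; apply/setP=> v; rewrite inE; apply/esym/imsetP.
  by exists (g v).
have /and3P[p1 p2 /forall_inP ref] := ram_valP d.
apply/and3P; split; rewrite ?fT ?imset_partition //=.
apply/forall_inP=> _ /imsetP[B inB ->].
have /exists_inP[C inC BC] := ref _ inB.
by apply/exists_inP; exists (f @: C); rewrite ?imset_f ?imsetS.
Qed.

(** Both the reflection of a diagram and the permutation of its northern vertices are instances. *)
Definition ram_image : ram k' l' := Ram ramified_image.

Lemma inner_image u v : inner ram_image (f u) (f v) = inner d u v.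
Proof. exact: same_imset. Qed.
Lemma outer_image u v : outer ram_image (f u) (f v) = outer d u v.
Proof. exact: same_imset. Qed.

End Image.

Section Flip.
Variables k l : nat.
Definition turn k l (v : vertex k l) : vertex l k :=
  match v with inl i => inr i | inr j => inl j end.
Lemma turn_bij : bijective (@turn k l).
Proof. by exists (@turn l k); case. Qed.
Definition flip (d : ram k l) : ram l k := ram_image turn_bij d.
End Flip.

Lemma eq_constant_on (T : finType) (P : {set {set T}}) (A : eqType) (f g : T -> A) :
  f =1 g -> constant_on P f = constant_on P g.
Proof.
by move=> e; apply/constant_onP/constant_onP => H u v uv; move: (H u v uv); rewrite !e.
Qed.

(** * Compatibility of tensor indices with a diagram *)

Section Compat.
Variables m n : nat.
Local Notation tindex := (tindex m n).

(** Rectangular version of [compatible], so that half diagrams act between different tensor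
    powers. *)
Definition tcompat k l (d : ram k l) (x : tindex k) (z : tindex l) :=
  constant_on (ram_val d).1 (label (fun i => (x i).1) (fun j => (z j).1)) &&
  constant_on (ram_val d).2 (label (fun i => (x i).2) (fun j => (z j).2)).

Lemma compatibleE r (d : ram r r) (x z : tindex r) : compatible d x z = tcompat d x z.
Proof. by congr (_ && _); apply: eq_constant_on; case. Qed.

Lemma tcompatP k l (d : ram k l) (x : tindex k) (z : tindex l) :
  reflect ((forall u v, inner d u v -> (label x z u).1 = (label x z v).1) /\
           (forall u v, outer d u v -> (label x z u).2 = (label x z v).2))
          (tcompat d x z).
Proof.
have e1 v : label (fun i => (x i).1) (fun j => (z j).1) v = (label x z v).1 by case: v.
have e2 v : label (fun i => (x i).2) (fun j => (z j).2) v = (label x z v).2 by case: v.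
apply: (iffP andP) => [[/constant_onP h1 /constant_onP h2]|[h1 h2]].
  by split=> u v; [rewrite -!e1; apply: h1 | rewrite -!e2; apply: h2].
by split; apply/constant_onP=> u v; rewrite ?e1 ?e2; [apply: h1 | apply: h2].
Qed.

Lemma tcompat_image k l k' l' (f : vertex k l -> vertex k' l') (bij_f : bijective f)
    (d : ram k l) (x : tindex k) (z : tindex l) (x' : tindex k') (z' : tindex l') :
  (forall v, label x' z' (f v) = label x z v) ->
  tcompat (ram_image bij_f d) x' z' = tcompat d x z.
Proof.
move=> lf; case: (bij_f) => g fK gK.
apply/tcompatP/tcompatP => [[h1 h2]|[h1 h2]]; split=> u v.
- by rewrite -!lf => uv; apply: h1; rewrite inner_image.
- by rewrite -!lf => uv; apply: h2; rewrite outer_image.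
- by rewrite -(gK u) -(gK v) !lf inner_image => /h1.
- by rewrite -(gK u) -(gK v) !lf outer_image => /h2.
Qed.

Lemma tcompat_flip k l (d : ram k l) (x : tindex k) (z : tindex l) : tcompat (flip d) z x = tcompat d x z.
Proof. by apply: tcompat_image; case. Qed.

Definition pair_index k (y : {ffun 'I_k -> 'I_m} * {ffun 'I_k -> 'I_n}) : tindex k :=
  [ffun i => (y.1 i, y.2 i)].
Definition unpair_index k (x : tindex k) : {ffun 'I_k -> 'I_m} * {ffun 'I_k -> 'I_n} :=
  ([ffun i => (x i).1], [ffun i => (x i).2]).
Lemma pair_indexK k : cancel (@pair_index k) (@unpair_index k).
Proof. by case=> y1 y2; congr pair; apply/ffunP=> i; rewrite !ffunE. Qed.
Lemma unpair_indexK k : cancel (@unpair_index k) (@pair_index k).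
Proof. by move=> x; apply/ffunP=> i; rewrite !ffunE -surjective_pairing. Qed.

Hypotheses (m_gt0 : 0 < m) (n_gt0 : 0 < n).

(** Diagram multiplication becomes matrix multiplication. Inner and outer labels of the middle
    vertices are chosen independently, so the sum splits into two counts evaluated by
    [card_stack]. *)
Lemma sum_tcompat k l h (d : ram k l) (d' : ram l h) (x : tindex k) (z : tindex h) :
  \sum_(y : tindex l) tcompat d x y * tcompat d' y z =
  m ^ deleted (ram_val d).1 (ram_val d').1 * n ^ deleted (ram_val d).2 (ram_val d').2
  * tcompat (stack d d') x z.
Proof.
rewrite (reindex (@pair_index l)) /=; last first.
  by exists (@unpair_index l) => y _; rewrite ?pair_indexK ?unpair_indexK.
rewrite (eq_bigr (fun y : {ffun 'I_l -> 'I_m} * {ffun 'I_l -> 'I_n} =>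
  (constant_on (ram_val d).1 (label (fun i => (x i).1) y.1) &&
   constant_on (ram_val d').1 (label y.1 (fun j => (z j).1))) *
  (constant_on (ram_val d).2 (label (fun i => (x i).2) y.2) &&
   constant_on (ram_val d').2 (label y.2 (fun j => (z j).2))))); last first.
  case=> y1 y2 _; rewrite /tcompat !mulnb andbACA; congr (nat_of_bool _).
  by congr ((_ && _) && (_ && _)); apply: eq_constant_on; case=> // i; rewrite /= ffunE.
rewrite -(pair_big predT predT (fun y1 y2 =>
  (constant_on (ram_val d).1 (label (fun i => (x i).1) (y1 : {ffun 'I_l -> 'I_m})) &&
   constant_on (ram_val d').1 (label y1 (fun j => (z j).1))) *
  (constant_on (ram_val d).2 (label (fun i => (x i).2) (y2 : {ffun 'I_l -> 'I_n})) &&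
   constant_on (ram_val d').2 (label y2 (fun j => (z j).2))))) /=.
have sumE (I : finType) (p : pred I) : \sum_i nat_of_bool (p i) = #|[set i | p i]|.
  by rewrite -sum1_card [RHS]big_mkcond; apply: eq_bigr => i _; rewrite inE; case: (p i).
rewrite -big_distrlr /= !sumE.
rewrite (card_stack _ _ (Ordinal m_gt0)) (card_stack _ _ (Ordinal n_gt0)) !card_ord.
by rewrite /tcompat -mulnb !mulnA [X in X * _]mulnAC -!mulnA.
Qed.

End Compat.

(** * Diagrams as operators between tensor powers *)

Local Open Scope ring_scope.

(** * Standard half diagrams and the permutation of their northern vertices *)

Section Standard.
Variables b r : nat.
Implicit Types x : ram b r.

(** The part of being standard that survives stacking below. Products set to 0 in [V_r(0^b)] still
    satisfy it and fail one of the other two conditions of [standard_diagramP]. *)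
Definition north_singletons x := forall k v, inner x (inl k) v -> v = inl k.

Lemma standard_diagramP x :
  reflect [/\ north_singletons x,
              forall k l, outer x (inl k) (inl l) -> k = l
            & forall k, exists j, outer x (inl k) (inr j)]
          (standard_diagram x).
Proof.
apply: (iffP forallP) => [H|[h1 h2 h3] k].
  split=> [k v|k l|k]; have /andP[sk /exists_inP[C inC /and3P[kC /existsP[j jC] /forallP hC]]] := H k.
  - rewrite /inner same_pblock ?inner_part //.
    by rewrite (def_pblock (partition_trivIset (inner_part x)) sk) ?inE ?set11 // => /eqP.
  - rewrite /outer same_pblock ?outer_part //.
    by rewrite (def_pblock (partition_trivIset (outer_part x)) inC kC) => lC;
      move: (hC l); rewrite lC => /eqP.
  - by exists j; apply/exists_inP; exists C; rewrite ?kC.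
have inP (P : {set {set vertex b r}}) : partition P setT -> inl k \in cover P.
  by move=> pP; rewrite (cover_partition pP) inE.
apply/andP; split.
  have -> : [set inl k] = pblock (ram_val x).1 (inl k) :> {set vertex b r}.
    apply/setP=> v; rewrite inE -(same_pblock (inner_part x)).
    by apply/eqP/idP => [->|/h1 //]; apply: inner_refl.
  by rewrite pblock_mem ?inP ?inner_part.
apply/exists_inP; exists (pblock (ram_val x).2 (inl k)).
  by rewrite pblock_mem ?inP ?outer_part.
have [j kj] := h3 k; apply/and3P; split.
- by rewrite mem_pblock inP ?outer_part.
- by apply/existsP; exists j; rewrite -same_pblock ?outer_part.
apply/forallP=> l; apply/implyP; rewrite -same_pblock ?outer_part // => /h2 ->.
exact: eqxx.
Qed.

Lemma relabel_bij (h : 'S_b) : bijective (@relabel r b h).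
Proof.
exists (@relabel r b h^-1%g); case=> // i; by rewrite /= ?permK ?permKV.
Qed.

Lemma relabelKV (h : 'S_b) (v : vertex b r) : relabel h (relabel h^-1%g v) = v.
Proof. by case: v => // i /=; rewrite permKV. Qed.

Lemma inner_relabel (h : 'S_b) x v w :
  inner (ram_image (relabel_bij h) x) v w = inner x (relabel h^-1%g v) (relabel h^-1%g w).
Proof. by rewrite -{1}(relabelKV h v) -{1}(relabelKV h w) inner_image. Qed.

Lemma outer_relabel (h : 'S_b) x v w :
  outer (ram_image (relabel_bij h) x) v w = outer x (relabel h^-1%g v) (relabel h^-1%g w).
Proof. by rewrite -{1}(relabelKV h v) -{1}(relabelKV h w) outer_image. Qed.

Lemma relabel_standard (h : 'S_b) (x : standard_basis r b) :
  standard_diagram (ram_image (relabel_bij h) (val x)).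
Proof.
have /standard_diagramP[h1 h2 h3] := valP x.
apply/standard_diagramP; split=> [k v|k l|k].
- by rewrite inner_relabel => /h1; case: v => //= l [/perm_inj ->].
- by rewrite outer_relabel => /h2/perm_inj.
- by have [j kj] := h3 (h^-1%g k); exists j; rewrite outer_relabel.
Qed.

Definition relabeled (h : 'S_b) (x : standard_basis r b) : standard_basis r b :=
  Sub (ram_image (relabel_bij h) (val x)) (relabel_standard h x).

Lemma relabeledM h k (x : standard_basis r b) : relabeled h (relabeled k x) = relabeled (k * h)%g x.
Proof.
have rM v : relabel k^-1%g (relabel h^-1%g v) = relabel (k * h)^-1%g v :> vertex b r.
  by case: v => // i /=; rewrite invMg permM.
by apply/val_inj/ram_eq => v w; rewrite ?inner_relabel ?outer_relabel -!rM.
Qed.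

Lemma relabeled1 (x : standard_basis r b) : relabeled 1%g x = x.
Proof.
have r1 v : relabel (1^-1 : 'S_b)%g v = v :> vertex b r.
  by case: v => // i /=; rewrite invg1 perm1.
by apply/val_inj/ram_eq => v w; rewrite ?inner_relabel ?outer_relabel !r1.
Qed.

Lemma relabeled_inj h : injective (relabeled h).
Proof.
by apply: (can_inj (g := relabeled h^-1%g)) => x; rewrite relabeledM mulgV relabeled1.
Qed.

End Standard.

(** * Operators of diagrams and of the wreath product *)

Section TensorPowers.
Variables (F : numClosedFieldType) (m n : nat).
Local Notation tindex := (tindex m n).
Local Notation E k := (free_space F (tindex k)).

Definition dot (B : finType) (u v : free_space F B) : F := \sum_x u x * (v x)^*.

Lemma dot_eq0 (B : finType) (u : free_space F B) : dot u u = 0 -> u = 0.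
Proof.
rewrite /dot => s0; have: \sum_x `|u x| ^+ 2 = 0.
  by rewrite -[RHS]s0; apply: eq_bigr => x _; rewrite normCK.
move/psumr_eq0P => H; apply/ffunP=> x; rewrite ffunE; apply/eqP.
by rewrite -normr_eq0 -sqrf_eq0 H // => y _; rewrite exprn_ge0.
Qed.

Lemma dotDl (B : finType) c (u u' v : free_space F B) :
  dot (c *: u + u') v = c * dot u v + dot u' v.
Proof.
rewrite /dot mulr_sumr -big_split; apply: eq_bigr => x _.
by rewrite !ffunE mulrDl mulrA.
Qed.

Lemma dotC (B : finType) (u v : free_space F B) : dot u v = (dot v u)^*.
Proof.
rewrite /dot rmorph_sum; apply: eq_bigr => x _.
by rewrite rmorphM /= conjCK mulrC.
Qed.

Definition diag k l (d : ram k l) : 'Hom(E k, E l) :=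
  matrix_map (fun x z => (tcompat d x z)%:R).

Lemma diag_comp (m_gt0 : (0 < m)%N) (n_gt0 : (0 < n)%N) k l h (d : ram k l) (d' : ram l h) u :
  diag d' (diag d u) =
  (m%:R ^+ deleted (ram_val d).1 (ram_val d').1 *
   n%:R ^+ deleted (ram_val d).2 (ram_val d').2) *: diag (stack d d') u.
Proof.
apply/ffunP=> z; rewrite !ffunE !matrix_mapE.
under eq_bigr do rewrite matrix_mapE mulr_suml.
rewrite exchange_big /= scaler_sumr; apply: eq_bigr => x _.
under eq_bigr do rewrite -mulrA -natrM.
rewrite -mulr_sumr -natr_sum sum_tcompat // /GRing.scale /= !natrM !natrX.
by rewrite mulrCA.
Qed.

(** The matrix of a diagram has entries 0 and 1, so its adjoint is its transpose, the matrix of the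
    reflected diagram. *)
Lemma diag_flip k l (d : ram k l) u v : dot (diag d u) v = dot u (diag (flip d) v).
Proof.
rewrite /dot; under eq_bigr do rewrite matrix_mapE mulr_suml.
rewrite exchange_big; apply: eq_bigr => x _; rewrite matrix_mapE rmorph_sum mulr_sumr.
apply: eq_bigr => y _; rewrite tcompat_flip rmorphM /= conjC_nat -mulrA; congr (_ * _).
exact: mulrC.
Qed.

Definition wreath_op k (w : wreath m n) : 'End(E k) :=
  matrix_map (fun x z => (z == wreath_index w x)%:R).

Definition wreath_inv (w : wreath m n) : wreath m n :=
  ([ffun j => (w.1 (w.2 j))^-1%g], w.2^-1%g).

Lemma wreath_indexK k w : cancel (@wreath_index m n k w) (wreath_index (wreath_inv w)).
Proof. by move=> x; apply/ffunP=> i; rewrite !ffunE /= !permK -surjective_pairing. Qed.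

Lemma wreath_indexVK k w : cancel (@wreath_index m n k (wreath_inv w)) (wreath_index w).
Proof. by move=> x; apply/ffunP=> i; rewrite !ffunE /= !permKV -surjective_pairing. Qed.

Lemma wreath_opE k w (u : E k) z : wreath_op k w u z = u (wreath_index (wreath_inv w) z).
Proof.
rewrite matrix_mapE (bigD1 (wreath_index (wreath_inv w) z)) //= big1 => [|x nx].
  by rewrite wreath_indexVK eqxx mulr1 addr0.
case: eqP => [zx|]; last by rewrite mulr0.
by rewrite zx wreath_indexK eqxx in nx.
Qed.

Lemma wreath_op_adj k w (u v : E k) :
  dot (wreath_op k w u) v = dot u (wreath_op k (wreath_inv w) v).
Proof.
rewrite /dot (reindex (wreath_index w)) /=; last first.
  exists (wreath_index (wreath_inv w)) => x _; [exact: wreath_indexK | exact: wreath_indexVK].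
apply: eq_bigr => x _; rewrite !wreath_opE wreath_indexK; congr (_ * (v _)^*).
by apply: (can_inj (wreath_indexVK w)); rewrite wreath_indexK wreath_indexVK.
Qed.

(** The permutation applied to an inner label depends on the outer label. Vertices in one inner
    block share their outer block, so both inner labels undergo the same permutation. *)
Lemma tcompat_wreath k l (d : ram k l) w (x : tindex k) (z : tindex l) :
  tcompat d (wreath_index w x) (wreath_index w z) = tcompat d x z.
Proof.
have lE v : label (wreath_index w x) (wreath_index w z) v =
    (w.1 (w.2 (label x z v).2) (label x z v).1, w.2 (label x z v).2).
  by case: v => i; rewrite /= ffunE.
apply/tcompatP/tcompatP => [[h1 h2]|[h1 h2]]; split=> u v uv.
- have := h1 _ _ uv; have := h2 _ _ (inner_outer uv); rewrite !lE /= => /perm_inj ->.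
  exact: perm_inj.
- by have := h2 _ _ uv; rewrite !lE /= => /perm_inj.
- by rewrite !lE /= (h1 _ _ uv) (h2 _ _ (inner_outer uv)).
- by rewrite !lE /= (h2 _ _ uv).
Qed.

Lemma diag_wreath k l (d : ram k l) w u : wreath_op l w (diag d u) = diag d (wreath_op k w u).
Proof.
apply/ffunP=> z; rewrite wreath_opE !matrix_mapE (reindex (wreath_index (wreath_inv w))) /=.
  by apply: eq_bigr => x _; rewrite tcompat_wreath wreath_opE.
exists (wreath_index w) => x _; [exact: wreath_indexVK | exact: wreath_indexK].
Qed.

(** The pure tensor with [k]-th factor the sum over [i] of the $v^{f(k)}_i$. Summing out the inner
    labels makes the base group act trivially, as on an inflated module. *)
Definition Om b (f : 'I_b -> 'I_n) : E b :=
  [ffun x : tindex b => [forall k, (x k).2 == f k]%:R].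

Lemma eq_Om b (f f' : 'I_b -> 'I_n) : f =1 f' -> Om f = Om f'.
Proof.
by move=> e; apply/ffunP=> x; rewrite !ffunE; congr ((nat_of_bool _)%:R); apply: eq_forallb => k; rewrite e.
Qed.

Lemma wreath_Om b w (f : 'I_b -> 'I_n) : wreath_op b w (Om f) = Om (fun k => w.2 (f k)).
Proof.
apply/ffunP=> z; rewrite wreath_opE !ffunE; congr ((nat_of_bool _)%:R); apply: eq_forallb => k.
by rewrite ffunE /= -(inj_eq (@perm_inj _ w.2)) permKV.
Qed.

(** The copy of the [b]-th tensor power of $\mathbb C^n$ spanned by the tensors [Om f]. *)
Definition blind b (u : E b) := forall x x' : tindex b, (forall k, (x k).2 = (x' k).2) -> u x = u x'.

Lemma Om_blind b (f : 'I_b -> 'I_n) : blind (Om f).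
Proof.
by move=> x x' e; rewrite !ffunE; congr ((nat_of_bool _)%:R); apply: eq_forallb => k; rewrite e.
Qed.

Definition at_first (i0 : 'I_m) b (f : 'I_b -> 'I_n) : tindex b := [ffun k => (i0, f k)].

Lemma card_second b (f : 'I_b -> 'I_n) :
  #|[set x : tindex b | [forall k, (x k).2 == f k]]| = (m ^ b)%N.
Proof.
pose g (y : {ffun 'I_b -> 'I_m}) : tindex b := [ffun k => (y k, f k)].
have ginj : injective g.
  by move=> y y' /ffunP e; apply/ffunP=> k; have := e k; rewrite !ffunE => -[].
have -> : (m ^ b)%N = #|g @: setT| by rewrite card_imset // cardsT card_ffun !card_ord.
apply: eq_card => x; rewrite inE; apply/forallP/imsetP => [H|[y _ ->] k]; last by rewrite ffunE.
exists [ffun k => (x k).1] => //; apply/ffunP=> k.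
by rewrite !ffunE -(eqP (H k)) -surjective_pairing.
Qed.

Lemma dot_Om i0 b (f : 'I_b -> 'I_n) (u : E b) :
  blind u -> dot (Om f) u = (m ^ b)%:R * (u (at_first i0 f))^*.
Proof.
move=> bu; rewrite -(card_second f) -sum1_card natr_sum mulr_suml /dot [RHS]big_mkcond /=.
apply: eq_bigr => x _; rewrite ffunE inE; case: forallP => [H|]; last by rewrite mul0r.
by rewrite !mul1r; congr (_^*); apply: bu => k; rewrite ffunE /= -(eqP (H k)).
Qed.

Definition south_compat b r (x : ram b r) (y : tindex r) :=
  [forall i, forall j, (inner x (inr i) (inr j) ==> ((y i).1 == (y j).1)) &&
                       (outer x (inr i) (inr j) ==> ((y i).2 == (y j).2))].

Lemma south_compatP b r (x : ram b r) (y : tindex r) :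
  reflect ((forall i j, inner x (inr i) (inr j) -> (y i).1 = (y j).1) /\
           (forall i j, outer x (inr i) (inr j) -> (y i).2 = (y j).2))
          (south_compat x y).
Proof.
apply: (iffP forallP) => [H|[h1 h2] i].
  split=> i j ij; have /forallP/(_ j)/andP[/implyP h1 /implyP h2] := H i; apply/eqP; auto.
by apply/forallP=> j; apply/andP; split; apply/implyP=> ij; apply/eqP; auto.
Qed.

(** [tau] selects a southern vertex in the outer block of each northern one. Northern inner labels
    are unconstrained, and northern outer labels are read off along [tau]. *)
Lemma tcompat_standard b r (x : ram b r) (tau : 'I_b -> 'I_r) (a : tindex b) (y : tindex r) :
  standard_diagram x -> (forall k, outer x (inl k) (inr (tau k))) ->
  tcompat x a y = south_compat x y && [forall k, (a k).2 == (y (tau k)).2].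
Proof.
case/standard_diagramP=> h1 h2 h3 tauP.
apply/tcompatP/andP => [[c1 c2]|[/south_compatP[c1 c2] /forallP c3]].
  split; first by apply/south_compatP; split=> i j ij; [apply: (c1 (inr i) (inr j)) | apply: (c2 (inr i) (inr j))].
  by apply/forallP=> k; apply/eqP; apply: (c2 (inl k) (inr (tau k))).
split.
  case=> [k|i] [l|j] uv.
  - by have [->] := h1 _ _ uv.
  - by have := h1 _ _ uv.
  - by move: uv; rewrite inner_sym => /h1.
  - exact: c1.
have key k j : outer x (inl k) (inr j) -> (a k).2 = (y j).2.
  move=> kj; rewrite (eqP (c3 k)); apply: c2; apply: outer_trans kj.
  by rewrite outer_sym.
case=> [k|i] [l|j] uv.
- by rewrite (h2 _ _ uv).
- exact: key.
- by apply/esym/key; rewrite outer_sym.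
- exact: c2.
Qed.

(** The factor [m ^ b] counts the free inner labels of the northern vertices. *)
Lemma diag_standardE b r (x : ram b r) (tau : 'I_b -> 'I_r) (u : E b) y :
  blind u -> standard_diagram x -> (forall k, outer x (inl k) (inr (tau k))) ->
  diag x u y = (m ^ b)%:R * ((south_compat x y)%:R * u [ffun k => y (tau k)]).
Proof.
move=> bu sx tauP; rewrite matrix_mapE -(card_second (fun k => (y (tau k)).2)).
rewrite -sum1_card natr_sum mulr_suml [RHS]big_mkcond /=; apply: eq_bigr => a _.
rewrite (tcompat_standard _ _ sx tauP) inE; case: forallP => [H|]; last by rewrite andbF mulr0.
rewrite andbT mul1r mulrC; congr (_ * _); apply: bu => k.
by rewrite ffunE (eqP (H k)).
Qed.

Lemma diag_relabel b r (h : 'S_b) (x : standard_basis r b) (f : 'I_b -> 'I_n) :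
  diag (val (relabeled h x)) (Om f) = diag (val x) (Om (fun k => f (h k))).
Proof.
apply/ffunP=> y; rewrite !matrix_mapE.
pose p (a : tindex b) : tindex b := [ffun k => a (h k)].
rewrite [RHS](reindex p) /=; last first.
  exists (fun a : tindex b => [ffun k => a (h^-1%g k)]) => a _;
    by apply/ffunP=> k; rewrite !ffunE ?permK ?permKV.
apply: eq_bigr => a _; rewrite !ffunE; congr ((nat_of_bool _)%:R * (nat_of_bool _)%:R).
  apply/forallP/forallP => H k; first by rewrite ffunE.
  by have := H (h^-1%g k); rewrite ffunE permKV.
by apply: tcompat_image; case=> // k; rewrite /= ffunE.
Qed.

(** First failure of standardness: an outer block with two northern vertices demands equal entries
    there. *)
Lemma diag_merge b r (x : ram b r) k l (f : 'I_b -> 'I_n) :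
  outer x (inl k) (inl l) -> f k != f l -> diag x (Om f) = 0.
Proof.
move=> kl fkl; apply/ffunP=> y; rewrite matrix_mapE ffunE big1 // => a _; rewrite ffunE.
case: forallP => [H|]; last by rewrite mul0r.
case: tcompatP => [[_ c2]|]; last by rewrite mulr0.
have := c2 _ _ kl; rewrite /= (eqP (H k)) (eqP (H l)) => e.
by rewrite e eqxx in fkl.
Qed.

(** Second failure: an outer block consisting of [k] alone does not see the entry there. The
    involution [t], which swaps [f k] and [f' k] in position [k], matches the two sums. *)
Lemma diag_isolated b r (x : ram b r) k (f f' : 'I_b -> 'I_n) :
  (forall v, outer x (inl k) v -> v = inl k) ->
  (forall l, l != k -> f l = f' l) -> diag x (Om f) = diag x (Om f').
Proof.
move=> iso ff'; apply/ffunP=> y; rewrite !matrix_mapE.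
pose t (a : tindex b) : tindex b :=
  [ffun l => if l == k then ((a l).1, tperm (f k) (f' k) (a l).2) else a l].
have tK : involutive t.
  move=> a; apply/ffunP=> l; rewrite !ffunE; case: eqP => // _ /=.
  by rewrite tpermK -surjective_pairing.
rewrite [RHS](reindex_inj (can_inj tK)) /=; apply: eq_bigr => a _; rewrite !ffunE.
congr ((nat_of_bool _)%:R * (nat_of_bool _)%:R).
  apply/forallP/forallP => H l; have := H l; rewrite ffunE; case: (l =P k) => [->|/eqP lk] /=.
  - by move/eqP->; rewrite tpermL.
  - by rewrite ff'.
  - by rewrite -[X in _ == X](tpermL (f k) (f' k)) (inj_eq perm_inj).
  - by rewrite ff'.
have l1 v : (label (t a) y v).1 = (label a y v).1.
  by case: v => // l; rewrite /= ffunE; case: eqP.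
have l2 v : v != inl k -> (label (t a) y v).2 = (label a y v).2.
  by case: v => // l; rewrite /= ffunE (inj_eq (@inl_inj _ _)); case: eqP.
apply/tcompatP/tcompatP => [[c1 c2]|[c1 c2]]; split=> u v uv;
  try (by rewrite ?l1; have := c1 _ _ uv; rewrite ?l1).
  have [uk|uk] := eqVneq u (inl k); first by move: uv; rewrite uk => /iso ->.
  have [vk|vk] := eqVneq v (inl k).
    by move: uv; rewrite vk outer_sym => /iso ->.
  by rewrite !l2 // (c2 _ _ uv).
have [uk|uk] := eqVneq u (inl k); first by move: uv; rewrite uk => /iso ->.
have [vk|vk] := eqVneq v (inl k).
  by move: uv; rewrite vk outer_sym => /iso ->.
by rewrite -(l2 u uk) -(l2 v vk) (c2 _ _ uv).
Qed.

End TensorPowers.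

(** * The bimodule map into tensor space *)

Lemma linear_sumZ (F : fieldType) (V W : lmodType F) (f : V -> W) (linf : linear f)
    (I : Type) (s : seq I) (P : pred I) (c : I -> F) (v : I -> V) :
  f (\sum_(i <- s | P i) c i *: v i) = \sum_(i <- s | P i) c i *: f (v i).
Proof.
have f0 : f 0 = 0.
  by have := linf (-1) 0 0; rewrite !scaler0 addr0 scaleN1r addrC subrr.
elim/big_rec2: _ => [|i y x _ <-]; [exact: f0 | exact: linf].
Qed.

Lemma reshape_index_cons x s i :
  reshape_index (x :: s) i = if (i < x)%N then 0%N else (reshape_index s (i - x)).+1.
Proof.
rewrite /reshape_index /= subn_eq0; case: ltnP => // xi.
by rewrite subSn.
Qed.

Lemma reshape_offset_cons x s i :
  reshape_offset (x :: s) i = if (i < x)%N then i else reshape_offset s (i - x).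
Proof.
rewrite /reshape_offset reshape_index_cons; case: ltnP => _ /=; first by rewrite subn0.
by rewrite subnDA.
Qed.

(** Pairing [q] with [tperm x y * q] shows that the sum equals its own negative. *)
Lemma col_antisym (F : numClosedFieldType) (V : lmodType F) n la (x y : 'I_n) (phi : 'S_n -> V) :
  x != y -> reshape_offset la x = reshape_offset la y ->
  (forall q, phi (tperm x y * q)%g = phi q) ->
  \sum_(q | col_perm la q) (-1) ^+ odd_perm q *: phi q = 0.
Proof.
move=> xy exy phit; set S := \sum_(_ | _) _.
have tc : col_perm la (tperm x y) by apply/forallP=> i; case: tpermP => // ->; rewrite exy.
suff : S = - S.
  move/eqP; rewrite -addr_eq0 -mulr2n -scaler_nat scaler_eq0 pnatr_eq0 /=.
  by move/eqP.
rewrite {1}/S (reindex_inj (mulgI (tperm x y))) -sumrN /=.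
apply: eq_big => q; rewrite ?col_permMl // => _.
by rewrite phit odd_permM odd_tperm xy signr_addb expr1 mulN1r scaleNr.
Qed.

Section Psi.
Variables (F : numClosedFieldType) (m n b : nat) (be : seq nat).
Hypotheses (be_part : intpart b be) (be_le : (b + head 0%N be <= n)%N).
Local Notation tindex := (tindex m n).
Local Notation E k := (free_space F (tindex k)).
Local Notation la := (padded be n).
Local Notation ri := (reshape_index la).
Local Notation ci := (reshape_offset la).

Lemma sumn_be : sumn be = b.
Proof. by case/and3P: be_part => _ _ /eqP. Qed.

Lemma b_le_n : (b <= n)%N. Proof. exact: leq_trans (leq_addr _ _) be_le. Qed.

Lemma sumn_la : sumn la = n.
Proof. by rewrite /padded /= sumn_be subnK ?b_le_n. Qed.

Lemma low_proof (k : 'I_b) : (n - b + k < n)%N.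
Proof. by rewrite -[X in (_ < X)%N](subnK b_le_n) ltn_add2l. Qed.
(** The first row of [padded be n] takes the numbers below [n - b]; box [k] of [be] comes [n - b]
    places later. *)
Definition low (k : 'I_b) : 'I_n := Ordinal (low_proof k).

Lemma low_inj : injective low.
Proof. by move=> k l /(congr1 val) /addnI /val_inj. Qed.

Lemma ri_low k : ri (low k) = (reshape_index be k).+1.
Proof.
by rewrite reshape_index_cons sumn_be /= ltnNge leq_addr /= addKn.
Qed.
Lemma ci_low k : ci (low k) = reshape_offset be k.
Proof.
by rewrite reshape_offset_cons sumn_be /= ltnNge leq_addr /= addKn.
Qed.
Lemma ri_high (i : 'I_n) : (ri i == 0%N) = (i < n - b)%N.
Proof. by rewrite reshape_index_cons sumn_be; case: ltnP. Qed.
Lemma ci_high (i : 'I_n) : (i < n - b)%N -> ci i = i.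
Proof. by move=> h; rewrite reshape_offset_cons sumn_be h. Qed.
Lemma not_high (i : 'I_n) : ~~ (i < n - b)%N -> exists k, i = low k.
Proof.
rewrite -leqNgt => h; have ltk : (i - (n - b) < b)%N by have := ltn_ord i; have := b_le_n; lia.
by exists (Ordinal ltk); apply: val_inj; rewrite /= subnKC.
Qed.

Lemma offset_head (k : 'I_b) : (reshape_offset be k < head 0%N be)%N.
Proof.
have kb : (k < sumn be)%N by rewrite sumn_be.
apply: leq_trans (reshape_offsetP kb) _; have := reshape_indexP kb.
case/and3P: be_part => + _ _; case: be => [//|x s] /= srt.
case: (reshape_index _ _) => //= j js.
have /allP := order_path_min (rev_trans leq_trans) srt; apply; exact: mem_nth.
Qed.

Lemma top_proof (k : 'I_b) : (reshape_offset be k < n)%N.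
Proof. have := offset_head k; have := be_le; lia. Qed.
(** The box of the first row in the column of [low k]; within the first row the number of a box is
    its column. *)
Definition top (k : 'I_b) : 'I_n := Ordinal (top_proof k).

Lemma top_high k : (top k < n - b)%N.
Proof. have := offset_head k; have := be_le => /=; lia. Qed.
Lemma ci_top k : ci (low k) = ci (top k).
Proof. by rewrite ci_low ci_high ?top_high. Qed.
Lemma low_top k l : low k != top l.
Proof. by apply/eqP=> /(congr1 val) e; have := top_high l; rewrite -e /=; lia. Qed.

(** The vector [s . v . t] with [v] the tensor [Om low]: [s] permutes entries, [t] permutes
    positions. *)
Definition psi (s : galg F 'S_n) (t : galg F 'S_b) : E b :=
  \sum_g \sum_h (s g * t h) *: Om F m (fun k => g (low (h k))).

Lemma psi_linl t : linear (fun s => psi s t).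
Proof.
move=> c s s'; rewrite /psi scaler_sumr -big_split; apply: eq_bigr => g _ /=.
rewrite scaler_sumr -big_split; apply: eq_bigr => h _ /=.
by rewrite !ffunE mulrDl scalerDl scalerA mulrA.
Qed.
Lemma psi_linr s : linear (psi s).
Proof.
move=> c t t'; rewrite /psi scaler_sumr -big_split; apply: eq_bigr => g _ /=.
rewrite scaler_sumr -big_split; apply: eq_bigr => h _ /=.
by rewrite !ffunE mulrDr scalerDl scalerA mulrCA.
Qed.

Lemma psi_basis g h : psi (gbasis F g) (gbasis F h) = Om F m (fun k => g (low (h k))).
Proof.
rewrite /psi (bigD1 g) //= [X in _ + X]big1 => [|g' ng]; last first.
  by rewrite big1 // => h' _; rewrite ffunE (negPf ng) mul0r scale0r.
rewrite addr0 (bigD1 h) //= big1 => [|h' nh].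
  by rewrite !ffunE !eqxx mulr1 scale1r addr0.
by rewrite !ffunE (negPf nh) mulr0 scale0r.
Qed.

(** Bilinearity as an induction principle: compatibilities of [psi] need checking on group elements
    only. *)
Lemma psi_ind (P : galg F 'S_n -> galg F 'S_b -> E b -> Prop) :
  (forall t, P 0 t 0) -> (forall s, P s 0 0) -> 
  (forall c s s' t u u', P s t u -> P s' t u' -> P (c *: s + s') t (c *: u + u')) ->
  (forall c s t t' u u', P s t u -> P s t' u' -> P s (c *: t + t') (c *: u + u')) ->
  (forall g h, P (gbasis F g) (gbasis F h) (Om F m (fun k => g (low (h k))))) ->
  forall s t, P s t (psi s t).
Proof.
move=> P0l P0r Pl Pr Pb s t.
have Pg g : P (gbasis F g) t (psi (gbasis F g) t).
  rewrite (galgE t) (linear_sumZ (psi_linr _)).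
  by elim/big_rec2: _ => [//|h v t' _ Pt']; apply: Pr => //; rewrite psi_basis.
rewrite (galgE s) (linear_sumZ (psi_linl t)).
by elim/big_rec2: _ => [//|g u' s' _ Ps']; apply: Pl.
Qed.

Lemma psi_wreath w s t : wreath_op F b w (psi s t) = psi (s * gbasis F w.2) t.
Proof.
apply: (@psi_ind (fun s t u => wreath_op F b w u = psi (s * gbasis F w.2) t)) => {s t}.
- by move=> t; rewrite linear0 mul0r /psi !big1 // => g _; rewrite big1 // => h _;
    rewrite ffunE mul0r scale0r.
- move=> s; rewrite linear0 /psi !big1 // => g _; rewrite big1 // => h _;
    by rewrite [_ h]ffunE mulr0 scale0r.
- by move=> c s s' t u u' e e'; rewrite linearP /= e e' mulrDl -scalerAl psi_linl.
- by move=> c s t t' u u' e e'; rewrite linearP /= e e' psi_linr.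
move=> g h; rewrite gbasisM psi_basis wreath_Om; apply: eq_Om => k.
by rewrite permM.
Qed.

Lemma psi_relabel r (h : 'S_b) (x : standard_basis r b) s t :
  diag F m n (val (relabeled h x)) (psi s t) = diag F m n (val x) (psi s (gbasis F h * t)).
Proof.
apply: (@psi_ind (fun s t u => diag F m n (val (relabeled h x)) u
                = diag F m n (val x) (psi s (gbasis F h * t)))) => {s t}.
- move=> t; rewrite linear0 /psi big1 ?linear0 // => g _; rewrite big1 // => h' _;
    by rewrite ffunE mul0r scale0r.
- move=> s; rewrite linear0 mulr0 /psi big1 ?linear0 // => g _; rewrite big1 // => h' _;
    by rewrite [_ h']ffunE mulr0 scale0r.
- by move=> c s s' t u u' e e'; rewrite linearP /= e e' psi_linl linearP.
- by move=> c s t t' u u' e e'; rewrite linearP /= e e' mulrDr -scalerAr psi_linr linearP.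
move=> g h'; rewrite gbasisM psi_basis diag_relabel; congr (diag _ _ _ _ _).
by apply: eq_Om => k; rewrite permM.
Qed.

Lemma psi_shift (h : 'S_b) s t (a : tindex b) :
  psi s (gbasis F h * t) a = psi s t [ffun k => a (h^-1%g k)].
Proof.
apply: (@psi_ind (fun s t u => psi s (gbasis F h * t) a = u [ffun k => a (h^-1%g k)])) => {s t}.
- move=> t; rewrite /psi big1 ?ffunE // => g _; rewrite big1 // => h' _;
    by rewrite ffunE mul0r scale0r.
- move=> s; rewrite mulr0 /psi big1 ?ffunE // => g _; rewrite big1 // => h' _;
    by rewrite [_ h']ffunE mulr0 scale0r.
- by move=> c s s' t u u' e e'; rewrite psi_linl !ffunE e e'.
- by move=> c s t t' u u' e e'; rewrite mulrDr -scalerAr psi_linr !ffunE e e'.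
move=> g h'; rewrite gbasisM psi_basis !ffunE; congr ((nat_of_bool _)%:R).
apply/forallP/forallP => H k; have := H (h^-1%g k); have := H (h k);
  by rewrite !ffunE !permM ?permKV ?permK.
Qed.

Lemma psi_blind s t : blind (psi s t).
Proof.
move=> x x' e; rewrite /psi !sum_ffunE; apply: eq_bigr => g _.
rewrite !sum_ffunE; apply: eq_bigr => h _; rewrite [LHS]ffunE [RHS]ffunE.
by rewrite (@Om_blind _ _ _ _ _ x x' e).
Qed.

(** By [psi_col] these span the values of [psi] on the right ideal of [col_sum], which contains that
    of the symmetrizer. *)
Definition col_vector (g : 'S_n) (h : 'S_b) : E b :=
  \sum_(q | col_perm la q) (-1) ^+ odd_perm q *: Om F m (fun k => g (q (low (h k)))).

Lemma psi_col s t :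
  psi (col_sum F n la * s) t = \sum_g \sum_h (s g * t h) *: col_vector g h.
Proof.
rewrite {1}(galgE s) mulr_sumr.
under eq_bigr do rewrite -scalerAr.
rewrite (linear_sumZ (psi_linl t)); apply: eq_bigr => g _.
rewrite {1}(galgE t) (linear_sumZ (psi_linr _)) scaler_sumr; apply: eq_bigr => h _.
rewrite scalerA; congr (_ *: _); rewrite /col_sum mulr_suml.
under eq_bigr do rewrite -scalerAl gbasisM.
rewrite (linear_sumZ (psi_linl _)); apply: eq_bigr => q _; congr (_ *: _).
by rewrite psi_basis; apply: eq_Om => k; rewrite permM.
Qed.

(** Merged northern vertices contradict the distinctness of the entries. If [k] is isolated,
    exchanging [low (h k)] with [top (h k)] changes only the entry that the diagram ignores, and the
    alternating sum cancels. *)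
Lemma diag_col_vector r (z : ram b r) g h :
  north_singletons z -> ~~ standard_diagram z -> diag F m n z (col_vector g h) = 0.
Proof.
move=> ns nst; rewrite linear_sum /=.
under eq_bigr do rewrite linearZ /=.
case: (boolp.pselect (exists k l, k != l /\ outer z (inl k) (inl l))) => [[k [l [kl okl]]]|h2].
  apply: big1 => q _; rewrite (diag_merge _ _ okl) ?scaler0 //.
  by rewrite (inj_eq perm_inj) (inj_eq perm_inj) (inj_eq low_inj) (inj_eq perm_inj).
case: (boolp.pselect (exists k, forall j, ~ outer z (inl k) (inr j))) => [[k hk]|h3]; last first.
  case/negP: nst; apply/standard_diagramP; split=> // [k l okl|k].
    by apply/eqP; apply: boolp.contrapT => kl; apply: h2; exists k, l; split=> //; apply/negP.
  by apply: boolp.contrapT => nj; apply: h3; exists k => j kj; apply: nj; exists j.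
apply: (@col_antisym _ _ _ _ (low (h k)) (top (h k))); rewrite ?low_top ?ci_top // => q.
apply: (@diag_isolated _ _ _ _ _ _ k) => [[l|j]|l lk] //.
- move=> kl; congr inl; apply/eqP; apply: boolp.contrapT => nkl; apply: h2.
  by exists k, l; split=> //; rewrite eq_sym; apply/negP.
- by move=> /hk.
rewrite permM tpermD // eq_sym ?low_top //.
by rewrite (inj_eq low_inj) (inj_eq perm_inj).
Qed.

Lemma diag_psi_eq0 r (z : ram b r) s t :
  north_singletons z -> ~~ standard_diagram z ->
  diag F m n z (psi (symmetrizer F n la * s) t) = 0.
Proof.
move=> ns nst; rewrite /symmetrizer -mulrA psi_col linear_sum big1 // => g _.
by rewrite linear_sum big1 // => h _; rewrite linearZ /= diag_col_vector ?scaler0.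
Qed.

End Psi.

(** * Injectivity on equivariant families *)

Section Injectivity.
Variables (F : numClosedFieldType) (m n r b : nat) (be : seq nat).
Hypotheses (be_part : intpart b be) (b_le_r : (b <= r)%N)
  (r_be_n : (r + head 0%N be <= n)%N) (r_b_m : (r - b + (b != 0%N) <= m)%N)
  (m_gt0 : (0 < m)%N).

Lemma b_be_n : (b + head 0%N be <= n)%N. Proof. by apply: leq_trans r_be_n; rewrite leq_add2r. Qed.

Local Notation tindex := (tindex m n).
Local Notation E k := (free_space F (tindex k)).
Local Notation la := (padded be n).
Local Notation psi := (@psi F m n b be b_be_n).
Local Notation low := (low b_be_n).
Local Notation top := (top be_part b_be_n).
Local Notation col_vector := (@col_vector F m n b be b_be_n).
Local Notation X := (standard_basis r b).

(** With [b] vertices on either side [tau] is a bijection, so every outer block joins one northern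
    to one southern vertex and the diagram permutes positions. *)
Lemma diag_psi_standard (z : ram b b) :
  standard_diagram z -> exists h : 'S_b, forall s t,
  diag F m n z (psi s t) = (m ^ b)%:R *: psi s (gbasis F h * t).
Proof.
move=> sz; have /standard_diagramP[h1 h2 h3] := sz; have [tau tauP] := boolp.choice h3.
have tau_inj : injective tau.
  move=> k l e; apply: h2; apply: outer_trans (tauP k) _.
  by rewrite e outer_sym.
exists (perm tau_inj)^-1%g => s t; apply/ffunP=> y.
rewrite (diag_standardE _ (@psi_blind _ _ _ _ _ b_be_n s t) sz tauP) [RHS]ffunE psi_shift.
have -> : south_compat z y.
  have o_eq i j : outer z (inr i) (inr j) -> i = j.
    rewrite -(permKV (perm tau_inj) i) -(permKV (perm tau_inj) j) !permE => ij.
    congr tau; apply: h2; apply: outer_trans (tauP _) _; apply: outer_trans ij _.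
    by rewrite outer_sym.
  by apply/south_compatP; split=> i j ij; [rewrite (o_eq i j (inner_outer ij)) | rewrite (o_eq i j ij)].
rewrite mul1r; congr (_ * _); congr (psi s t _).
by apply/ffunP=> k; rewrite !ffunE invgK permE.
Qed.

(** Measures coarseness of the southern set-partitions; a minimum is attained by the finest ones. *)
Definition south_relations (x : ram b r) : nat :=
  #|[set p : 'I_r * 'I_r | inner x (inr p.1) (inr p.2)]| +
  #|[set p : 'I_r * 'I_r | outer x (inr p.1) (inr p.2)]|.

Lemma south_relations_min (x x0 : ram b r) :
  (forall i j, inner x (inr i) (inr j) -> inner x0 (inr i) (inr j)) ->
  (forall i j, outer x (inr i) (inr j) -> outer x0 (inr i) (inr j)) ->
  (south_relations x0 <= south_relations x)%N ->
  (forall i j, inner x (inr i) (inr j) = inner x0 (inr i) (inr j)) /\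
  (forall i j, outer x (inr i) (inr j) = outer x0 (inr i) (inr j)).
Proof.
rewrite /south_relations; set I := [set _ | _]; set O := [set _ | _].
set I' := [set _ | _]; set O' := [set _ | _] => hi ho.
have sI : I' \subset I by apply/subsetP=> p; rewrite !inE; apply: hi.
have sO : O' \subset O by apply/subsetP=> p; rewrite !inE; apply: ho.
move=> le; have cI := subset_leq_card sI; have cO := subset_leq_card sO.
have le_split i o i' o' : (i + o <= i' + o' -> i' <= i -> o' <= o -> i <= i' /\ o <= o')%N by lia.
have [leI leO] := le_split _ _ _ _ le cI cO.
have /eqP eI : I' == I by rewrite eqEcard sI.
have /eqP eO : O' == O by rewrite eqEcard sO.
split=> i j.
  by move/setP/(_ (i, j)): eI; rewrite !inE.
by move/setP/(_ (i, j)): eO; rewrite !inE.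
Qed.

(** * A generic tensor adapted to a half diagram *)

Section Generic.
Variables (x0 : ram b r) (tau : 'I_b -> 'I_r) (h : 'S_b).
Hypotheses (sx0 : standard_diagram x0) (tauP : forall k, outer x0 (inl k) (inr (tau k))).

Let h2 : forall k l, outer x0 (inl k) (inl l) -> k = l.
Proof. by have /standard_diagramP[] := sx0. Qed.

Lemma tau_inj : injective tau.
Proof.
move=> k l e; apply: h2; apply: outer_trans (tauP k) _.
by rewrite e outer_sym.
Qed.

Definition rep_outer (i : 'I_r) : 'I_r := odflt i [pick j | outer x0 (inr i) (inr j)].
Definition rep_inner (i : 'I_r) : 'I_r := odflt i [pick j | inner x0 (inr i) (inr j)].
Definition block (i : 'I_r) : {set 'I_r} := [set j | outer x0 (inr i) (inr j)].

Lemma rep_outerP i : outer x0 (inr i) (inr (rep_outer i)).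
Proof. by rewrite /rep_outer; case: pickP => //= _; apply: outer_refl. Qed.
Lemma rep_innerP i : inner x0 (inr i) (inr (rep_inner i)).
Proof. by rewrite /rep_inner; case: pickP => //= _; apply: inner_refl. Qed.

Lemma rep_outer_eq i j : outer x0 (inr i) (inr j) -> rep_outer i = rep_outer j.
Proof.
move=> ij; have e : outer x0 (inr i) =1 outer x0 (inr j).
  move=> v; apply/idP/idP; apply: outer_trans => //.
  by rewrite outer_sym.
rewrite /rep_outer (eq_pick (fun k => e (inr k))); case: pickP => // /(_ j).
by rewrite outer_refl.
Qed.
Lemma rep_inner_eq i j : inner x0 (inr i) (inr j) -> rep_inner i = rep_inner j.
Proof.
move=> ij; have e : inner x0 (inr i) =1 inner x0 (inr j).
  move=> v; apply/idP/idP; apply: inner_trans => //.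
  by rewrite inner_sym.
rewrite /rep_inner (eq_pick (fun k => e (inr k))); case: pickP => // /(_ j).
by rewrite inner_refl.
Qed.
Lemma block_eq i j : outer x0 (inr i) (inr j) -> block i = block j.
Proof.
move=> ij; apply/setP=> k; rewrite !inE; apply/idP/idP; apply: outer_trans => //.
by rewrite outer_sym.
Qed.

(** By [rep_spare] these include the representatives of all outer blocks without northern vertex, so
    they can index the fresh entries. *)
Definition spares : {set 'I_r} := ~: (tau @: setT).

Lemma card_spares : #|spares| = (r - b)%N.
Proof. by rewrite cardsCs setCK card_imset ?cardsT ?card_ord //; apply: tau_inj. Qed.

(** A block contains at most one value of [tau], and none if [b] is 0; its other vertices are
    spares. This is where the bound on [m] enters. *)
Lemma card_block i : (#|block i| <= m)%N.
Proof.
apply: leq_trans r_b_m.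
have : (#|block i :|: spares| <= r)%N by rewrite -[X in (_ <= X)%N](card_ord r) max_card.
have : (#|block i :&: (tau @: setT)| <= (b != 0%N))%N.
  case: (posnP b) => [b0|bpos]; last first.
    apply/card_le1_eqP => u v /setIP[ik /imsetP[k _ uk]] /setIP[il /imsetP[l _ vl]].
    move: ik il; rewrite {u}uk {v}vl !inE => ik il;
    have kl : outer x0 (inl k) (inl l).
      apply: outer_trans (tauP k) _; apply: (@outer_trans _ _ _ _ (inr i)).
        by rewrite outer_sym.
      by apply: outer_trans il _; rewrite outer_sym.
    by rewrite (h2 kl).
  rewrite leqn0 cards_eq0 -subset0; apply/subsetP=> j /setIP[_ /imsetP[k]].
  by have : (k < 0)%N by rewrite -[X in (_ < X)%N]b0.
have -> : (#|block i| = #|block i :&: (tau @: setT)| + #|block i :&: spares|)%N.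
  by rewrite -(cardsID (tau @: setT) (block i)) setDE.
have : (#|block i :&: spares| <= r - b)%N.
  by rewrite -card_spares subset_leq_card ?subsetIr.
lia.
Qed.

Definition north (i : 'I_r) : option 'I_b := [pick k | outer x0 (inl k) (inr i)].

(** The bound on [n] leaves at least [r - b] boxes of the first row to the right of all columns of
    [be]. *)
Lemma spare_proof (i : 'I_r) : i \in spares ->
  (head 0%N be + index i (enum spares) < n - b)%N.
Proof.
rewrite -mem_enum -index_mem -cardE card_spares.
move: (index _ _) (head _ _) r_be_n => ix hd ? ?; have := b_le_r; lia.
Qed.

Lemma n_gt0 (i : 'I_r) : (0 < n)%N.
Proof. by have := ltn_ord i; have := r_be_n; lia. Qed.

Definition spare (i : 'I_r) : 'I_n :=
  insubd (Ordinal (n_gt0 i)) (head 0%N be + index i (enum spares))%N.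

Lemma spareE i : i \in spares -> spare i = (head 0%N be + index i (enum spares))%N :> nat.
Proof.
move=> si; rewrite val_insubd; have := spare_proof si.
case: ifP => //; have := b_le_r; have := r_be_n; lia.
Qed.

(* The entries on outer blocks without northern vertex lie in the first row, to the
   right of all columns of [be], so they differ from all [low k] and all [top k]. *)
Definition jindex (i : 'I_r) : 'I_n :=
  if north i is Some k then low (h k) else spare (rep_outer i).

Lemma north_some i k : outer x0 (inl k) (inr i) -> north i = Some k.
Proof.
rewrite /north; case: pickP => [l il ik|/(_ k) ->] //.
congr Some; apply: h2; apply: outer_trans il _; by rewrite outer_sym.
Qed.

Lemma jindex_north i k : outer x0 (inl k) (inr i) -> jindex i = low (h k).
Proof. by move=> /north_some; rewrite /jindex => ->. Qed.

Lemma rep_spare i : north i = None -> rep_outer i \in spares.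
Proof.
move=> ni; rewrite inE; apply/negP=> /imsetP[k _ ek].
suff : north i = Some k by rewrite ni.
apply: north_some; apply: outer_trans (tauP k) _; rewrite -ek outer_sym.
exact: rep_outerP.
Qed.

Lemma jindex_neq i k : ~~ outer x0 (inl k) (inr i) ->
  jindex i != low (h k) /\ jindex i != top (h k).
Proof.
rewrite /jindex /north; case: pickP => [l il nk|none _].
  split; last exact: low_top.
  rewrite (inj_eq (@low_inj _ _ _ _)) (inj_eq perm_inj).
  by apply: contraNneq nk => <-.
have si : rep_outer i \in spares.
  by apply: rep_spare; rewrite /north; case: pickP => // l; rewrite none.
have sE := spareE si; have := spare_proof si; rewrite -sE => lt.
split; apply/eqP=> /(congr1 val) /= e; first by move: lt; rewrite e; lia.
have := offset_head be_part (h k); rewrite -e sE; lia.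
Qed.

Lemma jindexP i j : (jindex i == jindex j) = outer x0 (inr i) (inr j).
Proof.
apply/eqP/idP => [e|ij]; last first.
  rewrite /jindex (rep_outer_eq ij).
  suff -> : north i = north j by [].
  by apply: eq_pick => k /=; apply/idP/idP => kk; apply: outer_trans kk _; rewrite // outer_sym.
case ni: (north i) => [k|]; case nj: (north j) => [l|].
- have : outer x0 (inl k) (inr i) by move: ni; rewrite /north; case: pickP => // ? ? [<-].
  have : outer x0 (inl l) (inr j) by move: nj; rewrite /north; case: pickP => // ? ? [<-].
  move: e; rewrite /jindex ni nj => /low_inj/perm_inj <- kj ki.
  by apply: outer_trans kj; rewrite outer_sym.
- have : outer x0 (inl k) (inr i) by move: ni; rewrite /north; case: pickP => // ? ? [<-].
  move=> ki; have [/north_some|/jindex_neq[+ _]] := boolP (outer x0 (inl k) (inr j)).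
    by rewrite nj.
  by rewrite -e (jindex_north ki) eqxx.
- have : outer x0 (inl l) (inr j) by move: nj; rewrite /north; case: pickP => // ? ? [<-].
  move=> lj; have [/north_some|/jindex_neq[+ _]] := boolP (outer x0 (inl l) (inr i)).
    by rewrite ni.
  by rewrite e (jindex_north lj) eqxx.
have si := rep_spare ni; have sj := rep_spare nj.
move: e; rewrite /jindex ni nj => /(congr1 val) /=; rewrite !spareE // => /addnI.
move/(congr1 (nth (rep_outer i) (enum spares))); rewrite !nth_index ?mem_enum // => e.
by apply: outer_trans (rep_outerP i) _; rewrite e outer_sym; apply: rep_outerP.
Qed.

(** Inner labels only have to separate inner blocks within one outer block, so a position in that
    block serves as label; it is below [m] by [card_block]. *)
Definition iindex (i : 'I_r) : 'I_m :=
  insubd (Ordinal m_gt0) (index (rep_inner i) (enum (block i))).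

Lemma iindexP i j : outer x0 (inr i) (inr j) ->
  (iindex i == iindex j) = inner x0 (inr i) (inr j).
Proof.
have mem l : rep_inner l \in enum (block l).
  by rewrite mem_enum inE; apply: inner_outer; apply: rep_innerP.
have lt l : (index (rep_inner l) (enum (block l)) < m)%N.
  by apply: leq_trans (card_block l); rewrite cardE index_mem.
have valE l : val (iindex l) = index (rep_inner l) (enum (block l)).
  by rewrite val_insubd lt.
move=> ij; apply/eqP/idP => [/(congr1 val)|inij]; last first.
  by apply: val_inj; rewrite !valE (rep_inner_eq inij) (block_eq ij).
rewrite !valE (block_eq ij) => /(congr1 (nth i (enum (block j)))).
rewrite !nth_index // => [e|]; last by rewrite -(block_eq ij).
by apply: inner_trans (rep_innerP i) _; rewrite e inner_sym; apply: rep_innerP.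
Qed.

Variable g : 'S_n.

Definition generic (q : 'S_n) : tindex r := [ffun i => (iindex i, g (q (jindex i)))].

Lemma south_generic (x : ram b r) q :
  south_compat x (generic q) <->
  (forall i j, inner x (inr i) (inr j) -> inner x0 (inr i) (inr j)) /\
  (forall i j, outer x (inr i) (inr j) -> outer x0 (inr i) (inr j)).
Proof.
have e2 i j : ((generic q i).2 == (generic q j).2) = outer x0 (inr i) (inr j).
  by rewrite !ffunE /= !(inj_eq perm_inj) jindexP.
have e1 i j : outer x0 (inr i) (inr j) ->
    ((generic q i).1 == (generic q j).1) = inner x0 (inr i) (inr j).
  by move=> ij; rewrite !ffunE iindexP.
split=> [/south_compatP[c1 c2]|[c1 c2]].
  have ho i j : outer x (inr i) (inr j) -> outer x0 (inr i) (inr j).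
    by move=> ij; rewrite -e2; apply/eqP/c2.
  split=> // i j ij; rewrite -e1; first by apply/eqP/c1.
  exact/ho/inner_outer.
apply/south_compatP; split=> i j ij; apply/eqP; last by rewrite e2 (c2 _ _ ij).
by rewrite e1 (c1 _ _ ij, c2 _ _ (inner_outer ij)).
Qed.

Variables (u : X -> E b) (X0 : X).
Hypotheses (X0E : val X0 = x0) (u_blind : forall x, blind (u x))
  (u_equiv : forall p x a, u (relabeled p x) a = u x [ffun i => a (p i)]).

Definition alternating (x : X) (tx : 'I_b -> 'I_r) : F :=
  \sum_(q | col_perm la q) (-1) ^+ odd_perm q * u x [ffun k => generic q (tx k)].

Definition alternating0 : F :=
  \sum_(q | col_perm la q)
    (-1) ^+ odd_perm q * u X0 (at_first (Ordinal m_gt0) (fun k => g (q (low (h k))))).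

(** If [x] does not attach a northern vertex to the block holding [low (h k)], then neither this
    entry nor the top of its column is read, and the sum cancels. Otherwise [x] is a relabelling of
    [x0] and equivariance identifies the two sums. *)
Lemma alternating_or (x : X) (tx : 'I_b -> 'I_r) :
  (forall k, outer (val x) (inl k) (inr (tx k))) ->
  (forall i j, inner (val x) (inr i) (inr j) = inner x0 (inr i) (inr j)) ->
  (forall i j, outer (val x) (inr i) (inr j) = outer x0 (inr i) (inr j)) ->
  alternating x tx = 0 \/ alternating x tx = alternating0.
Proof.
move=> txP eI eO.
case: (boolp.pselect (exists k, forall l, ~ outer x0 (inl k) (inr (tx l)))) => [[k hk]|hx].
  left; apply: (@col_antisym F F^o _ _ (low (h k)) (top (h k))) => [||q].
  - exact: low_top.
  - exact: ci_top.
  congr (u x _); apply/ffunP=> l; rewrite !ffunE permM tpermD // eq_sym.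
    by have [|//] := @jindex_neq (tx l) k; apply/negP/hk.
  by have [|//] := @jindex_neq (tx l) k; apply/negP/hk.
right; have /boolp.choice[pi piP] k : exists l, outer x0 (inl k) (inr (tx l)).
  apply: boolp.contrapT => nl; apply: hx; exists k => l kl.
  by apply: nl; exists l.
have pi_inj : injective pi.
  move=> k l e; apply: h2; apply: outer_trans (piP k) _; by rewrite e outer_sym.
pose p := perm pi_inj.
have /standard_diagramP[s1 s2 _] := sx0.
have /standard_diagramP[t1 t2 _] := valP x.
have rlV v : relabel p (relabel p^-1%g v) = v :> vertex b r by case: v => // i /=; rewrite permKV.
(* [pi k] is the northern vertex that [x] attaches to the southern block joined to [k] in [x0]. *)
have xE : x = relabeled p X0.
  apply: val_inj => /=; apply: ram_eq => v w.
    rewrite -[v in RHS]rlV -[w in RHS]rlV inner_image X0E.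
    case: v w => [k|i] [l|j] /=.
    - apply/idP/idP => [/t1[->]|/s1[/perm_inj ->]]; exact: inner_refl.
    - by apply/idP/idP => [/t1|/s1].
    - by rewrite inner_sym [RHS]inner_sym; apply/idP/idP => [/t1|/s1].
    - exact: eI.
  have key k j : outer (val x) (inl k) (inr j) = outer x0 (inl (p^-1%g k)) (inr j).
    have e1 : outer (val x) (inl k) (inr j) = outer (val x) (inr (tx k)) (inr j).
      apply/idP/idP; apply: outer_trans => //; by rewrite outer_sym.
    have pk := piP (p^-1%g k).
    have pE l : p l = pi l by rewrite permE.
    have tk : tx (pi (p^-1%g k)) = tx k by rewrite -pE permKV.
    rewrite tk in pk; rewrite e1 eO.
    by apply/idP/idP; apply: outer_trans => //; rewrite outer_sym.
  rewrite -[v in RHS]rlV -[w in RHS]rlV outer_image X0E.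
  case: v w => [k|i] [l|j] /=.
  - apply/idP/idP => [/t2 ->|/s2/perm_inj ->]; exact: outer_refl.
  - exact: key.
  - by rewrite outer_sym key outer_sym.
  - exact: eO.
apply: eq_bigr => q _; congr (_ * _); rewrite {1}xE u_equiv; apply: u_blind => k.
by rewrite !ffunE /= permE (jindex_north (piP k)).
Qed.

(** In the signed sum of the evaluations at [generic q] only diagrams with finer southern part than
    [x0] survive; by minimality those with [u x] nonzero agree with [x0] there. Each summand is then
    0 or [alternating0], and [X0] yields the latter, so a positive multiple of it vanishes. *)
Lemma alternating0_eq0 :
  (forall x, u x != 0 -> (south_relations x0 <= south_relations (val x))%N) ->
  \sum_x diag F m n (val x) (u x) = 0 -> alternating0 = 0.
Proof.
move=> x0min sum0.
have taux (x : X) : exists t : 'I_b -> 'I_r, forall k, outer (val x) (inl k) (inr (t k)).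
  by have /standard_diagramP[_ _ /boolp.choice[t tP]] := valP x; exists t.
have [tx txP] := boolp.choice taux.
have mb : (m ^ b)%:R != 0 :> F by rewrite pnatr_eq0 -lt0n expn_gt0 m_gt0.
pose T (x : X) := [forall i, forall j, (inner (val x) (inr i) (inr j) ==> inner x0 (inr i) (inr j))
   && (outer (val x) (inr i) (inr j) ==> outer x0 (inr i) (inr j))].
have TP x q : south_compat (val x) (generic q) = T x.
  apply/idP/idP => [/south_generic[c1 c2]|/forallP H].
    by apply/forallP=> i; apply/forallP=> j; apply/andP; split; apply/implyP; [apply: c1 | apply: c2].
  apply/south_generic; split=> i j ij; have /forallP/(_ j)/andP[/implyP c1 /implyP c2] := H i; auto.
have sumT : \sum_(x | T x) alternating x (tx x) = 0.
  apply: (mulfI mb); rewrite mulr0 mulr_sumr.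
  transitivity (\sum_(q | col_perm la q) (-1) ^+ odd_perm q *
     (\sum_x diag F m n (val x) (u x) : E r) (generic q)); last first.
    by rewrite sum0 big1 // => q _; rewrite ffunE mulr0.
  under [RHS]eq_bigr do rewrite sum_ffunE mulr_sumr.
  rewrite [RHS]exchange_big [LHS]big_mkcond /=; apply: eq_bigr => x _.
  case: ifP => Tx; last first.
    rewrite big1 // => q _.
    by rewrite (diag_standardE _ (u_blind x) (valP x) (txP x)) TP Tx mul0r !mulr0.
  rewrite mulr_sumr; apply: eq_bigr => q _.
  by rewrite (diag_standardE _ (u_blind x) (valP x) (txP x)) TP Tx mul1r mulrCA.
have altT x : T x -> alternating x (tx x) = 0 \/ alternating x (tx x) = alternating0.
  move=> Tx; have [ux0|ux] := eqVneq (u x) 0.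
    by left; rewrite /alternating big1 // => q _; rewrite ux0 ffunE mulr0.
  have [c1 c2] : (forall i j, inner (val x) (inr i) (inr j) -> inner x0 (inr i) (inr j)) /\
     (forall i j, outer (val x) (inr i) (inr j) -> outer x0 (inr i) (inr j)).
    by apply/(south_generic (val x) 1%g); rewrite TP.
  have [d1 d2] := south_relations_min c1 c2 (x0min x ux).
  by apply: alternating_or.
have altX0 : alternating X0 (tx X0) = alternating0.
  have tX0 k : outer x0 (inl k) (inr (tx X0 k)) by rewrite -X0E; apply: txP.
  apply: eq_bigr => q _; congr (_ * _); apply: u_blind => k.
  by rewrite !ffunE /= (jindex_north (tX0 k)).
apply/eqP/contraT=> nz; move: sumT.
rewrite (eq_bigr (fun x => (alternating x (tx x) == alternating0)%:R * alternating0)) => [|x Tx].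
  rewrite -mulr_suml => /eqP; rewrite mulf_eq0 (negPf nz) orbF -natr_sum pnatr_eq0.
  have TX0 : T X0 by rewrite -(TP X0 1%g); apply/south_generic; rewrite X0E.
  by rewrite (bigD1 X0) //= altX0 eqxx.
case: (altT x Tx) => ->; last by rewrite eqxx mul1r.
by rewrite eq_sym (negPf nz) mul0r.
Qed.

End Generic.

(** Up to conjugation and the factor [m ^ b], [alternating0] is the inner product of
    [col_vector g h] with [u x0]. Its vanishing for all [g] and [h] makes [u x0] orthogonal to
    itself. *)
Lemma equivariant_family_eq0 (u : X -> E b) (c : X -> 'S_n -> 'S_b -> F) :
  (forall x, u x = \sum_g \sum_h c x g h *: col_vector g h) ->
  (forall p x a, u (relabeled p x) a = u x [ffun i => a (p i)]) ->
  \sum_x diag F m n (val x) (u x) = 0 -> forall x, u x = 0.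
Proof.
move=> uE u_equiv sum0 x1; apply/eqP/contraT => ux1.
have u_blind x : blind (u x).
  move=> a a' e; rewrite uE !sum_ffunE; apply: eq_bigr => g _; rewrite !sum_ffunE.
  apply: eq_bigr => h _; rewrite [LHS]ffunE [RHS]ffunE !sum_ffunE; congr (_ *: _).
  by apply: eq_bigr => q _; rewrite [LHS]ffunE [RHS]ffunE (@Om_blind _ _ _ _ _ _ _ e).
pose x0 := [arg min_(x < x1 | u x != 0) south_relations (val x)].
have [ux0 x0min] : u x0 != 0 /\
    forall x, u x != 0 -> (south_relations (val x0) <= south_relations (val x))%N.
  by rewrite /x0; case: arg_minnP.
have [tau tauP] : exists t : 'I_b -> 'I_r, forall k, outer (val x0) (inl k) (inr (t k)).
  by have /standard_diagramP[_ _ /boolp.choice[t tP]] := valP x0; exists t.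
have orth g h : dot (col_vector g h) (u x0) = 0.
  have <- : (m ^ b)%:R * (alternating0 h g u x0)^* = dot (col_vector g h) (u x0).
    rewrite /alternating0 rmorph_sum mulr_sumr /dot /col_vector.
    under [RHS]eq_bigr do rewrite sum_ffunE mulr_suml.
    rewrite [RHS]exchange_big; apply: eq_bigr => q _.
    rewrite rmorphM rmorph_sign mulrCA /= -dot_Om // /dot mulr_sumr; apply: eq_bigr => a _.
    by rewrite [in RHS]ffunE -mulrA.
  by rewrite (alternating0_eq0 h (valP x0) tauP g (erefl _) u_blind u_equiv x0min sum0) conjC0 mulr0.
have dot_sum (I : finType) (k : I -> F) (v : I -> E b) (w : E b) :
    dot (\sum_i k i *: v i) w = \sum_i k i * dot (v i) w.
  by rewrite (linear_sumZ (f := fun v => dot v w : F^o)) // => a v1 v2; apply: dotDl.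
case/eqP: ux0; apply: dot_eq0; rewrite {1}uE /dot.
under eq_bigr do rewrite sum_ffunE mulr_suml.
rewrite exchange_big big1 // => g _ /=; rewrite -/(dot _ _).
by rewrite dot_sum big1 // => h _; rewrite orth mulr0.
Qed.

End Injectivity.

(** * Injectivity on the Specht modules *)

Section NonVanishing.
Variables (F : numClosedFieldType) (m n b : nat) (be : seq nat).
Hypotheses (be_part : intpart b be) (be_le : (b + head 0%N be <= n)%N) (m_gt0 : (0 < m)%N).
Local Notation tindex := (tindex m n).
Local Notation E k := (free_space F (tindex k)).
Local Notation la := (padded be n).
Local Notation psi := (@psi F m n b be be_le).
Local Notation low := (low be_le).
Local Notation sumn_la := (sumn_la be_part be_le).

Definition lift_fun (h : 'S_b) (i : 'I_n) : 'I_n :=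
  if [pick k | i == low k] is Some k then low (h k) else i.

Lemma lift_fun_low h k : lift_fun h (low k) = low (h k).
Proof.
rewrite /lift_fun; case: pickP => [l /eqP/low_inj <- //|/(_ k)]; by rewrite eqxx.
Qed.

Lemma lift_fun_high h (i : 'I_n) : (i < n - b)%N -> lift_fun h i = i.
Proof.
rewrite /lift_fun; case: pickP => // k /eqP -> /=; lia.
Qed.

Lemma lift_fun_inj h : injective (lift_fun h).
Proof.
have high_lift (i : 'I_n) : (lift_fun h i < n - b)%N = (i < n - b)%N.
  case: (boolP (i < n - b)%N) => [hi|/(not_high be_part be_le)[k ->]]; first by rewrite lift_fun_high.
  by rewrite lift_fun_low /=; lia.
move=> i j e; have := congr1 (fun z : 'I_n => z < n - b)%N e; rewrite !high_lift.
case: (boolP (i < n - b)%N) => [hi|/(not_high be_part be_le)[k ek]].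
  by move=> hj; rewrite -(lift_fun_high h hi) e lift_fun_high -?hj.
case: (boolP (j < n - b)%N) => // /(not_high be_part be_le)[l el] _.
by move: e; rewrite ek el !lift_fun_low => /low_inj/perm_inj ->.
Qed.

(** Embeds ['S_b] as the permutations of the boxes below the first row. *)
Definition lift (h : 'S_b) : 'S_n := perm (@lift_fun_inj h).

Lemma lift_low h k : lift h (low k) = low (h k).
Proof. by rewrite permE lift_fun_low. Qed.
Lemma lift_high h (i : 'I_n) : (i < n - b)%N -> lift h i = i.
Proof. by move=> hi; rewrite permE lift_fun_high. Qed.

Lemma lift_inj : injective lift.
Proof. by move=> h h' e; apply/permP=> k; apply: (@low_inj _ _ _ be_le); rewrite -!lift_low e. Qed.

Lemma liftM h h' : lift (h * h')%g = (lift h * lift h')%g.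
Proof.
apply/permP=> i; rewrite permM.
case: (boolP (i < n - b)%N) => [hi|/(not_high be_part be_le)[k ->]]; first by rewrite !lift_high.
by rewrite !lift_low permM.
Qed.

Lemma lift_tperm k l : lift (tperm k l) = tperm (low k) (low l).
Proof.
apply/permP=> i; case: (boolP (i < n - b)%N) => [hi|/(not_high be_part be_le)[j ->]].
  by rewrite lift_high // tpermD //; apply/eqP=> ei; move: hi; rewrite -ei /=; lia.
rewrite lift_low; case: tpermP => [->|->|/eqP jk /eqP jl].
- by rewrite tpermL.
- by rewrite tpermR.
- by rewrite tpermD // (inj_eq (@low_inj _ _ _ be_le)) eq_sym.
Qed.

Lemma odd_lift h : odd_perm (lift h) = odd_perm h.
Proof.
have [ts -> _] := prod_tpermP h; elim: ts => [|[x y] ts IHts].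
  rewrite !big_nil !odd_perm1 /=; suff -> : lift 1%g = 1%g by rewrite odd_perm1.
  by apply: (mulgI (lift 1%g)); rewrite -liftM !mulg1.
rewrite !big_cons liftM !odd_permM IHts lift_tperm !odd_tperm.
by rewrite (inj_eq (@low_inj _ _ _ be_le)).
Qed.

Lemma col_lift h : col_perm la (lift h) = col_perm be h.
Proof.
apply/forallP/forallP => H i.
  by have := H (low i); rewrite lift_low !(ci_low be_part).
case: (boolP (i < n - b)%N) => [hi|/(not_high be_part be_le)[j ->]]; first by rewrite lift_high.
by rewrite lift_low !(ci_low be_part).
Qed.

Definition preserves_low (q : 'S_n) := [forall k, ~~ (q (low k) < n - b)%N].

Lemma lift_preserves h : preserves_low (lift h).
Proof. by apply/forallP=> k; rewrite lift_low /=; lia. Qed.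

Lemma preserves_lowP (q : 'S_n) : preserves_low q ->
  exists h : 'S_b, forall k, q (low k) = low (h k).
Proof.
move=> /forallP pq.
have /boolp.choice[f fP] k : exists l, q (low k) = low l by exact: (not_high be_part be_le (pq k)).
have finj : injective f.
  by move=> k l e; apply: (@low_inj _ _ _ be_le); apply: (@perm_inj _ q); rewrite !fP e.
by exists (perm finj) => k; rewrite permE fP.
Qed.

(** Keeping the lower boxes below keeps the first row in place as a set, and each column meets the
    first row only once. *)
Lemma col_preserves_lift (q : 'S_n) : col_perm la q -> preserves_low q -> exists h, q = lift h.
Proof.
move=> /forallP cq /preserves_lowP[h hP]; exists h; apply/permP=> i.
case: (boolP (i < n - b)%N) => [hi|/(not_high be_part be_le)[j ->]]; last by rewrite lift_low hP.
rewrite lift_high //; apply: (@box_inj n la); last exact/eqP/cq.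
have /eqP -> : reshape_index la i == 0%N by rewrite (ri_high be_part).
apply/eqP; rewrite (ri_high be_part); apply: contraT => /(not_high be_part be_le)[l ql].
have /perm_inj ei : q i = q (low (h^-1%g l)) by rewrite ql hP permKV.
by move: hi; rewrite ei /=; lia.
Qed.

(** Left inverse of [psi 1]: the coefficients at the arrangements of the lower boxes. *)
Definition low_part (u : E b) : galg F 'S_b :=
  [ffun k => u (at_first (Ordinal m_gt0) (fun l => low ((k : 'S_b) l)))].

Lemma low_part_linear : linear low_part.
Proof. by move=> c u v; apply/ffunP=> k; rewrite !ffunE. Qed.

Lemma psi_first (g : 'S_n) t : psi (gbasis F g) t = \sum_h t h *: Om F m (fun k => g (low (h k))).
Proof.
rewrite (galgE t) (linear_sumZ (psi_linr _ _ _)); apply: eq_bigr => h _.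
by rewrite psi_basis -galgE.
Qed.

Lemma low_part_lift s t (p : 'S_n) (p' : 'S_b) :
  (forall k, p (low k) = low (p' k)) ->
  low_part (psi (s * gbasis F p) t) = low_part (psi s t) * gbasis F p'.
Proof.
move=> pE; apply/ffunP=> k; rewrite gmulbr !ffunE.
rewrite -[p]/((([ffun=> 1%g], p) : wreath m n).2) -psi_wreath wreath_opE.
apply: psi_blind => l; rewrite !ffunE /= permM; apply: (@perm_inj _ p).
by rewrite permKV pE permKV.
Qed.

Lemma low_part_one t : low_part (psi 1 t) = t.
Proof.
apply/ffunP=> k; rewrite ffunE psi_first sum_ffunE (bigD1 k) //= big1 => [|h nh].
  rewrite !ffunE addr0 [X in (nat_of_bool X)%:R](_ : _ = true) ?mulr1 //.
    by rewrite /GRing.scale /= mulr1.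
  by apply/forallP=> l; rewrite ffunE /= perm1.
rewrite !ffunE; case: forallP => [H|]; last by rewrite scaler0.
case/eqP: nh; apply/permP=> l; apply: (@low_inj _ _ _ be_le).
by have := H l; rewrite ffunE /= perm1 => /eqP.
Qed.

Lemma low_part_outside (q : 'S_n) t : ~~ preserves_low q -> low_part (psi (gbasis F q) t) = 0.
Proof.
case/forallPn=> k; rewrite negbK => qk; apply/ffunP=> h; rewrite !ffunE psi_first sum_ffunE.
apply: big1 => h' _; rewrite !ffunE; case: forallP => [H|]; last by rewrite scaler0.
have := H (h'^-1%g k); rewrite ffunE /= permKV => /eqP e.
by move: qk; rewrite -e /=; lia.
Qed.

(** Column permutations that bring a lower box into the first row contribute nothing; the others are
    the lifts of the column group of [be], with the same signs. *)
Lemma low_part_col t : low_part (psi (col_sum F n la) t) = t * col_sum F b be.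
Proof.
rewrite /col_sum (linear_sumZ (psi_linl _ _ t)) (linear_sumZ low_part_linear).
rewrite (bigID preserves_low) /= [X in _ + X]big1 ?addr0 => [|q /andP[_ nq]]; last first.
  by rewrite low_part_outside ?scaler0.
pose down q := odflt 1%g [pick h | q == lift h].
have downK h : down (lift h) = h.
  rewrite /down; case: pickP => [h' /eqP/lift_inj <- //|/(_ h)]; by rewrite eqxx.
rewrite (reindex_onto lift down) => [|q /andP[cq pq]]; last first.
  by have [h ->] := col_preserves_lift cq pq; rewrite downK.
rewrite mulr_sumr; apply: eq_big => h.
  by rewrite col_lift lift_preserves downK eqxx !andbT.
move=> _; rewrite odd_lift -scalerAr; congr (_ *: _).
by rewrite -[gbasis F (lift h)]mul1r (low_part_lift _ _ (lift_low h)) low_part_one.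
Qed.

Lemma row_preserves (p : 'S_n) : row_perm la p -> preserves_low p.
Proof.
move=> /forallP hp; apply/forallP=> k; rewrite -(ri_high be_part) (eqP (hp _)).
by rewrite (ri_low be_part).
Qed.

(** Row permutations keep the lower boxes below and restrict to row permutations of [be]. After
    [low_part] and multiplication by [row_sum], a nonzero multiple of the square of the smaller
    symmetrizer is left. *)
Lemma psi_symmetrizer_neq0 : psi (symmetrizer F n la) (symmetrizer F b be) != 0.
Proof.
have /boolp.choice[d dP] (p : 'S_n) : exists h : 'S_b, row_perm la p ->
    (forall k, p (low k) = low (h k)).
  case: (boolP (row_perm la p)) => [/row_preserves/preserves_lowP[h hP]|_]; last by exists 1%g.
  by exists h.
have dR (p : 'S_n) : row_perm la p -> row_perm be (d p).
  move=> rp; apply/forallP=> k; have := (forallP rp) (low k).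
  by rewrite (dP p rp) !(ri_low be_part) eqSS.
set e := symmetrizer F b be; pose rho : galg F 'S_b := \sum_(p | row_perm la p) gbasis F (d p).
have rhoR : rho * row_sum F b be = #|[set p : 'S_n | row_perm la p]|%:R *: row_sum F b be.
  rewrite /rho mulr_suml (eq_bigr (fun=> row_sum F b be)) => [|p rp]; last first.
    by rewrite row_sumM // dR.
  by rewrite sumr_const cardsE scaler_nat.
have lowE : low_part (psi (symmetrizer F n la) e) = e * col_sum F b be * rho.
  rewrite /symmetrizer /row_sum /rho !mulr_sumr.
  have := linear_sumZ (psi_linl m be_le e) (index_enum _) (fun p => row_perm la p) (fun=> 1)
     (fun p => col_sum F n la * gbasis F p).
  under eq_bigr do rewrite scale1r.
  move=> ->; rewrite (linear_sumZ low_part_linear); apply: eq_bigr => p rp.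
  by rewrite scale1r (low_part_lift _ _ (dP p rp)) low_part_col -mulr_sumr.
apply/negP=> /eqP psi0; move: lowE; rewrite psi0.
have -> : low_part 0 = 0 by apply/ffunP=> k; rewrite !ffunE.
move/(congr1 (fun z => z * row_sum F b be)); rewrite /= mul0r -[_ * rho * _]mulrA rhoR -scalerAr.
rewrite -[e * _ * _]mulrA.
move/esym/eqP; rewrite scaler_eq0 pnatr_eq0 cards_eq0 -/(symmetrizer F b be).
rewrite (negPf (@symmetrizer_sqr_neq0 F b be)) orbF; apply/negP/set0Pn.
by exists 1%g; rewrite inE row_perm1.
Qed.

(** Injectivity of [psi] on the tensor product of the two ideals. Multiplying by [x * e] on the
    right and by [e' * x'] on the left turns each term into a scalar multiple of [psi e e'], and the
    resulting scalar relation is resolved by nondegeneracy, one factor at a time. *)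
Lemma psi_independent N (s : 'I_N -> galg F 'S_n) (t : 'I_N -> galg F 'S_b) :
  (forall i, exists y, s i = symmetrizer F n la * y) ->
  (forall i, exists z, t i = z * symmetrizer F b be) ->
  (forall c : 'I_N -> F, \sum_i c i *: s i = 0 -> forall i, c i = 0) ->
  \sum_i psi (s i) (t i) = 0 -> forall i, t i = 0.
Proof.
set e := symmetrizer F n la; set e' := symmetrizer F b be => sE tE free sum0.
have [y yE] := boolp.choice sE; have [z zE] := boolp.choice tE.
have sumM x x' : \sum_i psi (s i * x) (x' * t i) = 0.
  have sumMl t' g : \sum_i psi (s i) (t' i) = 0 -> \sum_i psi (s i * gbasis F g) (t' i) = 0.
    move=> H; transitivity (wreath_op F b ([ffun=> 1%g], g) (\sum_i psi (s i) (t' i))).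
      by rewrite linear_sum; apply: eq_bigr => i _; rewrite /= psi_wreath.
    by rewrite H linear0.
  have sumMr h : \sum_i psi (s i) (gbasis F h * t i) = 0.
    apply/ffunP=> a; rewrite sum_ffunE ffunE; under eq_bigr do rewrite psi_shift.
    by have /ffunP/(_ [ffun k => a (h^-1%g k)]) := sum0; rewrite sum_ffunE [RHS]ffunE.
  have sumMr' : \sum_i psi (s i) (x' * t i) = 0.
    rewrite (galgE x'); under eq_bigr do rewrite mulr_suml.
    under eq_bigr => i _ do under eq_bigr => h _ do rewrite -scalerAl.
    under eq_bigr do rewrite (linear_sumZ (psi_linr _ _ _)).
    rewrite exchange_big big1 // => h _; rewrite -scaler_sumr sumMr scaler0 //.
  rewrite (galgE x); under eq_bigr do rewrite mulr_sumr.
  under eq_bigr => i _ do under eq_bigr => h _ do rewrite -scalerAr.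
  under eq_bigr do rewrite (linear_sumZ (psi_linl _ _ _)).
  by rewrite exchange_big big1 // => h _; rewrite -scaler_sumr sumMl ?scaler0.
have [lam lamP] := boolp.choice (fun x : galg F 'S_n => symmetrizer_sandwich sumn_la x).
have [mu muP] := boolp.choice (fun x : galg F 'S_b => symmetrizer_sandwich (sumn_be be_part) x).
rewrite -/e in lamP; rewrite -/e' in muP.
have orth x x' : \sum_i lam (y i * x) * mu (x' * z i) = 0.
  have := sumM (x * e) (e' * x').
  rewrite (eq_bigr (fun i => (lam (y i * x) * mu (x' * z i)) *: psi e e')) => [|i _]; last first.
    rewrite yE zE.
    have -> : e * y i * (x * e) = lam (y i * x) *: e + 0 by rewrite addr0 -lamP !mulrA.
    have -> : e' * x' * (z i * e') = mu (x' * z i) *: e' + 0 by rewrite addr0 -muP !mulrA.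
    have psi0l t' : psi 0 t' = 0.
      by have := psi_linl m be_le t' (-1) 0 0; rewrite !scaler0 addr0 scaleN1r addNr.
    have psi0r s' : psi s' 0 = 0.
      by have := psi_linr m be_le s' (-1) 0 0; rewrite !scaler0 addr0 scaleN1r addNr.
    by rewrite psi_linl psi_linr psi0l psi0r !addr0 scalerA.
  rewrite -scaler_suml => /eqP; rewrite scaler_eq0 (negPf psi_symmetrizer_neq0) orbF.
  by move/eqP.
have mu0 x' i : mu (x' * z i) = 0.
  (* The combination of the [s i] with coefficients [mu (x' * z i)] pairs to 0 with the whole left
     ideal, so it vanishes. *)
  move: i; apply: free; rewrite (eq_bigr (fun i => e * (mu (x' * z i) *: y i))) => [|i _]; last first.
    by rewrite yE scalerAr.
  rewrite -mulr_sumr; apply: (right_ideal_faithful) => x; rewrite -/e.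
  rewrite mulr_sumr !mulr_suml (eq_bigr (fun i => (lam (y i * x) * mu (x' * z i)) *: e)) => [|i _].
    by rewrite -scaler_suml orth scale0r.
  by rewrite -scalerAr -!scalerAl -[e * y i * x]mulrA lamP scalerA mulrC.
move=> i; rewrite zE; apply: left_ideal_faithful => x'.
by rewrite mulrA -[e' * x' * _]mulrA muP mu0 scale0r.
Qed.

End NonVanishing.

(** * Modules and tensor products *)

Lemma linear_lfun (F : fieldType) (U V : vectType F) (f : U -> V) :
  linear f -> exists g : 'Hom(U, V), forall u, g u = f u.
Proof.
move=> lin_f; pose G := HB.pack_for {linear U -> V} f (GRing.isLinear.Build _ _ _ _ f lin_f).
by exists (linfun G) => u; rewrite lfunE.
Qed.

Lemma linear_injective (F : fieldType) (U V : vectType F) (f : U -> V) :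
  linear f -> (forall u, f u = 0 -> u = 0) -> injective f.
Proof.
case/linear_lfun=> g gE f0 u v; rewrite -!gE => e; apply/eqP; rewrite -subr_eq0.
by apply/eqP/f0; rewrite -gE linearB /= e subrr.
Qed.

(** * Tensor products in coordinates *)

Section Tensor.
Variable F : fieldType.
Implicit Types U V Z : vectType F.

Definition unit_vec U (i : 'I_(dim U)) : U := r2v (delta_mx 0 i).

Lemma unit_vec_sum U (u : U) : u = \sum_i v2r u 0 i *: unit_vec i.
Proof.
rewrite -{1}(v2rK u) {1}(row_sum_delta (v2r u)) linear_sum; apply: eq_bigr => i _.
by rewrite linearZ.
Qed.

Lemma unit_vec_free U (c : 'I_(dim U) -> F) : \sum_i c i *: unit_vec i = 0 -> forall i, c i = 0.
Proof.
move=> /(congr1 v2r); rewrite linear_sum linear0 => /rowP H i; have := H i.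
rewrite summxE (bigD1 i) //= big1 => [|j ji]; rewrite linearZ /= r2vK !mxE !eqxx ?mulr1 ?addr0 //.
by rewrite eq_sym (negPf ji) mulr0.
Qed.

Lemma pure_tensorE U V (u : U) (v : V) i j : pure_tensor u v i j = v2r u 0 i * v2r v 0 j.
Proof. by rewrite /pure_tensor mxE big_ord1 mxE. Qed.

(** A normal form whose left factors are the basis of [U]; it provides the free family for
    [psi_independent]. *)
Lemma tensor_sum U V (A : tensor U V) :
  A = \sum_i pure_tensor (unit_vec i) (r2v (row i A) : V).
Proof.
apply/matrixP=> i j; rewrite summxE (bigD1 i) //= big1 => [|k ki].
  by rewrite pure_tensorE !r2vK !mxE !eqxx mul1r addr0.
by rewrite pure_tensorE /unit_vec !r2vK !mxE [i == k]eq_sym (negPf ki) andbF mul0r.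
Qed.

Lemma pure_tensorDl U V c (u u' : U) (v : V) :
  pure_tensor (c *: u + u') v = c *: pure_tensor u v + pure_tensor u' v.
Proof.
apply/matrixP=> i j; rewrite pure_tensorE [RHS]mxE [X in _ = X + _]mxE !pure_tensorE linearP !mxE.
by rewrite mulrDl mulrA.
Qed.

Lemma pure_tensorDr U V c (u : U) (v v' : V) :
  pure_tensor u (c *: v + v') = c *: pure_tensor u v + pure_tensor u v'.
Proof.
apply/matrixP=> i j; rewrite pure_tensorE [RHS]mxE [X in _ = X + _]mxE !pure_tensorE linearP !mxE.
by rewrite mulrDr mulrCA.
Qed.

Lemma pure_tensor0l U V (v : V) : pure_tensor (0 : U) v = 0.
Proof. by apply/matrixP=> i j; rewrite pure_tensorE linear0 !mxE mul0r. Qed.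

Lemma pure_tensor0r U V (u : U) : pure_tensor u (0 : V) = 0.
Proof. by apply/matrixP=> i j; rewrite pure_tensorE linear0 !mxE mulr0. Qed.

Lemma pure_tensor_suml U V (I : finType) (u : I -> U) (v : V) :
  pure_tensor (\sum_i u i) v = \sum_i pure_tensor (u i) v.
Proof.
apply/matrixP=> i j; rewrite pure_tensorE linear_sum summxE [RHS]summxE mulr_suml.
by apply: eq_bigr => k _; rewrite pure_tensorE.
Qed.

Lemma pure_tensorZl U V c (u : U) (v : V) : pure_tensor (c *: u) v = c *: pure_tensor u v.
Proof. by rewrite -[c *: u]addr0 pure_tensorDl pure_tensor0l addr0. Qed.

Lemma pure_tensor_eq0r U V (u : U) (v : V) : u != 0 -> pure_tensor u v = 0 -> v = 0.
Proof.
move=> u0 uv; have [i ui] : exists i, v2r u 0 i != 0.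
  apply/existsP; apply: contraNT u0; rewrite negb_exists => /forallP H.
  apply/eqP; apply: (can_inj (@v2rK _ U)); rewrite linear0; apply/rowP=> i.
  by apply/eqP; rewrite mxE; have := H i; rewrite negbK.
apply: (can_inj (@v2rK _ V)); rewrite linear0; apply/rowP=> j; rewrite mxE.
have /matrixP/(_ i j)/eqP := uv; rewrite pure_tensorE mxE mulf_eq0 (negPf ui).
by move/eqP.
Qed.

(** Existence half of the universal property; [tensor_ind] is the uniqueness half. *)
Lemma tensor_lift U V Z (B : U -> V -> Z) :
  (forall v, linear (B^~ v)) -> (forall u, linear (B u)) ->
  exists f : 'Hom(tensor U V, Z), forall u v, f (pure_tensor u v) = B u v.
Proof.
move=> linl linr.
have [f fE] : exists f : 'Hom(tensor U V, Z), forall A : tensor U V,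
    f A = \sum_i \sum_j A i j *: B (unit_vec i) (unit_vec j).
  apply: linear_lfun => c A A'; rewrite scaler_sumr -big_split; apply: eq_bigr => i _ /=.
  rewrite scaler_sumr -big_split; apply: eq_bigr => j _ /=.
  by rewrite !mxE scalerDl scalerA.
have lsum (Y : vectType F) (g : Y -> Z) (ling : linear g) (I : finType) (c : I -> F) (w : I -> Y) :
    g (\sum_i c i *: w i) = \sum_i c i *: g (w i).
  have [h hE] := linear_lfun ling; rewrite -hE linear_sum; apply: eq_bigr => i _.
  by rewrite linearZ /= hE.
exists f => u v; rewrite fE [in RHS](unit_vec_sum u) (lsum _ _ (linl v)).
apply: eq_bigr => i _; rewrite [in RHS](unit_vec_sum v) (lsum _ _ (linr _)) scaler_sumr.
by apply: eq_bigr => j _; rewrite pure_tensorE scalerA.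
Qed.

Lemma tensor_ind U V Z (f g : tensor U V -> Z) : linear f -> linear g ->
  (forall u v, f (pure_tensor u v) = g (pure_tensor u v)) -> forall A, f A = g A.
Proof.
move=> /linear_lfun[f' fE] /linear_lfun[g' gE] fg A.
rewrite -fE -gE (tensor_sum A) !linear_sum; apply: eq_bigr => i _.
by rewrite /= fE gE.
Qed.

End Tensor.

(** * Orthogonal complements *)

Section Complement.
Variables (F : numClosedFieldType) (B : finType).
Local Notation V := (free_space F B).

(** The complement is the kernel of the map [p] taking inner products with a basis of [U]. The rank
    of [p] is at most the dimension of [U], so the two spaces fill everything. *)
Lemma orthogonal_complement (U : {vspace V}) : exists W : {vspace V},
  [/\ (U + W)%VS = fullv, (U :&: W)%VS = 0%VS
    & forall v, v \in W <-> forall u, u \in U -> dot v u = 0].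
Proof.
have [p pE] : exists p : 'Hom(V, 'rV[F]_(\dim U)),
    forall v, p v = \row_i dot v (vbasis U)`_i.
  by apply: linear_lfun => c u v; apply/rowP=> i; rewrite !mxE dotDl.
have WP v : v \in lker p <-> forall u, u \in U -> dot v u = 0.
  rewrite memv_ker; split=> [/eqP p0 u uU|H]; last first.
    by apply/eqP; rewrite pE; apply/rowP=> i; rewrite !mxE H ?vbasis_mem ?memt_nth.
  rewrite (coord_vbasis uU) dotC; apply/eqP; rewrite conjC_eq0; apply/eqP.
  have dot_sum (I : finType) (k : I -> F) (w : I -> V) (z : V) :
      dot (\sum_i k i *: w i) z = \sum_i k i * dot (w i) z.
    have [d dE] : exists d : 'Hom(V, F^o), forall w, d w = dot w z.
      by apply: linear_lfun => a v1 v2; apply: dotDl.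
    by rewrite -dE linear_sum; apply: eq_bigr => i _; rewrite linearZ /= dE.
  rewrite dot_sum big1 // => i _; rewrite dotC.
  by have /rowP/(_ i) := p0; rewrite pE !mxE => ->; rewrite conjC0 mulr0.
exists (lker p); split=> //; last first.
  apply/eqP; rewrite -subv0; apply/subvP=> v /memv_capP[vU /WP/(_ v vU)/dot_eq0 ->].
  exact: mem0v.
have cap0 : (U :&: lker p)%VS = 0%VS.
  apply/eqP; rewrite -subv0; apply/subvP=> v /memv_capP[vU /WP/(_ v vU)/dot_eq0 ->].
  exact: mem0v.
apply/eqP; rewrite eqEdim subvf /= dimv_disjoint_sum //.
rewrite -(limg_ker_dim p fullv) capfv addnC leq_add2r.
by apply: leq_trans (dimvS (subvf _)) _; rewrite dimvf /dim /= mul1n.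
Qed.

End Complement.

(** * Quotients, heads and direct summands of modules *)

Section Modules.
Variables (F : fieldType) (W : Type).
Implicit Types M N : module F W.

Lemma quot_operatorE M (K : {vspace M}) w (u : quot_module K) :
  vsval (operator (quot_module K) w u) = daddv_pi K^C K (operator M w (vsval u)).
Proof. by rewrite /= !lfunE /= !lfunE /= !lfunE /= !lfunE /= vsprojK ?memv_pi. Qed.

Lemma module_iso_sym M N : module_iso M N -> module_iso N M.
Proof.
case=> f [hf bf]; have [g' fK gK] := bf.
have ker0 : (lker f == 0)%VS by apply/lker0P/(can_inj fK).
exists (f^-1)%VF; split; last first.
  exists f => u; first by rewrite -{1}(gK u) lker0_lfunK // gK.
  by rewrite lker0_lfunK.
move=> w; apply/lfunP=> u; rewrite !lfunE /= -(gK u) lker0_lfunK //.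
have /lfunP/(_ (g' u)) := hf w; rewrite !lfunE /= => <-.
by rewrite lker0_lfunK.
Qed.

Lemma simple_module_iso M N : module_iso M N -> simple_module M -> simple_module N.
Proof.
case=> f [hf bf] [M0 Msub]; have [g fK gK] := bf.
have ker0 : (lker f == 0)%VS by apply/lker0P/(can_inj fK).
have im_f : limg f = fullv.
  by apply/vspaceP=> u; rewrite memvf -(gK u) memv_img ?memvf.
split=> [N0|U subU].
  apply: M0; apply/eqP; rewrite -subv0; apply/subvP=> v _.
  have : f v \in (0%VS : {vspace N}) by rewrite -N0 memvf.
  by rewrite !memv0 => /eqP fv; apply/eqP; apply: (can_inj fK); rewrite fv linear0.
have UE : (f @: (f @^-1: U))%VS = U by rewrite lpreimK ?im_f ?subvf.
have subpre : submodule (f @^-1: U)%VS.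
  move=> w; apply/subvP=> _ /memv_imgP[v + ->]; rewrite -!memv_preim => fv.
  have /lfunP/(_ v) := hf w; rewrite !lfunE /= => ->.
  by apply: (subvP (subU w)); apply: memv_img.
by have [e|e] := Msub _ subpre; [left | right]; rewrite -UE e ?limg0.
Qed.

Lemma quot_zero_iso M : module_iso M (@quot_module F W M 0%VS).
Proof.
have m0 v : v \in (0%VS : {vspace M})^C%VS by rewrite -[(0^C)%VS]add0v addv_complf memvf.
have projE v : daddv_pi (0%VS : {vspace M})^C 0 v = v.
  by apply: daddv_pi_id (m0 v); rewrite capv0.
exists (linfun (@vsproj _ _ (0%VS : {vspace M})^C)); split.
  by move=> w; apply/lfunP=> u; rewrite !lfunE /= !lfunE /= !lfunE /= !lfunE /= vsprojK // projE lfunE.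
by exists vsval => u; rewrite lfunE /= ?vsprojK ?vsvalK.
Qed.

(** In a simple module 0 is a maximal submodule, so the radical is 0. The head is then the quotient
    by 0, a copy on another carrier. *)
Lemma simple_head M : simple_module M ->
  simple_module (head_module M) /\ module_iso M (head_module M).
Proof.
move=> sM; have [M0 Msub] := sM.
have rad0 : radical M = 0%VS.
  apply/eqP; rewrite -subv0; apply/subvP=> v /radicalP; apply; split.
  - by move=> w; rewrite limg0 subvv.
  - by move/esym.
  - by move=> U subU _; have [->|->] := Msub U subU; [left | right].
have iso : module_iso M (head_module M) by rewrite /head_module rad0; apply: quot_zero_iso.
by split=> //; apply: simple_module_iso iso sM.
Qed.

Lemma injective_direct_summand M N (f : 'Hom(N, M)) :
  module_hom f -> lker f = 0%VS ->
  (forall U : {vspace M}, submodule U -> exists V : {vspace M},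
     [/\ submodule V, (U + V)%VS = fullv & (U :&: V)%VS = 0%VS]) ->
  direct_summand M N.
Proof.
move=> hf ker0 compl.
have subI : submodule (limg f).
  move=> w; apply/subvP=> _ /memv_imgP[_ /memv_imgP[u _ ->] ->].
  have /lfunP/(_ u) := hf w; rewrite !lfunE /= => <-.
  by rewrite memv_img ?memvf.
have [V [subV sumV capV]] := compl _ subI.
exists (limg f), V; split=> //; apply: module_iso_sym.
have mem u : f u \in limg f by rewrite memv_img ?memvf.
have kf : (lker f == 0)%VS by rewrite ker0.
exists (linfun (@vsproj _ _ (limg f)) \o f)%VF; split.
  move=> w; apply/lfunP=> u; rewrite !lfunE /= !lfunE /= !lfunE /= !lfunE /= vsprojK //.
  by have /lfunP/(_ u) := hf w; rewrite !lfunE /= => ->.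
exists (fun v => f^-1%VF (vsval v)) => u; rewrite !lfunE /= !lfunE /=.
  by rewrite vsprojK // lker0_lfunK.
apply: subvs_inj; have /memv_imgP[v _ vE] := subvsP u.
by rewrite vE lker0_lfunK // vsprojK.
Qed.

End Modules.

Lemma outer_tensor_hom (F : fieldType) (G D : Type) (M : module F G) (N : module F D)
    (P : module F (G + D)) (f : 'Hom(tensor M N, P)) :
  (forall g u v, f (pure_tensor (operator M g u) v) = operator P (inl g) (f (pure_tensor u v))) ->
  (forall d u v, f (pure_tensor u (operator N d v)) = operator P (inr d) (f (pure_tensor u v))) ->
  @module_hom _ _ (outer_tensor M N) P f.
Proof.
move=> fl fr w; apply/lfunP=> A; rewrite !comp_lfunE.
apply: (@tensor_ind F M N P (fun A => f (operator (outer_tensor M N) w A))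
  (fun A => operator P w (f A))) => [c u v|c u v|u v].
- by rewrite !linearP.
- by rewrite !linearP.
by case: w => [g|d]; rewrite /= tensor_mapE id_lfunE ?fl ?fr.
Qed.

(** * Specht modules and standard diagrams *)

(** In the glued graph a northern singleton has no neighbour but itself, so paths never leave it. *)
Lemma north_singletons_stack b r l (x : ram b r) (d : ram r l) :
  north_singletons x -> north_singletons (stack x d).
Proof.
move=> ns k v; rewrite /inner same_stack /= => /connectP[p].
have step w : glue (ram_val x).1 (ram_val d).1 (inl (inl k)) w -> w = inl (inl k).
  case/orP=> /exists_inP[B inB /andP[/imsetP[u uB eu] /imsetP[w' wB ->]]].
    have ku : u = inl k by case: u eu {uB} => // j [->].
    by rewrite (ns k w') //; apply/exists_inP; exists B; rewrite // wB -ku uB.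
  by case: u eu {uB}.
have lst : forall p, path (glue (ram_val x).1 (ram_val d).1) (inl (inl k)) p ->
    last (inl (inl k)) p = inl (inl k).
  by elim=> //= w q IHq /andP[/step ->].
by move/lst=> ->; case: v => // j [->].
Qed.

(** All inner blocks are singletons; [col] joins northern vertex [k] to southern vertex [k] in an
    outer block. *)
Lemma exists_standard b r : (b <= r)%N ->
  exists x : standard_basis r b, forall i j, outer (val x) (inr i) (inr j) -> i = j.
Proof.
move=> br; pose col (v : vertex b r) := match v with inl k => widen_ord br k | inr j => j end.
pose P (T : eqType) (f : vertex b r -> T) := preim_partition f [set: vertex b r].
have sameP (T : eqType) (f : vertex b r -> T) u v : same (P T f) u v = (f u == f v).
  rewrite same_pblock ?preim_partitionP //.
  rewrite pblock_equivalence_partition ?inE // => x y z _ _ _; split=> // /eqP ->.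
  by [].
have ramP : ramified (P _ id, P _ col).
  apply/and3P; split; rewrite ?preim_partitionP //=.
  apply/forall_inP=> _ /imsetP[u _ ->]; apply/exists_inP.
  exists [set v in [set: vertex b r] | col u == col v]; first exact: imset_f.
  by apply/subsetP=> v; rewrite !inE => /eqP ->; rewrite /= eqxx.
pose d := Ram ramP.
have innE u v : inner d u v = (u == v) by exact: sameP.
have outE u v : outer d u v = (col u == col v) by exact: sameP.
have sd : standard_diagram d.
  apply/standard_diagramP; split=> [k v|k l|k].
  - by rewrite innE eq_sym => /eqP.
  - by rewrite outE /= => /eqP/(congr1 val) /= e; apply: val_inj.
  - by exists (widen_ord br k); rewrite outE.
by exists (Sub d sd) => i j; rewrite SubK outE => /eqP.
Qed.

(** * Specht modules as one-sided ideals *)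

Section Specht.
Variables (F : numClosedFieldType) (n : nat) (la : seq nat).
Local Notation e := (symmetrizer F n la).
Local Notation SL := (specht_left F n la).
Local Notation SR := (specht_right F n la).

Definition left_val (s : SL) : galg F 'S_n := vsval s.
Definition right_val (t : SR) : galg F 'S_n := vsval t.

Lemma left_regularE g (a : galg F 'S_n) : operator (left_regular F n) g a = a * gbasis F g.
Proof.
apply/ffunP=> k; rewrite gmulbr matrix_mapE (bigD1 (k * g^-1)%g) //= big1 => [|h nh].
  by rewrite /pcomp mulgKV eqxx mulr1 addr0.
case: eqP => [kh|]; last by rewrite mulr0.
by rewrite kh mulgK eqxx in nh.
Qed.

Lemma right_regularE g (a : galg F 'S_n) : operator (right_regular F n) g a = gbasis F g * a.
Proof.
apply/ffunP=> k; rewrite gmulbl matrix_mapE (bigD1 (g^-1 * k)%g) //= big1 => [|h nh].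
  by rewrite /pcomp mulKVg eqxx mulr1 addr0.
case: eqP => [kh|]; last by rewrite mulr0.
by rewrite kh mulKg eqxx in nh.
Qed.

Lemma span_stable (V : vectType F) (I : finType) (v : I -> V) (f : 'End(V)) :
  (forall i, exists j, f (v i) = v j) ->
  forall u, u \in <<[seq v i | i : I]>>%VS -> f u \in <<[seq v i | i : I]>>%VS.
Proof.
move=> fv u /(memv_img f); rewrite limg_span; apply: subvP; apply/span_subvP=> _ /mapP[_ /mapP[i _ ->] ->].
by have [j ->] := fv i; apply/memv_span/mapP; exists j; rewrite ?mem_enum.
Qed.

Lemma left_valM g (s : SL) : left_val (operator SL g s) = left_val s * gbasis F g.
Proof.
rewrite /left_val /= !lfunE /= !lfunE /= !lfunE /= vsprojK; first exact: left_regularE.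
apply: span_stable (subvsP s) => h; exists (h * g)%g.
by rewrite !left_regularE -mulrA gbasisM.
Qed.

Lemma right_valM g (t : SR) : right_val (operator SR g t) = gbasis F g * right_val t.
Proof.
rewrite /right_val /= !lfunE /= !lfunE /= !lfunE /= vsprojK; first exact: right_regularE.
apply: span_stable (subvsP t) => h; exists (g * h)%g.
by rewrite !right_regularE mulrA gbasisM.
Qed.

Lemma left_val_ideal (s : SL) : exists y, left_val s = e * y.
Proof.
have [f fE] : exists f : 'End(group_alg F n), forall y : galg F 'S_n, f y = e * y.
  apply: linear_lfun => c y y'.
  suff H (a a' : galg F 'S_n) : e * (c *: a + a') = c *: (e * a) + e * a' by exact: H.
  by rewrite mulrDr -scalerAr.
have : left_val s \in limg f.
  apply: subvP (subvsP s); apply/span_subvP=> _ /mapP[g _ ->].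
  by rewrite left_regularE -symmetrizerE -fE memv_img ?memvf.
by case/memv_imgP=> y _ ->; exists y; rewrite fE.
Qed.

Lemma right_val_ideal (t : SR) : exists z, right_val t = z * e.
Proof.
have [f fE] : exists f : 'End(group_alg F n), forall y : galg F 'S_n, f y = y * e.
  apply: linear_lfun => c y y'.
  suff H (a a' : galg F 'S_n) : (c *: a + a') * e = c *: (a * e) + a' * e by exact: H.
  by rewrite mulrDl -scalerAl.
have : right_val t \in limg f.
  apply: subvP (subvsP t); apply/span_subvP=> _ /mapP[g _ ->].
  by rewrite right_regularE -symmetrizerE -fE memv_img ?memvf.
by case/memv_imgP=> y _ ->; exists y; rewrite fE.
Qed.

Lemma exists_left_val : exists s : SL, left_val s = e.
Proof.
have eS : e \in <<[seq operator (left_regular F n) g (young_symmetrizer F n la) | g : 'S_n]>>%VS.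
  apply/memv_span/mapP; exists 1%g; rewrite ?mem_enum //.
  by rewrite left_regularE -symmetrizerE mulr1.
by exists (vsproj _ e); apply: vsprojK.
Qed.

Lemma exists_right_val : exists t : SR, right_val t = e.
Proof.
have eS : e \in <<[seq operator (right_regular F n) g (young_symmetrizer F n la) | g : 'S_n]>>%VS.
  apply/memv_span/mapP; exists 1%g; rewrite ?mem_enum //.
  by rewrite right_regularE -symmetrizerE mul1r.
by exists (vsproj _ e); apply: vsprojK.
Qed.

Lemma left_val_linear : linear left_val. Proof. exact: linearP. Qed.
Lemma right_val_linear : linear right_val. Proof. exact: linearP. Qed.
Lemma left_val_inj : injective left_val. Proof. exact: subvs_inj. Qed.
Lemma right_val_inj : injective right_val. Proof. exact: subvs_inj. Qed.

End Specht.

(** * The summand and the simplicity of the standard module *)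

Section Bimodule.
Variables (F : numClosedFieldType) (m n r b : nat) (be : seq nat).
Hypotheses (be_part : intpart b be) (b_le_r : (b <= r)%N)
  (r_be_n : (r + head 0%N be <= n)%N) (r_b_m : (r - b + (b != 0%N) <= m)%N)
  (m_gt0 : (0 < m)%N) (n_gt0 : (0 < n)%N).
Local Notation la := (padded be n).
Local Notation be_le := (b_be_n b_le_r r_be_n).
Local Notation psi := (psi m be_le).
Local Notation X := (standard_basis r b).
Local Notation SL := (specht_left F n la).
Local Notation SR := (specht_right F b be).
Local Notation T := (Delta_tensor F m n r b be).
Local Notation Rel := (Delta_relations F m n r b be).
Local Notation Dl := (Delta F m n r b be).
Local Notation E k := (free_space F (tindex m n k)).
Local Notation diag := (diag F m n).
Local Notation pure t y := (@pure_tensor F SR (free_space F X) t y : T).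
Local Notation e := (symmetrizer F n la).
Local Notation e' := (symmetrizer F b be).

Lemma component_exists (x : X) : exists c : 'Hom(T, SR), forall t y, c (pure t y) = y x *: t.
Proof.
apply: (@tensor_lift F SR (free_space F X) SR (fun t y => y x *: t)) => [y|t] c u v.
  by rewrite scalerDr !scalerA mulrC.
by rewrite !ffunE scalerDl -scalerA.
Qed.

Definition component (x : X) : 'Hom(T, SR) := projT1 (boolp.cid (component_exists x)).

Lemma component_pure x t y : component x (pure t y) = y x *: t.
Proof. by rewrite /component; case: boolp.cid. Qed.

Lemma free_sum (y : free_space F X) : y = \sum_x y x *: basis_vec F x.
Proof.
apply/ffunP=> z; rewrite sum_ffunE (bigD1 z) //= big1 => [|x xz].
  by rewrite !ffunE eqxx addr0 /GRing.scale /= mulr1.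
by rewrite !ffunE eq_sym (negPf xz) scaler0.
Qed.

Lemma component_sum (A : T) : A = \sum_x pure (component x A) (basis_vec F x).
Proof.
apply: (@tensor_ind F SR (free_space F X) T id
  (fun A => \sum_x pure (component x A) (basis_vec F x))) => [//|c B B'|t y].
  rewrite scaler_sumr -big_split; apply: eq_bigr => x _ /=.
  by rewrite -pure_tensorDl linearP.
rewrite {1}(free_sum y).
have lin : linear (fun y => pure t y) by move=> c y1 y2; apply: pure_tensorDr.
rewrite (linear_sumZ lin); apply: eq_bigr => x _; rewrite component_pure.
exact: (esym (pure_tensorZl _ _ _)).
Qed.

(** The bimodule map before dividing by the relations, and with [s] in the whole group algebra. *)
Definition Phi0 (s : galg F 'S_n) (A : T) : E r :=
  \sum_x diag (val x) (psi s (right_val (component x A))).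

Lemma Phi0_linl A : linear (fun s => Phi0 s A).
Proof.
move=> c s s'; rewrite /Phi0 scaler_sumr -big_split; apply: eq_bigr => x _ /=.
by rewrite (psi_linl m be_le) (linearP (diag (val x))).
Qed.

Lemma Phi0_linr s : linear (Phi0 s).
Proof.
move=> c A B; rewrite /Phi0 scaler_sumr -big_split; apply: eq_bigr => x _ /=.
rewrite (linearP (component x)) (right_val_linear c (component x A) (component x B)).
by rewrite (psi_linr m be_le s) (linearP (diag (val x))).
Qed.

Lemma Phi0_sum s I (rr : seq I) (P : pred I) (c : I -> F) (v : I -> T) :
  Phi0 s (\sum_(i <- rr | P i) c i *: v i) = \sum_(i <- rr | P i) c i *: Phi0 s (v i).
Proof. exact: linear_sumZ (Phi0_linr s) _ _ _ _ _. Qed.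

Lemma Phi00 s : Phi0 s 0 = 0.
Proof. by have := Phi0_linr s (-1) 0 0; rewrite !scaler0 addr0 scaleN1r addNr. Qed.

Lemma Phi0B s A B : Phi0 s (A - B) = Phi0 s A - Phi0 s B.
Proof.
by have := Phi0_linr s (-1) B A; rewrite !scaleN1r [A - B]addrC [RHS]addrC.
Qed.

Lemma Phi0_pure s t y : Phi0 s (pure t y) = \sum_x y x *: diag (val x) (psi s (right_val t)).
Proof.
apply: eq_bigr => x _; rewrite component_pure.
have := right_val_linear (y x) t 0; rewrite !addr0 => ->.
have := psi_linr m be_le s (y x) (right_val t) 0; rewrite addr0 => ->.
have -> : psi s 0 = 0.
  by have := psi_linr m be_le s (-1) 0 0; rewrite !scaler0 addr0 scaleN1r addNr.
by rewrite addr0 linearZ.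
Qed.

Lemma sum_V_left (V : lmodType F) (h : 'S_b) (y : free_space F X) (G : X -> V) :
  \sum_z (@V_left F r b h y : free_space F X) z *: G z = \sum_x y x *: G (relabeled h x).
Proof.
under eq_bigr do rewrite matrix_mapE scaler_suml.
rewrite exchange_big; apply: eq_bigr => x _ /=.
rewrite (bigD1 (relabeled h x)) //= big1 => [|z zx]; first by rewrite eqxx mulr1 addr0.
case: eqP => [ez|]; last by rewrite mulr0 scale0r.
by case/eqP: zx; do 2 apply: val_inj.
Qed.

Lemma Phi0_relations s A : A \in Rel -> Phi0 s A = 0.
Proof.
case/memv_sumP=> v vP ->; have -> : \sum_(h : 'S_b) v h = \sum_(h : 'S_b) (1 : F) *: v h.
  by apply: eq_bigr => h _; rewrite scale1r.
rewrite Phi0_sum big1 // => h _; rewrite scale1r; have /memv_imgP[B _ ->] := vP h isT.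
set f := tensor_map _ _; set g := tensor_map _ _.
rewrite lfunE /= lfunE /= -/(f B - g B) Phi0B; apply/eqP; rewrite subr_eq0; apply/eqP.
apply: (@tensor_ind F SR (free_space F X) _ (fun B => Phi0 s (f B)) (fun B => Phi0 s (g B))).
- by move=> c u u'; rewrite linearP Phi0_linr.
- by move=> c u u'; rewrite linearP Phi0_linr.
move=> t y; rewrite /f /g !tensor_mapE !Phi0_pure !id_lfunE right_valM.
have /= -> := sum_V_left h y (fun x => diag (val x) (psi s (right_val t))).
by apply: eq_bigr => x _; rewrite (psi_relabel m be_le h x s (right_val t)).
Qed.

(** The factor [e] makes this work: when stacking leaves the standard diagrams, the module sets the
    result to 0 and [diag_psi_eq0] makes the operator vanish as well. *)
Lemma Phi0_diag d s A :
  diag d (Phi0 (e * s) A) = Phi0 (e * s) (operator T d A).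
Proof.
apply: (@tensor_ind F SR (free_space F X) _ (fun A => diag d (Phi0 (e * s) A))
  (fun A => Phi0 (e * s) (operator T d A))).
- by move=> c u u'; rewrite Phi0_linr linearP.
- by move=> c u u'; rewrite linearP Phi0_linr.
move=> t y; rewrite /= tensor_mapE !Phi0_pure lfunE /= linear_sum.
under [RHS]eq_bigr do rewrite matrix_mapE scaler_suml.
rewrite [RHS]exchange_big; apply: eq_bigr => x _ /=; rewrite linearZ /=.
under eq_bigr do rewrite -scalerA.
rewrite -scaler_sumr diag_comp //; congr (_ *: _).
set c := _ * _; set u := psi _ _; rewrite /ram_mul -/c.
case: (boolP (standard_diagram (stack (val x) d))) => [std|nstd].
  rewrite (bigD1 (Sub _ std)) //= big1 => [|z zs].
    by rewrite !ffunE eqxx /GRing.scale /= mulr1 addr0.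
  rewrite !ffunE; case: eqP => [ez|]; last by rewrite scaler0 scale0r.
  by case/eqP: zs; apply: val_inj; rewrite SubK.
have [ns _ _] := standard_diagramP _ (valP x).
rewrite (diag_psi_eq0 m be_part) ?scaler0 //; last exact: north_singletons_stack.
rewrite big1 // => z _; rewrite !ffunE; case: eqP => [ez|]; last by rewrite scaler0 scale0r.
by case/negP: nstd; rewrite -ez; apply: valP.
Qed.

Lemma Phi0_wreath w s A : wreath_op F r w (Phi0 s A) = Phi0 (s * gbasis F w.2) A.
Proof. by rewrite /Phi0 linear_sum; apply: eq_bigr => x _; rewrite /= diag_wreath psi_wreath. Qed.

(** The quotient lives on a complement of [Rel], and projecting to it changes [A] by a relation
    only. *)
Lemma Phi0_proj s A : Phi0 s (daddv_pi Rel^C Rel A) = Phi0 s A.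
Proof.
have cap : (Rel :&: Rel^C = 0)%VS := capv_compl Rel.
have {2}<- := @daddv_pi_add _ _ Rel Rel^C A cap (_ : A \in (Rel + Rel^C)%VS); last first.
  by rewrite addv_complf memvf.
have rel0 := Phi0_relations s (memv_pi Rel Rel^C A).
have := Phi0_linr s 1 (daddv_pi Rel^C Rel A) (daddv_pi Rel Rel^C A).
by rewrite rel0 !scale1r addr0 [X in _ = Phi0 s X]addrC => ->.
Qed.

Definition lifted (dl : Dl) : T := vsval dl.

Lemma Phi0_Delta d s (dl : Dl) :
  diag d (Phi0 (e * s) (lifted dl)) = Phi0 (e * s) (lifted (operator Dl d dl)).
Proof.
apply: (etrans (Phi0_diag d s (lifted dl))).
apply: (etrans (esym (Phi0_proj (e * s) (operator T d (lifted dl))))).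
by congr (Phi0 _ _); rewrite /lifted quot_operatorE.
Qed.

Lemma lifted_linear : linear lifted. Proof. exact: linearP. Qed.


Lemma lifted0 (dl : Dl) : lifted dl \in Rel -> dl = 0.
Proof.
move=> dR; apply: subvs_inj; apply/eqP; rewrite linear0 -memv0 -(capv_compl Rel).
by apply/memv_capP; split=> //; apply: subvsP.
Qed.

(** Components of a representative are not equivariant; their sums over ['S_b] are, with the same
    image up to the factor [#|'S_b|]. *)
Definition averaged (dl : Dl) (x : X) : SR :=
  \sum_h operator SR h (component (relabeled h x) (lifted dl)).

Lemma right_val_sum (I : finType) (t : I -> SR) : right_val (\sum_i t i) = \sum_i right_val (t i).
Proof. exact: (linear_sum (@vsval _ _ _)). Qed.

Lemma averagedE dl x : right_val (averaged dl x) =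
  \sum_h gbasis F h * right_val (component (relabeled h x) (lifted dl)).
Proof. by rewrite /averaged right_val_sum; apply: eq_bigr => h _; rewrite right_valM. Qed.

Lemma averaged_relabeled dl k x :
  right_val (averaged dl (relabeled k x)) = gbasis F k^-1%g * right_val (averaged dl x).
Proof.
rewrite !averagedE mulr_sumr (reindex_inj (mulgI k^-1%g)) /=; apply: eq_bigr => h _.
by rewrite relabeledM mulKVg mulrA gbasisM.
Qed.

Lemma psi_sumr s (I : finType) (t : I -> galg F 'S_b) :
  psi s (\sum_i t i) = \sum_i psi s (t i).
Proof.
rewrite (eq_bigr (fun i => (1 : F) *: t i)) => [|i _]; last by rewrite scale1r.
by rewrite (linear_sumZ (psi_linr _ _ _)); apply: eq_bigr => i _; rewrite scale1r.
Qed.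

Lemma sum_averaged s dl :
  \sum_x diag (val x) (psi s (right_val (averaged dl x))) = #|'S_b|%:R *: Phi0 s (lifted dl).
Proof.
under eq_bigr do rewrite averagedE psi_sumr linear_sum.
rewrite exchange_big /= (eq_bigr (fun=> Phi0 s (lifted dl))) => [|h _].
  by rewrite sumr_const scaler_nat.
rewrite /Phi0 [RHS](reindex_inj (@relabeled_inj _ _ h)); apply: eq_bigr => x _ /=.
by rewrite psi_relabel.
Qed.

(** Modulo the relations, [#|'S_b|] times a representative is the sum of the tensors of its averaged
    components. *)
Lemma averaged_eq0 dl : (forall x, averaged dl x = 0) -> dl = 0.
Proof.
move=> a0; apply: lifted0; set A := lifted dl.
have nz : #|'S_b|%:R != 0 :> F by rewrite pnatr_eq0 -lt0n; apply/card_gt0P; exists 1%g.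
suff H : #|'S_b|%:R *: A \in Rel by rewrite -[A](scalerK nz) memvZ.
have relP h t x : pure (operator SR h t) (basis_vec F x) - pure t (basis_vec F (relabeled h x)) \in Rel.
  have -> : basis_vec F (relabeled h x) = @V_left F r b h (basis_vec F x).
    rewrite (free_sum (@V_left F r b h (basis_vec F x))) sum_V_left (bigD1 x) //= big1 => [|z zx].
      by rewrite ffunE eqxx scale1r addr0.
    by rewrite ffunE (negPf zx) scale0r.
  apply: (subvP (sumv_sup h _ (subvv _))) => //; apply/memv_imgP.
  exists (pure t (basis_vec F x)); rewrite ?memvf //.
  set f := tensor_map _ _; set g := tensor_map _ _.
  have fE : f (pure t (basis_vec F x)) = pure (operator SR h t) (basis_vec F x).
    by apply: etrans (tensor_mapE _ _ _ _) _; rewrite id_lfunE.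
  have gE : g (pure t (basis_vec F x)) = pure t (@V_left F r b h (basis_vec F x)).
    by apply: etrans (tensor_mapE _ _ _ _) _; rewrite id_lfunE.
  by rewrite -fE -gE [RHS]add_lfunE opp_lfunE.
have sum1 : \sum_x pure (averaged dl x) (basis_vec F x) = 0.
  by apply: big1 => x _; rewrite a0; apply: pure_tensor0l.
have sum2 : \sum_(h : 'S_b) \sum_x pure (component (relabeled h x) A) (basis_vec F (relabeled h x))
    = #|'S_b|%:R *: A.
  rewrite (eq_bigr (fun=> A)) => [|h _]; first by rewrite sumr_const scaler_nat.
  rewrite [RHS]component_sum.
  by rewrite [RHS](reindex_inj (@relabeled_inj _ _ h)).
have sum3 : \sum_x \sum_h (pure (operator SR h (component (relabeled h x) A)) (basis_vec F x) -
    pure (component (relabeled h x) A) (basis_vec F (relabeled h x))) =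
  \sum_x pure (averaged dl x) (basis_vec F x) -
  \sum_(h : 'S_b) \sum_x pure (component (relabeled h x) A) (basis_vec F (relabeled h x)).
  rewrite [X in _ = _ - X]exchange_big -sumrB; apply: eq_bigr => x _.
  by rewrite sumrB /averaged pure_tensor_suml.
have sum4 := etrans sum3 (f_equal2 (fun a c : T => a - c) sum1 sum2).
rewrite -rpredN -sub0r -sum4.
by apply: rpred_sum => x _; apply: rpred_sum => h _; apply: relP.
Qed.


Lemma Phi_exists : exists Phi : 'Hom(tensor SL Dl, E r),
  forall s dl, Phi (pure_tensor s dl) = Phi0 (left_val s) (lifted dl).
Proof.
apply: (@tensor_lift F SL Dl (E r) (fun s dl => Phi0 (left_val s) (lifted dl))) => [dl|s] c u v.
  by rewrite left_val_linear Phi0_linl.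
by rewrite lifted_linear Phi0_linr.
Qed.

(** For a kernel element in the normal form of [tensor_sum], averaging produces an equivariant
    family [u] killed by [equivariant_family_eq0]; [psi_independent] then separates the indices
    [i]. *)
Lemma Phi_injective (Phi : 'Hom(tensor SL Dl, E r)) :
  (forall s dl, Phi (pure_tensor s dl) = Phi0 (left_val s) (lifted dl)) -> lker Phi = 0%VS.
Proof.
move=> PhiE; apply/eqP; rewrite -subv0; apply/subvP=> A; rewrite memv_ker memv0 => /eqP PA.
pose s i := left_val (@unit_vec F SL i); pose dl i : Dl := r2v (row i A).
have AE : A = \sum_i pure_tensor (unit_vec i) (dl i) := tensor_sum A.
have sE i : exists y, s i = e * y by apply: left_val_ideal.
have [y yE] := boolp.choice sE.
pose t i x := right_val (averaged (dl i) x).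
pose u x : E b := \sum_i psi (s i) (t i x).
have u0 : forall x, u x = 0.
  apply: (equivariant_family_eq0 be_part r_b_m m_gt0 (c := fun x g h => \sum_i (row_sum F n la * y i) g * t i x h)).
  - move=> x; transitivity (\sum_i \sum_g \sum_h
        ((row_sum F n la * y i) g * t i x h) *: col_vector F m be_le g h).
      by apply: eq_bigr => i _; rewrite yE -psi_col mulrA.
    rewrite exchange_big; apply: eq_bigr => g _; rewrite exchange_big; apply: eq_bigr => h _ /=.
    by rewrite scaler_suml.
  - move=> p x a; rewrite /u !sum_ffunE; apply: eq_bigr => i _.
    by rewrite /t averaged_relabeled psi_shift invgK.
  under eq_bigr do rewrite linear_sum.
  rewrite exchange_big /=; under eq_bigr do rewrite sum_averaged -PhiE.
  by rewrite -scaler_sumr -linear_sum -AE /= PA scaler0.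
have dl0 i : dl i = 0.
  apply: averaged_eq0 => x; apply: right_val_inj.
  move: i; apply: (psi_independent be_part m_gt0 (s := s)) (u0 x) => // [i|c c0].
    exact: right_val_ideal.
  apply: unit_vec_free; apply: left_val_inj; rewrite -[RHS]c0.
  by rewrite (linear_sumZ (@left_val_linear _ _ _)).
apply/eqP; rewrite AE big1 // => i _; rewrite dl0.
exact: pure_tensor0r.
Qed.

Lemma tensor_space_inr d (u : E r) : operator (tensor_space F m n r) (inr d) u = diag d u.
Proof. by apply/ffunP=> z; rewrite !matrix_mapE; apply: eq_bigr => x _; rewrite compatibleE. Qed.

Lemma tensor_space_complement (U : {vspace tensor_space F m n r}) : submodule U ->
  exists W : {vspace tensor_space F m n r},
     [/\ submodule W, (U + W)%VS = fullv & (U :&: W)%VS = 0%VS].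
Proof.
move=> subU; have [W [sumW capW WP]] := orthogonal_complement U; exists W; split=> //.
move=> w; apply/subvP=> _ /memv_imgP[v /WP Wv ->]; apply/WP=> u uU; case: w => [w|d].
  rewrite /= wreath_op_adj; apply: Wv; apply: (subvP (subU (inl (wreath_inv w)))).
  exact: memv_img.
rewrite tensor_space_inr diag_flip; apply: Wv; rewrite -tensor_space_inr.
by apply: (subvP (subU (inr (flip d)))); apply: memv_img.
Qed.

Lemma Phi_hom (Phi : 'Hom(tensor SL Dl, E r)) :
  (forall s dl, Phi (pure_tensor s dl) = Phi0 (left_val s) (lifted dl)) ->
  @module_hom _ _ (outer_tensor (inflation m SL) Dl) (tensor_space F m n r) Phi.
Proof.
move=> PhiE; apply: (@outer_tensor_hom F _ _ (inflation m SL) Dl (tensor_space F m n r) Phi).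
  move=> w s dl; rewrite [LHS]PhiE.
  apply: etrans (congr1 (fun a => Phi0 a (lifted dl)) (left_valM w.2 s)) _.
  rewrite -Phi0_wreath; congr (wreath_op F r w _); exact: (esym (PhiE s dl)).
move=> d s dl; rewrite [LHS]PhiE tensor_space_inr.
apply: etrans (_ : _ = diag d (Phi0 (left_val s) (lifted dl))) _.
  by have [y ->] := left_val_ideal s; rewrite (Phi0_Delta d y dl).
by congr (diag d _); exact: (esym (PhiE s dl)).
Qed.

Lemma tensor_space_summand :
  direct_summand (tensor_space F m n r) (outer_tensor (inflation m SL) Dl).
Proof.
have [Phi PhiE] := Phi_exists.
apply: (injective_direct_summand (Phi_hom PhiE) (Phi_injective PhiE)).
exact: tensor_space_complement.
Qed.

(** * Simplicity of the standard module *)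

Local Notation theta dl := (Phi0 e (lifted dl)).

(** [theta] is [Phi] on pure tensors with a fixed nonzero left factor. *)
Lemma theta_eq0 (dl : Dl) : theta dl = 0 -> dl = 0.
Proof.
have [Phi PhiE] := Phi_exists; have [s sE] := @exists_left_val F n la.
rewrite -sE -PhiE => P0; have s0 : s != 0.
  apply/eqP=> s0; case/eqP: (@symmetrizer_neq0 F n la); rewrite -sE s0.
  exact: (linear0 (@vsval _ _ _)).
apply: (pure_tensor_eq0r s0).
have : pure_tensor s dl \in lker Phi by rewrite memv_ker P0.
by rewrite (Phi_injective PhiE) memv0 => /eqP.
Qed.

Lemma theta_injective (d1 d2 : Dl) : theta d1 = theta d2 -> d1 = d2.
Proof.
apply: (@linear_injective F Dl (E r) (fun dl => theta dl)) => [c u v|].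
  by rewrite lifted_linear Phi0_linr.
exact: theta_eq0.
Qed.

Lemma theta_operator d (dl : Dl) : diag d (theta dl) = theta (operator Dl d dl).
Proof. by have := Phi0_Delta d 1 dl; rewrite mulr1. Qed.

Lemma psi_symmetrizer_diag (z : ram b b) : north_singletons z ->
  exists a : galg F 'S_b, forall t, diag z (psi e t) = psi e (a * t).
Proof.
move=> ns; case: (boolP (standard_diagram z)) => [std|nstd].
  have [h hP] := diag_psi_standard F m b_le_r r_be_n std.
  exists ((m ^ b)%:R *: gbasis F h) => t; rewrite hP -scalerAl.
  have := psi_linr m be_le e (m ^ b)%:R (gbasis F h * t) 0.
  have psi0 : psi e 0 = 0.
    by have := psi_linr m be_le e (-1) 0 0; rewrite !scaler0 addr0 scaleN1r addNr.
  by rewrite psi0 !addr0.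
exists 0 => t; rewrite mul0r -[e]mulr1 (diag_psi_eq0 m be_part) //.
by have := psi_linr m be_le (e * 1) (-1) 0 0; rewrite !scaler0 addr0 scaleN1r addNr.
Qed.

(** If the module were 0, so would be [Phi0]. But for [x0] with distinct southern vertices in
    distinct outer blocks, [diag] is injective on blind tensors. *)
Lemma Delta_neq0 : (fullv : {vspace Dl}) <> 0%VS.
Proof.
move=> D0; have [x0 x0P] := exists_standard b_le_r.
have [t tE] := @exists_right_val F b be.
have [tau tauP] : exists tau : 'I_b -> 'I_r, forall k, outer (val x0) (inl k) (inr (tau k)).
  by have /standard_diagramP[_ _ /boolp.choice[tau tauP]] := valP x0; exists tau.
have Phi_pi s A : Phi0 s A = 0.
  have piE := vsprojK (memv_pi Rel^C Rel A).
  rewrite -(Phi0_proj s A) -piE.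
  have : vsproj Rel^C (daddv_pi Rel^C Rel A) \in (fullv : {vspace Dl}) by apply: memvf.
  rewrite D0 memv0 => /eqP ->; rewrite linear0.
  exact: Phi00.
have diag0 : diag (val x0) (psi e e') = 0.
  rewrite -(Phi_pi e (pure t (basis_vec F x0))) Phi0_pure (bigD1 x0) //= big1 => [|x nx].
    by rewrite ffunE eqxx scale1r addr0 tE.
  by rewrite ffunE (negPf nx) scale0r.
have tau_inj : injective tau.
  have /standard_diagramP[_ h2 _] := valP x0.
  move=> k l ekl; apply: h2; apply: outer_trans (tauP k) _.
  by rewrite ekl outer_sym.
case/eqP: (psi_symmetrizer_neq0 F be_part be_le m_gt0).
apply/ffunP=> a; rewrite [RHS]ffunE.
(* [y] extends [a] along [tau]; the default elsewhere is harmless, since [x0] imposes no coincidence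
   among southern vertices. *)
pose y : tindex m n r := [ffun i => odflt (Ordinal m_gt0, Ordinal n_gt0)
   (omap a [pick k | tau k == i])].
have yE : [ffun k => y (tau k)] = a.
  apply/ffunP=> k; rewrite !ffunE; case: pickP => [l /eqP/tau_inj -> //|/(_ k)].
  by rewrite eqxx.
have /ffunP/(_ y) := diag0; rewrite (diag_standardE _ (@psi_blind _ _ _ _ _ be_le _ _) (valP x0) tauP).
rewrite yE [RHS]ffunE => /eqP; rewrite mulf_eq0 pnatr_eq0 expn_eq0 -[m == 0%N]negbK -lt0n m_gt0 /=.
have -> : south_compat (val x0) y.
  by apply/south_compatP; split=> i j ij; rewrite (x0P i j) //; apply: inner_outer.
by rewrite mul1r => /eqP.
Qed.

Lemma Delta_simple : simple_module Dl.
Proof.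
split=> [|U subU]; first exact: Delta_neq0.
have [->|U0] := eqVneq U 0%VS; [by left | right].
pose dl : Dl := vpick U; have dlU : dl \in U by apply: memv_pick.
have dl0 : dl != 0 by rewrite vpick0.
pose f := theta dl.
have f0 : f != 0 by apply: contraNneq dl0 => /theta_eq0 ->.
(* [f] is a sum of vectors in the images of the [diag (val x)]; if all adjoints killed it, it would
   be orthogonal to itself. *)
have [y py] : exists y : X, diag (flip (val y)) f != 0.
  apply/existsP; apply: contraNT f0; rewrite negb_exists => /forallP H.
  apply/eqP/dot_eq0; rewrite {2}/f /dot.
  transitivity (\sum_x dot (diag (flip (val x)) f) (psi e (right_val (component x (lifted dl))))).
    under [RHS]eq_bigr do rewrite dotC -diag_flip -dotC.
    rewrite /dot exchange_big; apply: eq_bigr => z _; rewrite sum_ffunE rmorph_sum mulr_sumr.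
    by [].
  apply: big1 => x _; have := H x; rewrite negbK => /eqP ->.
  by rewrite /dot big1 // => z _; rewrite ffunE mul0r.
have ns_y (x : X) : north_singletons (stack (val x) (flip (val y))).
  by apply: north_singletons_stack; have /standard_diagramP[] := valP x.
have /boolp.choice[a aP] (x : X) := psi_symmetrizer_diag (ns_y x).
pose c (x : X) : F := m%:R ^+ deleted (ram_val (val x)).1 (ram_val (flip (val y))).1 *
   n%:R ^+ deleted (ram_val (val x)).2 (ram_val (flip (val y))).2.
pose t := \sum_x c x *: (a x * right_val (component x (lifted dl))).
have pE : diag (flip (val y)) f = psi e t.
  rewrite /t (linear_sumZ (psi_linr _ _ _)) /f linear_sum; apply: eq_bigr => x _.
  by rewrite /= diag_comp // aP.
have t0 : t != 0.
  apply: contraNneq py => t0; rewrite pE t0.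
  by have := psi_linr m be_le e (-1) 0 0; rewrite !scaler0 addr0 scaleN1r addNr => ->.
have [z tz] : exists z, t = z * e'.
  have /boolp.choice[z zE] x := right_val_ideal (component x (lifted dl)).
  exists (\sum_x c x *: (a x * z x)); rewrite /t mulr_suml; apply: eq_bigr => x _.
  by rewrite zE mulrA scalerAl.
(* Since [t] is a nonzero element of the left ideal, faithfulness and the sandwich property recover
   [e'] from it. *)
have [x' [mu [mu0 muE]]] : exists x' mu, mu != 0 /\ e' * x' * t = mu *: e'.
  apply: boolp.contrapT => none; case/eqP: t0; rewrite tz.
  apply: left_ideal_faithful => x'; rewrite -tz.
  have [mu muE] := symmetrizer_sandwich (sumn_be be_part) (x' * z : galg F 'S_b).
  have muE' : e' * x' * t = mu *: e' by rewrite -muE tz !mulrA.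
  apply: boolp.contrapT => nz; apply: none; exists x', mu; split=> //.
  by apply/eqP=> mu0; apply: nz; rewrite muE' mu0 scale0r.
(* The image of [U] in tensor space, where the diagrams on different numbers of vertices can be
   composed. *)
pose thetaU (v : E r) := exists2 dl', dl' \in U & v = theta dl'.
have thetaU_lin k v v' : thetaU v -> thetaU v' -> thetaU (k *: v + v').
  case=> d1 U1 -> [d2 U2 ->]; exists (k *: d1 + d2); first by rewrite memvD ?memvZ.
  by rewrite lifted_linear Phi0_linr.
have thetaU0 : thetaU 0.
  exists 0; first exact: mem0v.
  have -> : lifted 0 = 0 by exact: (linear0 (@vsval _ _ _)).
  by rewrite Phi00.
(* The vector [psi e t] is [diag (flip (val y)) f], so applying [diag (val x)] amounts, up to a
   scalar, to the action on [f] of the diagram stacked from [flip (val y)] and [val x]. *)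
have inU (x : X) : thetaU (diag (val x) (psi e t)).
  rewrite -pE diag_comp // /f theta_operator.
  set k := _ * _; have := thetaU_lin k (theta (operator Dl (stack (flip (val y)) (val x)) dl)) 0.
  rewrite addr0; apply=> //; eexists; last by [].
  by apply: (subvP (subU _)); apply: memv_img.
have inUa (x : X) (q : galg F 'S_b) : thetaU (diag (val x) (psi e (q * t))).
  rewrite (galgE q) mulr_suml; under eq_bigr do rewrite -scalerAl.
  rewrite (linear_sumZ (psi_linr _ _ _)) linear_sum; elim/big_rec: _ => // h v _ IH /=.
  rewrite linearZ; apply: thetaU_lin => //=; rewrite -psi_relabel; exact: inU.
have thetaUall (dl1 : Dl) : thetaU (theta dl1).
  rewrite /Phi0; elim/big_rec: _ => // x v _ IH; rewrite -[diag _ _]scale1r; apply: thetaU_lin => //.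
  have [w wE] := right_val_ideal (component x (lifted dl1)); rewrite wE.
  (* An arbitrary component is thus a left multiple of [t], to which [inUa] applies. *)
  have -> : w * e' = (mu^-1 *: (w * e' * x')) * t.
    by rewrite -scalerAl -[w * e' * x']mulrA -[w * _ * t]mulrA muE -scalerAr scalerA mulVf // scale1r.
  exact: inUa.
have allU (dl1 : Dl) : dl1 \in U.
  by have [dl2 dl2U /theta_injective e12] := thetaUall dl1; rewrite e12.
by apply/vspaceP=> dl1; rewrite memvf; apply: allU.
Qed.

End Bimodule.

Theorem theorem7p1 (R : realType) (m n r b : nat) (be : seq nat)
  (hm : (0 < m)%N) (hn : (0 < n)%N) (hr : (0 < r)%N)
  (hbe : intpart b be) (hbr : (b <= r)%N)
  (hn_large : (r + head 0 be <= n)%N)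
  (hm_large : (r - b + (b != 0) <= m)%N) :
  direct_summand (tensor_space R[i] m n r)
    (outer_tensor (inflation m (specht_left R[i] n (padded be n)))
                  (Delta R[i] m n r b be))
  /\ (simple_module (L R[i] m n r b be)
      /\ module_iso (Delta R[i] m n r b be) (L R[i] m n r b be)).
Proof.
split; first exact: (@tensor_space_summand R[i]).
by apply: simple_head; apply: (@Delta_simple R[i]).
Qed.
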